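(* Let $N\ge1$, $1<p<2$ and $0<s<1$, and consider the Cauchy problem for $\partial_tu+\mathcal L_{s,p}u=0$ in $\mathbb R^N\times(0,\infty)$ with initial data $u_0(x)=A|x|^\gamma$, $A>0$, $\gamma<0$. Let $\gamma_2=\max\{-N,-sp/(2-p)\}<0$. (i) For every $\gamma\in(\gamma_2,0)$ and every $A>0$ there exists a unique self-similar solution of the first kind for this problem (solutions being taken as minimal solutions), of the form $$u(x,t)=t^{\gamma\beta}F(xt^{-\beta}),\qquad \beta=\frac1{sp+\gamma(2-p)}>0 .$$ $F$ is continuous, positive and bounded, and $\gamma\beta=\dfrac{\gamma}{sp+\gamma(2-p)}<0$. (ii) $F(y)$ is monotone decreasing in $r=|y|$, and $\|u(t)\|_\infty$ decays according to $$u(x,t)\le u(0,t)=F(0)\,t^{-\alpha},\qquad \alpha=|\gamma|\beta>\frac{|\gamma|}{sp}.$$ The time exponent $\alpha=|\gamma|\beta>0$ increases with $|\gamma|$. (iii) In all cases the profile is continuous and locally bounded, and as $|y|\to\infty$ it decays in the precise way $F(y)\sim A|y|^\gamma$.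
   Context: Let $\Phi_p(z)=|z|^{p-2}z$ and $\mathcal L_{s,p}(u)(x)=P.V.\int_{\mathbb R^N}\frac{\Phi_p(u(x)-u(y))}{|x-y|^{N+sp}}\,dy$. In $L^2(\mathbb R^N)$ it is the subdifferential of the convex functional $J(u)=\frac1{2p}\iint\frac{|u(x)-u(y)|^p}{|x-y|^{N+sp}}\,dxdy$; it generates a contraction semigroup $S_t$ which extends to an order-preserving contraction semigroup on every $L^q(\mathbb R^N)$, $1\le q<\infty$; semigroup solutions are $S_tu_0$ with $u_0\in L^q(\mathbb R^N)$. Minimal solution with initial data $u_0\ge0$: the function $u=\lim_nu_n$, where $0\le u_{0,n}\in L^1(\mathbb R^N)\cap L^\infty(\mathbb R^N)$ is a nondecreasing sequence converging monotonically to $u_0$ and $u_n$ is the semigroup solution with data $u_{0,n}$; uniqueness means independence of the approximating sequence. A self-similar solution of the first kind is one of the form $t^{\gamma\beta}F(xt^{-\beta})$ with $\beta=1/(sp+\gamma(2-p))$. *)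

(* Defs.v *)
From HB Require Import structures.
From mathcomp Require Import all_boot all_order all_algebra.
From mathcomp Require Import all_classical all_reals all_analysis.

Set Implicit Arguments.
Unset Strict Implicit.
Unset Printing Implicit Defensive.

Import Order.TTheory GRing.Theory Num.Theory.
Import numFieldNormedType.Exports.

Local Open Scope classical_set_scope.
Local Open Scope ring_scope.

(* Row vectors carry the sigma-algebra generated by the coordinates, i.e., the
   Borel one; lebesgue_rV below is the n-fold product of lebesgue_measure. *)
Section rV_measurable.
Context (R : realType) (n : nat).

Definition rV_coord (i : 'I_n) (x : 'rV[R]_n) : R := x ord0 i.

Definition measure_rV_display : measure_display.
Proof. exact: default_measure_display. Qed.

Let rV_set0 : g_sigma_preimage rV_coord set0.
Proof. exact: sigma_algebra0. Qed.

Let rV_setC A : g_sigma_preimage rV_coord A -> g_sigma_preimage rV_coord (~` A).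
Proof. exact: sigma_algebraC. Qed.

Let rV_bigcup (F : (set 'rV[R]_n)^nat) :
  (forall i, g_sigma_preimage rV_coord (F i)) ->
  g_sigma_preimage rV_coord (\bigcup_i (F i)).
Proof. exact: sigma_algebra_bigcup. Qed.

HB.instance Definition _ := @isMeasurable.Build measure_rV_display
  'rV[R]_n (g_sigma_preimage rV_coord) rV_set0 rV_setC rV_bigcup.

End rV_measurable.


Section lebesgue_rV.
Context (R : realType).

Lemma measurable_rV_coord n (i : 'I_n) :
  measurable_fun [set: 'rV[R]_n] (@rV_coord R n i).
Proof.
move=> _ Y mY; rewrite setTI; apply: sub_sigma_algebra => /=.
rewrite -bigcup_seq/=; exists i => /=; first by rewrite mem_index_enum.
by exists Y => //; rewrite setTI.
Qed.

Lemma measurable_fun_rV d (T : measurableType d) n (f : T -> 'rV[R]_n) :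
  (forall i, measurable_fun [set: T] (fun x => f x ord0 i)) ->
  measurable_fun [set: T] f.
Proof.
move=> mf _ Y mY; rewrite setTI.
pose S : set (set 'rV[R]_n) := [set B | measurable (f @^-1` B)].
suff : S Y by [].
move: Y mY; apply: smallest_sub; first split => /=.
- by rewrite /S/= preimage_set0.
- by move=> B SB; rewrite /S/= setTD -preimage_setC; exact: measurableC.
- move=> F SF; rewrite /S/= preimage_bigcup.
  by apply: bigcupT_measurable => i; exact: SF.
- rewrite -bigcup_seq => B [i _] [A mA <-]; rewrite /S/= setTI.
  by have := mf i measurableT _ mA; rewrite setTI.
Qed.

Definition rV_cons n (p : measurableTypeR R * 'rV[R]_n) : 'rV[R]_n.+1 :=
  row_mx (const_mx p.1 : 'rV_1) p.2.

Lemma measurable_rV_cons n : measurable_fun setT (@rV_cons n).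
Proof.
apply: measurable_fun_rV => i; rewrite /rV_cons.
have [j ->|j ->] := split_ordP (i : 'I_(1 + n)).
  rewrite (_ : (fun _ => _) = fst)//.
  by apply/funext => x; rewrite [LHS](row_mxEl (const_mx x.1 : 'rV_1) x.2) mxE.
rewrite (_ : (fun _ => _) = @rV_coord R n j \o snd).
  by apply: measurableT_comp => //; exact: measurable_rV_coord.
by apply/funext => x; exact: (row_mxEr (const_mx x.1 : 'rV_1) x.2).
Qed.

Definition rV_uncons n (v : 'rV[R]_n.+1) : measurableTypeR R * 'rV[R]_n :=
  (v ord0 ord0, \row_j v ord0 (lift ord0 j)).

Lemma measurable_rV_uncons n : measurable_fun setT (@rV_uncons n).
Proof.
apply/measurable_fun_pairP; split; first exact: (measurable_rV_coord ord0).
apply: measurable_fun_rV => i.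
rewrite (_ : (fun _ => _) = @rV_coord R n.+1 (lift ord0 i)).
  exact: measurable_rV_coord.
by apply/funext => x /=; rewrite mxE.
Qed.

Lemma rV_consK n : cancel (@rV_cons n) (@rV_uncons n).
Proof.
move=> [x v]; rewrite /rV_uncons /rV_cons/=; congr pair.
  rewrite (_ : ord0 = lshift n (ord0 : 'I_1)); last exact/val_inj.
  by rewrite [LHS](row_mxEl (const_mx x : 'rV_1) v) mxE.
apply/rowP => j; rewrite mxE.
rewrite (_ : lift ord0 j = rshift 1 j); last exact/val_inj.
exact: (row_mxEr (const_mx x : 'rV_1) v).
Qed.

Section step.
Context n (m : {sigma_finite_measure set 'rV[R]_n -> \bar R}).

Definition lebesgue_rV_step : set 'rV[R]_n.+1 -> \bar R :=
  pushforward ((@lebesgue_measure R) \x m)%E (@rV_cons n).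

Let step0 : lebesgue_rV_step set0 = 0%E.
Proof. by rewrite /lebesgue_rV_step /pushforward preimage_set0 measure0. Qed.

Let step_ge0 A : (0 <= lebesgue_rV_step A)%E.
Proof. by rewrite /lebesgue_rV_step /pushforward measure_ge0. Qed.

Let step_sigma_additive : semi_sigma_additive lebesgue_rV_step.
Proof.
move=> F mF tF mUF.
have mE A : measurable A -> measurable (@rV_cons n @^-1` A).
  by move=> mA; rewrite -[X in measurable X]setTI; exact: measurable_rV_cons.
rewrite /lebesgue_rV_step /pushforward preimage_bigcup.
apply: measure_semi_sigma_additive.
- by move=> i; exact: mE.
- apply/trivIsetP => /= i j _ _ ij; rewrite -preimage_setI.
  by move/trivIsetP : tF => /(_ _ _ _ _ ij) ->//; rewrite preimage_set0.
- by rewrite -preimage_bigcup; exact: mE.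
Qed.

HB.instance Definition _ := isMeasure.Build _ _ _ lebesgue_rV_step
  step0 step_ge0 step_sigma_additive.

Lemma lebesgue_rV_stepE (A : set (measurableTypeR R)) (B : set 'rV[R]_n) :
  measurable A -> measurable B ->
  lebesgue_rV_step (@rV_uncons n @^-1` (A `*` B)) =
  (lebesgue_measure A * m B)%E.
Proof.
move=> mA mB; rewrite /lebesgue_rV_step /pushforward -comp_preimage.
rewrite (_ : _ \o _ = id); last by apply/funext => x; exact: rV_consK.
by rewrite preimage_id product_measure1E.
Qed.

Let step_sigma_finite : sigma_finite setT lebesgue_rV_step.
Proof.
have /sigma_finiteP[G [GT ndG Gfin]] := sigma_finiteT m.
have : sigma_finite setT (@lebesgue_measure R) by exact: sigma_finiteT.
move=> /sigma_finiteP[H [HT ndH Hfin]].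
exists (fun i => @rV_uncons n @^-1` (H i `*` G i)).
  rewrite -preimage_bigcup; apply/esym/seteqP; split=> // v _.
  have [k _ Hk] : (\bigcup_i H i) (rV_uncons v).1 by rewrite -HT.
  have [l _ Gl] : (\bigcup_i G i) (rV_uncons v).2 by rewrite -GT.
  exists (maxn k l) => //; split.
  - by move: Hk; exact/subsetPset/ndH/leq_maxl.
  - by move: Gl; exact/subsetPset/ndG/leq_maxr.
move=> i; have [mH Hoo] := Hfin i; have [mG Goo] := Gfin i; split.
  rewrite -[X in measurable X]setTI; apply: measurable_rV_uncons => //.
  exact: measurableX.
by rewrite lebesgue_rV_stepE// lte_mul_pinfty// ge0_fin_numE.
Qed.

HB.instance Definition _ := Measure_isSigmaFinite.Build _ _ _ lebesgue_rV_step
  step_sigma_finite.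

End step.

Fixpoint lebesgue_rV n : {sigma_finite_measure set 'rV[R]_n -> \bar R} :=
  match n with
  | 0 => dirac (0 : 'rV[R]_0)
  | n'.+1 => lebesgue_rV_step (lebesgue_rV n')
  end.

Lemma lebesgue_rV_box n (a b : 'rV[R]_n) :
  (forall i, a ord0 i <= b ord0 i) ->
  lebesgue_rV n [set x | forall i, x ord0 i \in `[a ord0 i, b ord0 i]] =
  (\prod_(i < n) (b ord0 i - a ord0 i))%:E.
Proof.
elim: n a b => [|n IH] a b ab.
  rewrite big_ord0/= diracE mem_set//=; by case.
pose a' : 'rV[R]_n := (rV_uncons a).2; pose b' : 'rV[R]_n := (rV_uncons b).2.
pose B := [set x : 'rV[R]_n | forall i, x ord0 i \in `[a' ord0 i, b' ord0 i]].
transitivity (lebesgue_rV n.+1 (@rV_uncons n @^-1` ([set` `[a ord0 ord0, b ord0 ord0]] `*` B))).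
  congr (lebesgue_rV n.+1 _).
  apply/seteqP; split=> x /=.
    by move=> xab; split=> // i; rewrite !mxE.
  move=> [x0 xB] i; have [j ->|->] := unliftP ord0 i; last exact: x0.
  by have := xB j; rewrite !mxE.
rewrite [LHS]lebesgue_rV_stepE//; last first.
  rewrite (_ : B = \bigcap_(i in [set: 'I_n])
      (@rV_coord R n i @^-1` [set` `[a' ord0 i, b' ord0 i]])).
    apply: fin_bigcap_measurable => // i _.
    by rewrite -[X in measurable X]setTI; exact: measurable_rV_coord.
  by apply/seteqP; split=> x /= xB i => [_|]; exact: xB.
rewrite IH; last by move=> i; rewrite !mxE.
rewrite big_ord_recl lebesgue_measure_itv/= lte_fin EFinM; congr (_ * _)%E.
  have := ab ord0; rewrite le_eqVlt => /orP[/eqP ->|->]//.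
  by rewrite ltxx subrr.
by congr EFin; apply: eq_bigr => i _; rewrite !mxE.
Qed.

End lebesgue_rV.

(* `|x| on 'rV is the max norm, hence a separate Euclidean norm. *)
Definition enorm (R : realType) (N : nat) (x : 'rV[R]_N) : R :=
  Num.sqrt (\sum_(i < N) x ord0 i ^+ 2).

Section fractional_p_laplacian.
Context (R : realType) (N : nat) (s p : R).
Local Notation X := 'rV[R]_N.
Local Notation mu := (lebesgue_rV R N).
Implicit Types (u g v w : X -> R).

(* The diagonal, where 0 / 0 evaluates to 0, is negligible. *)
Definition gagliardo_energy u : \bar R :=
  (((2 * p)^-1)%:E * \int[(mu \x mu)%E]_z
    (`|u z.1 - u z.2| `^ p / enorm (z.1 - z.2) `^ (N%:R + s * p))%:E)%E.

(* g is a value at u of the subdifferential in L^2 of the energy, that is, of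
   the operator L_{s,p}. *)
Definition subgradient u g : Prop :=
  [/\ u \in Lfun mu 2%:E, g \in Lfun mu 2%:E &
   forall v, v \in Lfun mu 2%:E ->
    (gagliardo_energy u + (\int[mu]_x (g x * (v x - u x)))%R%:E
      <= gagliardo_energy v)%E].

(* (w' - w) / h + L_{s,p} w' = 0 *)
Definition implicit_step (h : R) (w w' : X -> R) : Prop :=
  subgradient w' (fun x => (w x - w' x) / h).

(* ut = S_t u0, for t > 0, where S is the semigroup generated by the
   subdifferential in the sense of Crandall and Liggett:
     S_t u0 = lim_n (I + (t / n) L_{s,p})^{-n} u0   in L^2;
   w n k is the k-th of n.+1 implicit Euler steps of length t / n.+1. *)
Definition semigroup_at (t : R) (u0 ut : X -> R) : Prop :=
  ut \in Lfun mu 2%:E /\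
  exists w : nat -> nat -> X -> R,
  [/\ forall n, w n 0%N = u0,
      forall n k, (k < n.+1)%N ->
        implicit_step (t / n.+1%:R) (w n k) (w n k.+1) &
      ('N[mu]_2%:E[EFin \o (w n n.+1 \- ut)%R])%E @[n --> \oo] --> 0%E].

Definition semigroup_solution (u0 : X -> R) (u : R -> X -> R) : Prop :=
  [/\ u0 \in Lfun mu 2%:E, u 0 = u0 & forall t, 0 < t -> semigroup_at t u0 (u t)].

Definition approximating_sequence (u0 : X -> R) (u0_ : nat -> X -> R) : Prop :=
  [/\ forall n, u0_ n \in Lfun mu 1%:E /\ u0_ n \in Lfun mu +oo%E,
      \forall x \ae mu, forall n, 0 <= u0_ n x <= u0_ n.+1 x &
      \forall x \ae mu, u0_ n x @[n --> \oo] --> u0 x].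

Definition limit_of_semigroup_solutions (u0_ : nat -> X -> R) (u : R -> X -> R)
    : Prop :=
  exists u_ : nat -> R -> X -> R,
    (forall n, semigroup_solution (u0_ n) (u_ n)) /\
    forall t, 0 < t -> \forall x \ae mu, u_ n t x @[n --> \oo] --> u t x.

Definition minimal_solution (u0 : X -> R) (u : R -> X -> R) : Prop :=
  exists2 u0_, approximating_sequence u0 u0_ & limit_of_semigroup_solutions u0_ u.

Definition unique_minimal_solution (u0 : X -> R) (u : R -> X -> R) : Prop :=
  minimal_solution u0 u /\
  forall u0_, approximating_sequence u0 u0_ -> limit_of_semigroup_solutions u0_ u.

Definition gamma2 : R := Num.max (- N%:R) (- (s * p / (2 - p))).

Definition beta (gamma : R) : R := (s * p + gamma * (2 - p))^-1.

Definition alpha (gamma : R) : R := `|gamma| * beta gamma.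

Definition self_similar (gamma : R) (F : X -> R) (t : R) (x : X) : R :=
  t `^ (gamma * beta gamma) * F (t `^ (- beta gamma) *: x).

(* At x = 0 this is 0 for gamma < 0; only the a.e. class matters. *)
Definition power_data (A gamma : R) (x : X) : R := A * enorm x `^ gamma.

End fractional_p_laplacian.

(* Main.v *)
Require Import Defs.
From HB Require Import structures.
From mathcomp Require Import all_boot all_order all_algebra.
From mathcomp Require Import all_classical all_reals all_analysis.
From mathcomp Require Import measurable_realfun ess_sup_inf ring lra.

Set Implicit Arguments.
Unset Strict Implicit.
Unset Printing Implicit Defensive.

Import Order.TTheory GRing.Theory Num.Theory.
Import numFieldNormedType.Exports.

Local Open Scope classical_set_scope.
Local Open Scope ring_scope.

(** The profile F is obtained from the evolution itself. Write S_t for the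
    semigroup and u0 = A |x|^gamma.

    Existence and uniqueness. For a, l > 0 the map u |-> a u (l x) carries
    solutions to solutions and divides time by a^(p-2) l^(sp). With
    a = t^(gamma beta) and l = t^(-beta), that factor is 1/t and u0 is invariant.
    The bound int (S_t f - S_t g - c)_+ <= int (f - g - c)_+ for c >= 0
    (semigroup_T_contraction) shows that the monotone limit of S_t f_n is the same
    for all sequences f_n increasing to u0 (approximating_semigroup_le). Thus the
    limit at time t is the rescaled limit F0 at time 1 (profile_exists), provided
    that it is finite. That is a smoothing estimate (semigroup_sup): contraction
    against the constant k/4 bounds the measure of {S_t f > k/2}; when that
    measure is small, truncation at level k releases energy because of the mass
    of the singular kernel off a small set (gagliardo_truncate), and the supremum
    M then decays like the solution of M' = - C M^(1 + r), where r > 0 precisely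
    because sp + gamma (2 - p) > 0.

    Regularity. Polarization with respect to a half-space containing the origin
    does not increase the energy (polarize_energy), so the implicit steps preserve
    the order between values at mirror points (implicit_step_polar); having this
    for all half-spaces means that F0 is radially decreasing
    (reflection_radial). The rescaling with a = l^(sp/(2-p)) does not change time
    and for l >= 1 it increases u0, so that F0 x <= l^(sp/(2-p)) F0 (l x)
    (profile_amplification): a decreasing radial function of limited decay has a
    continuous representative (continuous_profile).

    Asymptotics. By self-similarity r^(-gamma) F(r) is the solution on the unit
    sphere at a small time. Let G be a truncation of u0, of finite energy J(G);
    in L^2 it moves by |S_t G - G|^2 <= t J(G) (semigroup_energy). From below, the
    solution dominates S_t G. From above, the integral of (solution - S_t G - e)_+
    is at most that of the part of u0 that G misses near the origin. As F is
    monotone, these integral bounds on thin annuli on either side of the sphere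
    become pointwise (profile_asymptotics_ge, profile_asymptotics_le).

    The semigroup is produced from its definition: J is convex and lower
    semicontinuous on L^2, the implicit steps exist and contract, and Kobayashi's
    estimate makes the Euler chains converge (exponential_formula). Integrals of
    powers of |x| are computed from their behaviour under dilations
    (self_similar_integral), and the effect of isometries and dilations on
    Lebesgue measure from the uniqueness of translation-invariant measures
    (translation_invariant_unique). *)

(** * Implicit Euler scheme for gradient flows in a Hilbert space *)

(** The product ip is only assumed semidefinite: it is used on functions that
    are not identified almost everywhere, and limits need not be unique. *)
Section gradient_flow.
Context (R : realType) (V : lmodType R) (ip : V -> V -> R) (J : V -> \bar R).
Context (ipC : forall u v, ip u v = ip v u)
  (ipDl : forall u v w, ip (u + v) w = ip u w + ip v w)
  (ipZl : forall a u w, ip (a *: u) w = a * ip u w)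
  (ip_ge0 : forall u, 0 <= ip u u).

Definition subdiff (u g : V) := forall v, (J u + (ip g (v - u))%:E <= J v)%E.
Definition euler_step (h : R) (w u : V) := subdiff u (h^-1 *: (w - u)).

Local Notation sq u := (ip u u).

Let ipDr u v w : ip w (u + v) = ip w u + ip w v.
Proof. by rewrite ipC ipDl !(ipC w). Qed.
Let ipZr a u w : ip w (a *: u) = a * ip w u.
Proof. by rewrite ipC ipZl (ipC w). Qed.
Let ipNl u w : ip (- u) w = - ip u w.
Proof. by rewrite -scaleN1r ipZl mulN1r. Qed.
Let ipNr u w : ip w (- u) = - ip w u.
Proof. by rewrite ipC ipNl (ipC w). Qed.
Let ip0 u : ip 0 u = 0.
Proof. by rewrite -(scale0r (0 : V)) ipZl mul0r. Qed.
Let ipE := (ipDl, ipDr, ipNl, ipNr, ipZl, ipZr).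

Let sqB u v : sq (u - v) = sq u - 2 * ip u v + sq v.
Proof. by rewrite !ipE (ipC v u); ring. Qed.
Let sqBC u v : sq (u - v) = sq (v - u).
Proof. by rewrite !sqB (ipC v u); ring. Qed.

Let sqD_weight e u v : 0 < e ->
  sq (u + v) <= (1 + e) * sq u + (1 + e^-1) * sq v.
Proof.
move=> e0; have := ip_ge0 (e *: u - v).
rewrite !ipE (ipC v u) => h.
have -> : sq u + ip u v + (ip u v + sq v) = (1 + e) * sq u + (1 + e^-1) * sq v -
  e^-1 * (e * (e * sq u) - e * ip u v + (- (e * ip u v) + sq v)).
  by field; rewrite gt_eqF.
rewrite gerBl mulr_ge0 ?invr_ge0 ?(ltW e0)//; lra.
Qed.

Let sqB_tri u v w : sq (u - w) <= 2 * sq (u - v) + 2 * sq (v - w).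
Proof.
have -> : u - w = (u - v) + (v - w) by rewrite addrA subrK.
have := @sqD_weight 1 (u - v) (v - w) ltr01; rewrite invr1; lra.
Qed.

Let sq_convex t u v : 0 <= t <= 1 ->
  sq (t *: u + (1 - t) *: v) <= t * sq u + (1 - t) * sq v.
Proof.
move=> /andP[t0 t1]; rewrite !ipE (ipC v u).
have := ip_ge0 (u - v); rewrite sqB => h.
have : 0 <= (t * (1 - t)) * (sq u - 2 * ip u v + sq v).
  by rewrite mulr_ge0// mulr_ge0// subr_ge0.
lra.
Qed.

Context (J_ge0 : forall u, (0 <= J u)%E) (J00 : J 0 = 0%E).

Lemma subdiff_fin u g : subdiff u g -> J u \is a fin_num.
Proof.
move=> /(_ 0); rewrite J00 ge0_fin_numE// ltey.
by case: (J u) (J_ge0 u).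
Qed.

Lemma subdiff_monotone u g v k : subdiff u g -> subdiff v k ->
  0 <= ip (g - k) (u - v).
Proof.
move=> ug vk; have := ug v; have := vk u.
have := subdiff_fin ug; have := subdiff_fin vk.
case: (J u) => [a| |]//; case: (J v) => [b| |]// _ _.
rewrite -!EFinD !lee_fin !ipE; lra.
Qed.

(** Monotonicity of the subdifferential at the two endpoints, expanded. *)
Lemma euler_step_contract h w u w' u' : 0 < h ->
  euler_step h w u -> euler_step h w' u' -> sq (u - u') <= sq (w - w').
Proof.
move=> h0 wu wu'; have := subdiff_monotone wu wu'.
rewrite -scalerBr ipZl pmulr_rge0 ?invr_gt0//.
have := ip_ge0 ((w - w') - (u - u')).
have -> : w - u - (w' - u') = (w - w') - (u - u').
  by rewrite opprD addrACA opprD.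
move: (w - w') (u - u') => a b; rewrite !ipE (ipC b a); lra.
Qed.

(** Monotonicity of the subdifferential at the endpoints of the step, where the
    slope at the starting point is known. *)
Lemma euler_step_move h u g u' : 0 < h -> subdiff u g ->
  euler_step h u u' -> sq (u' - u) <= h ^+ 2 * sq g.
Proof.
move=> h0 ug uu'; have := subdiff_monotone uu' ug.
have := ip_ge0 (h *: g + (u' - u)).
rewrite -[u - u']opprB; move: (u' - u) => d; rewrite !ipE (ipC d g) => h1 h2.
have : 0 <= h * (h^-1 * - sq d - ip g d) by rewrite mulr_ge0// ltW.
rewrite mulrBr mulrA divff ?gt_eqF// mul1r => h3.
rewrite expr2; lra.
Qed.

Section chains.
Context (h : R) (h0 : 0 < h) (x : nat -> V) (n : nat)
  (xS : forall i, (i < n)%N -> euler_step h (x i) (x i.+1)).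

Lemma euler_chain_contract (y : nat -> V) :
  (forall i, (i < n)%N -> euler_step h (y i) (y i.+1)) ->
  forall i, (i < n)%N -> sq (x i.+1 - y i.+1) <= sq (x 1%N - y 1%N).
Proof.
move=> yS; elim => [//|i IH] lin; apply: le_trans (IH (ltnW lin)).
exact: euler_step_contract (xS lin) (yS _ lin).
Qed.

(* Triangle inequality for the norm, in terms of squares: the weights 1/k and k
   are optimal, and k = 0 is a limiting case. *)
Let grow (k : nat) c u v : sq u <= k%:R ^+ 2 * c -> sq v <= c -> 0 <= c ->
  sq (u + v) <= k.+1%:R ^+ 2 * c.
Proof.
case: k => [|k] hu hv c0.
  have u0 : sq u = 0 by apply/eqP; rewrite eq_le ip_ge0 andbT; move: hu; lra.
  have uv e : 0 < e -> sq (u + v) <= c + e.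
    move=> e0; pose d := (c + 1) / e.
    have d0 : 0 < d by rewrite divr_gt0// ltr_pwDr.
    apply: le_trans (sqD_weight u v d0) _; rewrite u0 mulr0 add0r /d invf_div.
    rewrite mulrDl mul1r lerD//.
    apply: (@le_trans _ _ (e / (c + 1) * c)).
      by rewrite ler_wpM2l// divr_ge0// ?ltW//; lra.
    by rewrite mulrAC ler_pdivrMr ?ler_wpM2l ?ltW//; lra.
  rewrite expr1n mul1r; apply/ler_addgt0Pr => e e0; exact: uv.
have k0 : 0 < (k.+1%:R : R) by rewrite ltr0n.
have := sqD_weight u v (_ : 0 < k.+1%:R^-1); rewrite invr_gt0 k0 => /(_ isT).
move=> /le_trans; apply; rewrite invrK.
apply: (@le_trans _ _ ((1 + k.+1%:R^-1) * (k.+1%:R ^+ 2 * c) + (1 + k.+1%:R) * c)).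
  rewrite lerD// ler_wpM2l// ?addr_ge0// ?invr_ge0 ?ler0n//.
rewrite le_eqVlt; apply/orP; left; apply/eqP; rewrite -[k.+2]addn1 natrD.
by field; rewrite gt_eqF.
Qed.

Lemma euler_chain_move g : subdiff (x 0%N) g ->
  forall i, (i <= n)%N -> sq (x i - x 0%N) <= i%:R ^+ 2 * (h ^+ 2 * sq g).
Proof.
move=> xg.
have xd i : (i < n)%N -> sq (x i.+1 - x i) <= h ^+ 2 * sq g.
  elim: i => [|i IH] lin; first exact: euler_step_move (xS lin).
  apply: le_trans (IH (ltnW lin)).
  exact: euler_step_contract (xS lin) (xS (ltnW lin)).
elim => [|i IH] lin; first by rewrite subrr ip0 expr0n mul0r.
have -> : x i.+1 - x 0%N = (x i - x 0%N) + (x i.+1 - x i).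
  by rewrite [RHS]addrC addrA subrK.
apply: grow; [exact: IH (ltnW lin)|exact: xd|].
by rewrite mulr_ge0 ?sqr_ge0.
Qed.

(** A step of length h moves the point by d with d^2 <= h times the drop of J;
    Cauchy-Schwarz over i steps makes the drops telescope. *)
Lemma euler_chain_energy c : J (x 0%N) = c%:E ->
  forall i, (i <= n)%N -> exists2 d, (J (x i) = d%:E) &
    sq (x i - x 0%N) <= i%:R * h * (c - d).
Proof.
move=> Jc; elim => [|i IH] lin.
  exists c => //; by rewrite subrr ip0 !mul0r.
have [d Jd ind] := IH (ltnW lin).
have := xS lin => xx; have := subdiff_fin xx; have := xx (x i); rewrite Jd.
case: (J (x i.+1)) => [b| |]// + _; rewrite -EFinD lee_fin => bd.
exists b => //.
have hb : sq (x i.+1 - x i) <= h * (d - b).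
  move: bd; rewrite ipZl sqBC => bd; rewrite mulrC -ler_pdivrMr//; lra.
have -> : x i.+1 - x 0%N = (x i - x 0%N) + (x i.+1 - x i).
  by rewrite [RHS]addrC addrA subrK.
case: (posnP i) => [i0|i0].
  have -> : x i - x 0%N = 0 by rewrite i0 subrr.
  have dc : d = c by apply/EFin_inj; rewrite -Jd i0.
  by rewrite add0r; apply: le_trans hb _; rewrite dc i0 mul1r.
have i0' : 0 < (i%:R : R) by rewrite ltr0n.
have := sqD_weight (x i - x 0%N) (x i.+1 - x i) (_ : 0 < i%:R^-1).
rewrite invr_gt0 i0' => /(_ isT) /le_trans; apply; rewrite invrK.
apply: (@le_trans _ _ ((1 + i%:R^-1) * (i%:R * h * (c - d)) + (1 + i%:R) * (h * (d - b)))).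
  rewrite lerD// ler_wpM2l// ?addr_ge0// ?invr_ge0 ?ler0n//.
rewrite le_eqVlt; apply/orP; left; apply/eqP; rewrite -[i.+1]addn1 natrD.
by field; rewrite gt_eqF.
Qed.

End chains.

(** Resolvent identity: a step of length h is a step of length k towards the
    same endpoint from a point of the segment. *)
Lemma euler_step_refine h k w u : 0 < k -> 0 < h -> euler_step h w u ->
  euler_step k ((k / h) *: w + (1 - k / h) *: u) u.
Proof.
move=> k0 h0; rewrite /euler_step; congr subdiff.
rewrite scalerBl scale1r -[in RHS]addrA (addrAC u) subrr add0r -scalerBr scalerA.
by congr (_ *: _); field; rewrite !gt_eqF.
Qed.

(** The resolvent identity, contraction and convexity of the square bound the
    distance at (i + 1, j + 1) by the average of those at (i, j) and (i + 1, j)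
    with weights k / h and 1 - k / h; the right-hand side is a supersolution of
    this recursion, and dominates the displacement of one chain on the sides of
    the grid. *)
Lemma kobayashi h k (x y : nat -> V) (n m : nat) g : 0 < k -> k <= h ->
  (forall i, (i < n)%N -> euler_step h (x i) (x i.+1)) ->
  (forall j, (j < m)%N -> euler_step k (y j) (y j.+1)) ->
  x 0%N = y 0%N -> subdiff (x 0%N) g ->
  forall i j, (i <= n)%N -> (j <= m)%N -> sq (x i - y j) <=
    ((i%:R * h - j%:R * k) ^+ 2 + i%:R * h ^+ 2 + j%:R * k ^+ 2) * sq g.
Proof.
move=> k0 kh xS yS xy xg; have h0 : 0 < h by exact: lt_le_trans kh.
have sg0 := ip_ge0 g.
elim => [|i IHi] j lin ljm.
  rewrite xy sqBC; have := euler_chain_move k0 yS (g := g); rewrite -xy.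
  move=> /(_ xg _ ljm) /le_trans; apply.
  rewrite mulrA ler_wpM2r// !mul0r sub0r sqrrN exprMn addr0 lerDl.
  by rewrite mulr_ge0 ?ler0n ?sqr_ge0.
elim: j ljm => [|j IHj] ljm.
  rewrite -xy; have := euler_chain_move h0 xS xg lin => /le_trans; apply.
  rewrite mulrA ler_wpM2r// !mul0r subr0 exprMn addr0 lerDl.
  by rewrite mulr_ge0 ?ler0n ?sqr_ge0.
have := euler_step_contract k0 (euler_step_refine k0 h0 (xS _ lin)) (yS _ ljm).
move=> /le_trans; apply.
set t := k / h.
have t01 : 0 <= t <= 1 by rewrite /t divr_ge0 ?(ltW k0) ?(ltW h0)// ler_pdivrMr// mul1r.
have -> : t *: x i + (1 - t) *: x i.+1 - y j =
    t *: (x i - y j) + (1 - t) *: (x i.+1 - y j).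
  rewrite !scalerBr addrACA; congr (_ + _).
  by rewrite -opprD -scalerDl addrC subrK scale1r.
apply: le_trans (sq_convex _ _ t01) _.
have h1 := IHi j (ltnW lin) (ltnW ljm); have h2 := IHj (ltnW ljm).
have [t0 t1] : 0 <= t /\ 0 <= 1 - t by move: t01; lra.
apply: (le_trans (lerD (ler_wpM2l t0 h1) (ler_wpM2l t1 h2))).
rewrite !mulrA -mulrDl ler_wpM2r// -[i.+1]addn1 -[j.+1]addn1 !natrD.
have -> : k = t * h by rewrite /t divfK ?gt_eqF.
set a : R := i%:R; set b : R := j%:R.
rewrite -subr_ge0; set z := (X in 0 <= X).
have -> : z = 2 * (t * h) ^+ 2 by rewrite /z; ring.
by rewrite mulr_ge0 ?sqr_ge0.
Qed.

Context (J_convex : forall t u v a b, 0 <= t <= 1 -> (J u <= a%:E)%E ->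
    (J v <= b%:E)%E -> (J (t *: u + (1 - t) *: v) <= (t * a + (1 - t) * b)%:E)%E)
  (J_lsc : forall (u : nat -> V) l (c : nat -> R) d,
    ip (u n - l) (u n - l) @[n --> \oo] --> 0 ->
    (forall n, (J (u n) <= (c n)%:E)%E) -> c n @[n --> \oo] --> d ->
    (J l <= d%:E)%E)
  (ip_complete : forall u : nat -> V,
    (forall e, 0 < e -> exists n0, forall m n, (n0 <= m)%N -> (n0 <= n)%N ->
       ip (u m - u n) (u m - u n) <= e) ->
    exists l, ip (u n - l) (u n - l) @[n --> \oo] --> 0).

Let sq_cvg (u : nat -> V) l w : sq (u n - l) @[n --> \oo] --> 0 ->
  sq (u n - w) @[n --> \oo] --> sq (l - w).
Proof.
move=> ul; apply/cvgrPdist_le => e e0.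
have slw := ip_ge0 (l - w).
have [c c0 ci] : exists2 c, 0 < c & c * (e / 2) = sq (l - w) + 1.
  exists ((sq (l - w) + 1) / (e / 2)); first by rewrite !divr_gt0//; lra.
  by rewrite divfK// gt_eqF// divr_gt0.
have e1 : 0 < Num.min (e / 2) (e / 2 / (1 + c)).
  by rewrite lt_min divr_gt0//= divr_gt0// ?divr_gt0//; lra.
move/cvgrPdist_le : ul => /(_ _ e1); apply: filterS => n.
rewrite sub0r normrN ger0_norm// le_min => /andP[ue1 ue2].
have -> : u n - w = (u n - l) + (l - w) by rewrite addrA subrK.
move: (u n - l) (l - w) slw ci ue1 ue2 => a b slw ci ue1 ue2.
have := ip_ge0 (c *: a - b); have := ip_ge0 (c *: a + b).
rewrite !ipE (ipC b a) => h1 h2; have sa := ip_ge0 a.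
have ue2' : (1 + c) * sq a <= e / 2 by move: ue2; rewrite ler_pdivlMr 1?mulrC//; lra.
have h3 : c * (2 * `|ip a b|) <= c * (c * sq a + e / 2).
  case: (ger0P (ip a b)) => _; nra.
have h4 : 2 * `|ip a b| <= c * sq a + e / 2 by rewrite -(ler_pM2l c0).
rewrite ler_norml; apply/andP; split; move: h4; case: (ger0P (ip a b)) => hab; lra.
Qed.

(** The step minimises J + |. - w|^2 / 2h. By the parallelogram identity a
    minimising sequence is Cauchy, lower semicontinuity passes to the limit, and
    the first variation at the minimiser is the subgradient inequality. *)
Lemma euler_step_exists h w : 0 < h -> exists u, euler_step h w u.
Proof.
move=> h0; have [c cE] : exists c : R, c = (2 * h)^-1 by exists (2 * h)^-1.
have c0 : 0 < c by rewrite cE invr_gt0 mulr_gt0.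
pose S := [set r : R | exists v, (J v <= (r - c * sq (v - w))%:E)%E].
have S0 : S !=set0.
  by exists (c * sq (0 - w)), 0; rewrite subrr J00.
have Slb : lbound S 0.
  move=> r [v Jv]; have := le_trans (J_ge0 v) Jv; rewrite lee_fin subr_ge0.
  by apply: le_trans; rewrite mulr_ge0 ?ip_ge0 ?(ltW c0).
have Sinf : has_inf S by split => //; exists 0.
pose m := inf S.
have hv n : exists v, (J v <= (m + n.+1%:R^-1 - c * sq (v - w))%:E)%E.
  have n0 : 0 < (n.+1%:R^-1 : R) by rewrite invr_gt0 ltr0n.
  have [r [v Jv] rm] := inf_adherent n0 Sinf.
  exists v; apply: le_trans Jv _; rewrite lee_fin lerD2r ltW//.
pose u n := sval (cid (hv n)).
have Ju n : (J (u n) <= (m + n.+1%:R^-1 - c * sq (u n - w))%:E)%E.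
  by rewrite /u; case: cid.
have uu i j : sq (u i - u j) <= 4 * h * (i.+1%:R^-1 + j.+1%:R^-1).
  have t01 : 0 <= (2^-1 : R) <= 1 by lra.
  have := J_convex t01 (Ju i) (Ju j).
  set mid := (X in J X) => Jmid.
  have mid_sq : sq (mid - w) = 2^-1 * sq (u i - w) + 2^-1 * sq (u j - w)
      - 4^-1 * sq (u i - u j).
    have -> : mid - w = 2^-1 *: (u i - w) + 2^-1 *: (u j - w).
      rewrite /mid; have -> : 1 - 2^-1 = 2^-1 :> R by lra.
      rewrite !scalerBr addrACA; congr (_ + _).
      by rewrite -opprD -scalerDl -[X in X + X]mul1r -splitr scale1r.
    have -> : u i - u j = (u i - w) - (u j - w) by rewrite opprB addrA subrK.
    move: (u i - w) (u j - w) => a b; by rewrite !ipE (ipC b a); field.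
  pose r := m + 2^-1 * (i.+1%:R^-1 + j.+1%:R^-1) - c * 4^-1 * sq (u i - u j).
  have Sr : S r.
    exists mid; apply: le_trans Jmid _; rewrite lee_fin mid_sq /r.
    by rewrite le_eqVlt; apply/orP; left; apply/eqP; field; rewrite ?lt0r_neq0.
  have := ge_inf (ex_intro _ 0 Slb) Sr; rewrite -/m /r => mr.
  have lin (a b : R) : m <= m + 2^-1 * a - c / 4 * b -> c * b <= 2 * a by lra.
  have := lin _ _ mr.
  rewrite cE mulrC ler_pdivrMr ?mulr_gt0// => /le_trans; apply.
  by rewrite le_eqVlt; apply/orP; left; apply/eqP; ring.
have [l ul] : exists l, sq (u n - l) @[n --> \oo] --> 0.
  apply: ip_complete => e e0.
  have := @cvg_harmonic R; move/cvgrPdist_le => /(_ (e / (8 * h))).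
  rewrite divr_gt0 ?mulr_gt0// => /(_ isT) [n0 _ Hn0].
  exists n0 => i j ni nj; apply: le_trans (uu i j) _.
  have := Hn0 i ni; have := Hn0 j nj; rewrite /= /harmonic !sub0r !normrN.
  rewrite !ger0_norm ?invr_ge0 ?ler0n// => hj hi.
  have := lerD hi hj; rewrite -(ler_pM2l (_ : 0 < 4 * h)) ?mulr_gt0//.
  move=> /le_trans; apply; by rewrite le_eqVlt; apply/orP; left; apply/eqP; field; exact: lt0r_neq0.
have Jl : (J l <= (m - c * sq (l - w))%:E)%E.
  apply: (J_lsc ul Ju); apply: cvgB.
    rewrite -[X in _ --> X]addr0; apply: cvgD; first exact: cvg_cst.
    exact: cvg_harmonic.
  by apply: cvgMr; exact: sq_cvg.
exists l => v; case Jv : (J v) (J_ge0 v) => [b| |]// _; last by rewrite leey.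
set a := m - c * sq (l - w) in Jl.
apply: (@le_trans _ _ (a + ip (h^-1 *: (w - l)) (v - l))%:E).
  by rewrite EFinD leeD2r.
rewrite lee_fin ipZl.
(* First variation on the segment from l to v, before t tends to 0. *)
have key t : 0 < t <= 1 -> 0 <= b - a - h^-1 * ip (w - l) (v - l) + t * (c * sq (v - l)).
  move=> /andP[t0 t1]; have t01 : 0 <= t <= 1 by rewrite ltW.
  have Jvb : (J v <= b%:E)%E by rewrite Jv.
  have := J_convex t01 Jvb Jl; set vt := (X in J X) => Jvt.
  have vtw : vt - w = (l - w) + t *: (v - l).
    rewrite /vt scalerBl scale1r scalerBr addrCA -!addrA; congr (_ + _).
    by rewrite addrA addrC.
  have : S (t * b + (1 - t) * a + c * sq (vt - w)).
    by exists vt; rewrite addrK.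
  move=> /(ge_inf (ex_intro _ 0 Slb)); rewrite -/m vtw.
  have -> : m = a + c * sq (l - w) by rewrite /a subrK.
  have -> : w - l = - (l - w) by rewrite opprB.
  move: (l - w) (v - l) => x y; rewrite !ipE (ipC y x).
  have -> : h^-1 = 2 * c by rewrite cE; field; rewrite gt_eqF.
  move=> hm; rewrite -(pmulr_rge0 _ t0); lra.
rewrite -subr_ge0; apply/ler_addgt0Pr => e e0.
pose d := c * sq (v - l).
have d0 : 0 <= d by rewrite mulr_ge0 ?ip_ge0 ?(ltW c0).
have t01 : 0 < Num.min 1 (e / (d + 1)) <= 1.
  by rewrite lt_min ltr01 ge_min lexx/= divr_gt0//; lra.
have := key _ t01; rewrite -/d => hk.
suff : Num.min 1 (e / (d + 1)) * d <= e by move: hk; lra.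
apply: (@le_trans _ _ (e / (d + 1) * d)).
  by rewrite ler_wpM2r// ge_min lexx orbT.
rewrite mulrAC ler_pdivrMr ?ler_wpM2l ?ltW//; lra.
Qed.

(** The value 0 is only taken for a step length at which no step exists. *)
Definition resolvent h w : V :=
  if pselect (exists u, euler_step h w u) is left e then sval (cid e) else 0.

Lemma resolventP h w : 0 < h -> euler_step h w (resolvent h w).
Proof.
move=> h0; rewrite /resolvent; case: pselect => [e|]; first by case: cid.
by have := euler_step_exists w h0.
Qed.

(** With D h the squared distance of the resolvent to w, monotonicity gives
    |J_k w - J_h w|^2 <= D h - D k for k <= h; so D increases with h, and it
    remains to take D d close to its infimum. No density of the domain of the
    subdifferential is involved: w is arbitrary. *)
Lemma resolvent_cauchy w e : 0 < e -> exists2 d, 0 < d &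
  forall h k, 0 < h <= d -> 0 < k <= d ->
    sq (resolvent h w - resolvent k w) <= e.
Proof.
move=> e0; pose D h := sq (resolvent h w - w).
have key h k : 0 < k -> k <= h ->
    sq (resolvent k w - resolvent h w) <= D h - D k.
  move=> k0 kh; have h0 := lt_le_trans k0 kh.
  have [->|kneh] := eqVneq k h; first by rewrite !subrr ip0.
  have := subdiff_monotone (resolventP w k0) (resolventP w h0).
  rewrite /D; set x := resolvent k w; set y := resolvent h w.
  have -> : x - y = (x - w) - (y - w) by rewrite opprB addrA subrK.
  rewrite -(opprB x) -(opprB y); move: (x - w) (y - w) => {}x {}y.
  rewrite !ipE (ipC y x) => hm.
  have kh' : h^-1 < k^-1 by rewrite ltf_pV2// lt_neqAle kneh.
  have sxy := ip_ge0 (x - y); rewrite sqB in sxy.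
  have h'0 : 0 < h^-1 by rewrite invr_gt0.
  move: hm kh' h'0 sxy ip_ge0; move: (h^-1) (k^-1) => a b hm ab a0 sxy _.
  have h1 : (a + b) * (sq x - 2 * ip x y + sq y) <= (b - a) * (sq y - sq x).
    by lra.
  have ba0 : 0 < b - a by rewrite subr_gt0.
  have ab0 : 0 < a + b by lra.
  have h2 : 0 <= sq y - sq x.
    rewrite -(pmulr_rge0 _ ba0); apply: le_trans h1.
    by rewrite mulr_ge0// ltW.
  suff : sq x - 2 * ip x y + sq y <= sq y - sq x by lra.
  rewrite -(ler_pM2l ab0); apply: le_trans h1 _.
  by rewrite ler_wpM2r//; lra.
have D_ge0 h : 0 <= D h by exact: ip_ge0.
pose S := [set D h | h in [set h | 0 < h]].
have Sinf : has_inf S.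
  split; first by exists (D 1), 1 => /=.
  by exists 0 => _ [h _ <-].
have [_ [d /= d0 <-] Dd] := inf_adherent e0 Sinf.
exists d => // h k.
have lb h' : 0 < h' -> inf S <= D h'.
  by move=> h'0; apply: ge_inf; [exact: Sinf.2|exists h'].
wlog kh : h k / k <= h => [wl|].
  move=> hd kd; have [kh|/ltW hk] := leP k h; first exact: wl.
  by rewrite sqBC; exact: wl.
move=> /andP[h0 hd] /andP[k0 kd]; rewrite sqBC; apply: le_trans (key _ _ k0 kh) _.
have Dhd : D h <= D d.
  by rewrite -subr_ge0; apply: le_trans (key _ _ h0 hd); exact: ip_ge0.
have := lb _ k0; move: Dd; lra.
Qed.

(** The chains are compared with those issued from v = J_d w, which has a finite
    slope, so that the grid estimate applies to them; contraction keeps both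
    families as close as their first points are. *)
Lemma exponential_formula t w : 0 < t ->
  exists l, let x n := iter n.+1 (resolvent (t / n.+1%:R)) w in
    sq (x n - l) @[n --> \oo] --> 0.
Proof.
move=> t0; apply: ip_complete => e e0.
pose h n : R := t / n.+1%:R.
have h0 n : 0 < h n by rewrite divr_gt0.
pose e1 := e / 32.
have e10 : 0 < e1 by rewrite divr_gt0.
have [d d0 Hd] := resolvent_cauchy w e10.
pose v := resolvent d w; pose g := d^-1 *: (w - v).
have vg : subdiff v g by exact: resolventP.
have sg0 := ip_ge0 g.
have [n0 Hn0] : exists n0, forall n, (n0 <= n)%N ->
    h n <= d /\ h n * (h n + t) * sq g <= e1.
  pose c := Num.min d (Num.min 1 (e1 / ((1 + t) * (sq g + 1)))).
  have c0 : 0 < c.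
    by rewrite !lt_min d0 ltr01/= divr_gt0// mulr_gt0//; lra.
  have := @cvg_harmonic R; move/cvgrPdist_le => /(_ (c / t)).
  rewrite divr_gt0// => /(_ isT) [n0 _ Hn0]; exists n0 => n n0n.
  have := Hn0 n n0n; rewrite /= sub0r normrN ger0_norm ?invr_ge0 ?ler0n//.
  rewrite ler_pdivlMr// mulrC -/(h n) !le_min => /and3P[hd h1 he].
  split => //.
  apply: (@le_trans _ _ (h n * ((1 + t) * (sq g + 1)))).
    rewrite -mulrA ler_wpM2l// ?(ltW (h0 n))// ler_pM// ?lerD2r//; last by lra.
    by rewrite addr_ge0// ltW.
  by rewrite -ler_pdivlMr// mulr_gt0//; lra.
pose X n k := iter k (resolvent (h n)) w.
pose Y n k := iter k (resolvent (h n)) v.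
have XS n k : euler_step (h n) (X n k) (X n k.+1) by exact: resolventP.
have YS n k : euler_step (h n) (Y n k) (Y n k.+1) by exact: resolventP.
have XY n : (n0 <= n)%N -> sq (X n n.+1 - Y n n.+1) <= 4 * e1.
  move=> n0n; have [hd he] := Hn0 _ n0n.
  have := @euler_chain_contract (h n) (h0 n) (X n) n.+1 (fun i _ => XS n i)
    (Y n) (fun i _ => YS n i) n (ltnSn n).
  move=> /le_trans; apply; apply: le_trans (sqB_tri _ v _) _.
  have h1 : sq (X n 1%N - v) <= e1 by apply: Hd; rewrite ?h0 ?d0 /=.
  have h2 : sq (v - Y n 1%N) <= e1.
    rewrite sqBC; apply: le_trans (euler_step_move (h0 n) vg (YS n 0%N)) _.
    apply: le_trans he; rewrite ler_wpM2r// expr2 ler_wpM2l// ?(ltW (h0 n))//.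
    by rewrite lerDl ltW.
  by lra.
have YY n m : (n0 <= n)%N -> (n0 <= m)%N -> sq (Y n n.+1 - Y m m.+1) <= 2 * e1.
  wlog hmn : n m / h m <= h n => [wl nn mm|].
    have [|/ltW hnm] := leP (h m) (h n); first by move=> ?; exact: wl.
    by rewrite sqBC; exact: wl.
  move=> /Hn0[_ hn] /Hn0[_ hm].
  have := @kobayashi (h n) (h m) (Y n) (Y m) n.+1 m.+1 g (h0 m) hmn
    (fun i _ => YS n i) (fun i _ => YS m i) erefl vg n.+1 m.+1 (leqnn _) (leqnn _).
  move=> /le_trans; apply.
  have ht k : k.+1%:R * h k = t by rewrite /h mulrC divfK.
  have -> : (n.+1%:R * h n - m.+1%:R * h m) ^+ 2 + n.+1%:R * h n ^+ 2 +
      m.+1%:R * h m ^+ 2 = (n.+1%:R * h n - m.+1%:R * h m) ^+ 2 +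
      n.+1%:R * h n * h n + m.+1%:R * h m * h m by ring.
  rewrite !ht subrr expr0n/= add0r mulrDl.
  have hh k : t * h k * sq g <= h k * (h k + t) * sq g.
    by rewrite ler_wpM2r// (mulrC t) ler_wpM2l ?(ltW (h0 k))// lerDr ltW.
  have := hh n; have := hh m; lra.
exists n0 => m n mm nn; rewrite -/(X _ _) -/(X n _).
have h1 := XY _ mm; have h2 := XY _ nn; have h3 := YY _ _ mm nn.
apply: le_trans (sqB_tri _ (Y m m.+1) _) _.
have := sqB_tri (Y m m.+1) (Y n n.+1) (X n n.+1); rewrite (sqBC (Y n n.+1)) => h4.
rewrite /e1 in h1 h2 h3; lra.
Qed.

End gradient_flow.

(** * Integrals of nonnegative functions *)

Lemma cvgn_EFin (R : realType) (u : nat -> R) l :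
  u n @[n --> \oo] --> l -> ((u n)%:E @[n --> \oo] --> l%:E)%E.
Proof. by move=> ul; apply: cvg_EFin => //; exact: nearW. Qed.

Section nonneg_integrals.
Context d (T : measurableType d) (R : realType) (mu : {measure set T -> \bar R}).
Implicit Types f g : T -> R.
Local Open Scope ereal_scope.

Lemma le_int f g : measurable_fun setT f -> measurable_fun setT g ->
  (forall x, (0 <= f x)%R) -> (forall x, (f x <= g x)%R) ->
  \int[mu]_x (f x)%:E <= \int[mu]_x (g x)%:E.
Proof.
move=> mf mg f0 fg; apply: ge0_le_integral => //=.
- by move=> x _; rewrite lee_fin.
- exact/measurable_EFinP.
- exact/measurable_EFinP.
- by move=> x _; rewrite lee_fin.
Qed.

Lemma le_int_ae f g : measurable_fun setT f -> measurable_fun setT g ->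
  (forall x, (0 <= f x)%R) -> (forall x, (0 <= g x)%R) ->
  (\forall x \ae mu, (f x <= g x)%R) ->
  \int[mu]_x (f x)%:E <= \int[mu]_x (g x)%:E.
Proof.
move=> mf mg f0 g0 fg; apply: ae_ge0_le_integral => //=.
- by move=> x _; rewrite lee_fin.
- exact/measurable_EFinP.
- by move=> x _; rewrite lee_fin.
- exact/measurable_EFinP.
- by apply: filterS fg => x fgx _; rewrite lee_fin.
Qed.

Lemma intD f g : measurable_fun setT f -> measurable_fun setT g ->
  (forall x, (0 <= f x)%R) -> (forall x, (0 <= g x)%R) ->
  \int[mu]_x (f x + g x)%:E = \int[mu]_x (f x)%:E + \int[mu]_x (g x)%:E.
Proof.
move=> mf mg f0 g0.
rewrite -ge0_integralD//=.
- by move=> x _; rewrite lee_fin.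
- exact/measurable_EFinP.
- by move=> x _; rewrite lee_fin.
- exact/measurable_EFinP.
Qed.

Lemma intZ (c : R) f : measurable_fun setT f ->
  (forall x, (0 <= f x)%R) -> (0 <= c)%R ->
  \int[mu]_x (c * f x)%:E = c%:E * \int[mu]_x (f x)%:E.
Proof.
move=> mf f0 c0; rewrite -ge0_integralZl_EFin//=.
- by move=> x _; rewrite lee_fin.
- exact/measurable_EFinP.
Qed.

Lemma int_eq0_ae f : measurable_fun setT f -> (forall x, (0 <= f x)%R) ->
  \int[mu]_x (f x)%:E = 0 -> \forall x \ae mu, f x = 0%R.
Proof.
move=> mf f0 If.
have : \int[mu]_x `|(f x)%:E| = 0.
  by rewrite -[RHS]If; apply: eq_integral => x _; rewrite gee0_abs// lee_fin.
move/ae_eq_integral_abs => /(_ measurableT) h.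
suff h' : measurable_fun setT (fun x => (f x)%:E).
  by apply: filterS (h h') => x /(_ I) [].
exact/measurable_EFinP.
Qed.

Lemma fatou_ae (f_ : nat -> T -> R) f (C : \bar R) :
  (forall n, measurable_fun setT (f_ n)) -> measurable_fun setT f ->
  (forall n x, (0 <= f_ n x)%R) -> (forall x, (0 <= f x)%R) ->
  (\forall x \ae mu, f_ n x @[n --> \oo] --> f x) ->
  (\forall n \near \oo, \int[mu]_x (f_ n x)%:E <= C) ->
  \int[mu]_x (f x)%:E <= C.
Proof.
move=> mf_ mf f_0 f0 ff fC.
have mef n : measurable_fun setT (fun x => (f_ n x)%:E) by exact/measurable_EFinP.
have -> : \int[mu]_x (f x)%:E =
    \int[mu]_x limn_einf (fun n => (f_ n x)%:E).
  apply: ge0_ae_eq_integral => //=.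
  - exact/measurable_EFinP.
  - rewrite [X in measurable_fun _ X](_ : _ =
      fun x => - limn_esup (fun n => - (f_ n x)%:E)); last first.
      by apply/funext => x; rewrite -limn_einfN; congr limn_einf; apply/funext => n /=; rewrite opprK.
    apply: measurableT_comp => //; apply: measurable_fun_limn_esup => n.
    exact: measurableT_comp.
  - by move=> x _; rewrite lee_fin.
  - move=> x _; rewrite limn_einf_lim; apply: lime_ge.
      exact: is_cvg_einfs.
    by near=> n; apply: le_ereal_inf_tmp => _ [m /= _ <-]; rewrite lee_fin.
  - apply: filterS ff => x fx _.
    have fx' : (f_ n x)%:E @[n --> \oo] --> (f x)%:E by exact: cvgn_EFin.
    rewrite is_cvg_limn_einfE; last by apply/cvg_ex; eexists; exact: fx'.
    by apply/esym/cvg_lim.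
apply: (@le_trans _ _ (limn_einf (fun n => \int[mu]_x (f_ n x)%:E))).
  by apply: fatou => // n x _; rewrite lee_fin.
rewrite limn_einf_lim; apply: lime_le; first exact: is_cvg_einfs.
case: fC => n0 _ fC; exists n0 => // n /= n0n.
apply: le_trans (fC n n0n); apply: ereal_inf_lbound; exists n => //=.
Unshelve. all: by end_near.
Qed.

(** The sum of the functions 4^n f_n^2 has a finite integral, so it is finite
    almost everywhere, and it bounds each of its terms. *)
Lemma ae_geometric (f_ : nat -> T -> R) : (forall n, measurable_fun setT (f_ n)) ->
  (forall n, \int[mu]_x (f_ n x ^+ 2)%:E <= (8^-1 ^+ n)%:E) ->
  \forall x \ae mu, exists C : R, forall n, (`|f_ n x| <= C * 2^-1 ^+ n)%R.
Proof.
move=> mf fn.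
pose g n x : \bar R := (4 ^+ n * f_ n x ^+ 2)%:E.
have g0 n x : 0 <= g n x by rewrite lee_fin; apply: mulr_ge0; [exact: exprn_ge0|exact: sqr_ge0].
have mg n : measurable_fun setT (g n).
  apply/measurable_EFinP; apply: measurable_funM => //.
  exact: measurable_funX.
pose S x := \sum_(n <oo) g n x.
have mS : measurable_fun setT S.
  exact: ge0_emeasurable_sum.
have IS : \int[mu]_x S x <= (2 : R)%:E.
  rewrite /S integral_nneseries//.
  apply: (@le_trans _ _ (\sum_(n <oo) (2^-1 ^+ n)%:E)).
    apply: lee_nneseries => [n *|n *]; first by apply: integral_ge0.
    rewrite /g intZ//; last by move=> x; exact: sqr_ge0.
      apply: (@le_trans _ _ ((4 ^+ n)%:E * (8^-1 ^+ n)%:E)).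
        by rewrite lee_pmul2l// lte_fin exprn_gt0.
      by rewrite -EFinM lee_fin -exprMn le_eqVlt; apply/orP; left; apply/eqP; congr (_ ^+ _)%R; field.
    exact: measurable_funX.
  have := @cvg_geometric_series R 1 2^-1.
  rewrite ger0_norm// invf_lt1// ltr1n => /(_ isT) h.
  have -> : \sum_(n <oo) (2^-1 ^+ n)%:E = (2 : R)%:E; last by [].
  apply/cvg_lim => //.
  have e2 : (1 / (1 - 2^-1) = 2 :> R)%R by field.
  rewrite e2 in h.
  apply: cvg_trans (cvgn_EFin h) => /=.
  rewrite (_ : (fun n => _) = (EFin \o series (geometric 1 2^-1)))//.
  apply/funext => n /=; rewrite /series /= sumEFin; congr EFin.
  by apply: eq_bigr => i _; rewrite /geometric /= mul1r.
have iS : mu.-integrable setT S.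
  apply/integrableP; split => //.
  apply: (@le_lt_trans _ _ (2 : R)%:E); last by rewrite ltry.
  apply: le_trans IS; rewrite le_eqVlt; apply/orP; left; apply/eqP.
  by apply: eq_integral => x _; rewrite gee0_abs// nneseries_ge0.
have := integrable_ae measurableT iS.
apply: filterS => x /(_ I) Sx.
exists (Num.sqrt (fine (S x))) => n.
have gS : (4 ^+ n * f_ n x ^+ 2 <= fine (S x))%R.
  rewrite -lee_fin fineK//.
  apply: (@le_trans _ _ (\sum_(0 <= i < n.+1) g i x)); last first.
    by apply: nneseries_lim_ge => *; exact: g0.
  by rewrite big_nat_recr//= leeDr// sume_ge0.
rewrite exprVn ler_pdivlMr ?exprn_gt0// -[leLHS]ger0_norm ?mulr_ge0 ?exprn_ge0//.
rewrite -sqrtr_sqr ler_wsqrtr// exprMn real_normK ?num_real//.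
have -> : ((2 ^+ n) ^+ 2 = 4 ^+ n :> R)%R by rewrite -exprM mulnC exprM -natrX.
by rewrite mulrC.
Qed.

End nonneg_integrals.

(** * Square-integrable functions *)

Section square_integrable.
Context d (T : measurableType d) (R : realType) (mu : {measure set T -> \bar R}).
Implicit Types f g h : T -> R.
Local Notation L2 := (Lfun mu 2%:E).

Definition ipL2 f g : R := \int[mu]_x (f x * g x).

Lemma L2_measurable f : f \in L2 -> measurable_fun setT f.
Proof. by rewrite inE => /andP[/[!inE]]. Qed.

Lemma L2_lty f : f \in L2 -> (\int[mu]_x (f x ^+ 2)%:E < +oo)%E.
Proof.
move=> /Lfun2_integrable_sqr/integrableP[_]; apply: le_lt_trans.
by under [leRHS]eq_integral do rewrite gee0_abs ?lee_fin ?sqr_ge0//.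
Qed.

Lemma L2P f : measurable_fun setT f -> (\int[mu]_x (f x ^+ 2)%:E < +oo)%E ->
  f \in L2.
Proof.
move=> mf fy; rewrite inE; apply/andP; split; rewrite inE//=.
rewrite /finite_norm unlock /=; apply: poweR_lty; apply: le_lt_trans fy.
rewrite le_eqVlt; apply/orP; left; apply/eqP; apply: eq_integral => x _.
by rewrite /= powR_mulrn// -normrX ger0_norm// sqr_ge0.
Qed.

Lemma L2_le f g : measurable_fun setT f -> g \in L2 ->
  (forall x, `|f x| <= `|g x|) -> f \in L2.
Proof.
move=> mf gL fg; apply: L2P => //; apply: le_lt_trans (L2_lty gL).
have mg := L2_measurable gL.
apply: le_int => [|||x]; [exact: measurable_funX|exact: measurable_funX| |].
  by move=> x; exact: sqr_ge0.
by rewrite -[X in X <= _]real_normK ?num_real// -[leRHS]real_normK ?num_real// lerXn2r ?nnegrE.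
Qed.

Lemma L2D f g : f \in L2 -> g \in L2 -> (fun x => f x + g x) \in L2.
Proof.
move=> fL gL; have mf := L2_measurable fL; have mg := L2_measurable gL.
have mf2 := measurable_funX 2 mf; have mg2 := measurable_funX 2 mg.
apply: L2P; first exact: measurable_funD.
apply: (@le_lt_trans _ _ (\int[mu]_x (2 * f x ^+ 2 + 2 * g x ^+ 2)%:E)%E).
  apply: le_int => [||x|x].
  - by apply: measurable_funX; exact: measurable_funD.
  - by apply: measurable_funD; exact: measurable_funM.
  - exact: sqr_ge0.
  - by have := sqr_ge0 (f x - g x); rewrite sqrrB sqrrD; lra.
rewrite intD; [|exact: measurable_funM|exact: measurable_funM| |]; last 2 first.
- by move=> x; rewrite mulr_ge0// sqr_ge0.
- by move=> x; rewrite mulr_ge0// sqr_ge0.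
rewrite !intZ//; last 2 first.
- by move=> x; exact: sqr_ge0.
- by move=> x; exact: sqr_ge0.
by rewrite lte_add_pinfty// lte_mul_pinfty// ?L2_lty.
Qed.

Lemma L2Z c f : f \in L2 -> (fun x => c * f x) \in L2.
Proof.
move=> fL; have mf := L2_measurable fL; have mf2 := measurable_funX 2 mf.
apply: L2P; first exact: measurable_funM.
under eq_integral do rewrite exprMn.
rewrite intZ ?sqr_ge0//; last by move=> x; exact: sqr_ge0.
by rewrite lte_mul_pinfty ?lee_fin ?sqr_ge0// L2_lty.
Qed.

Lemma L2B f g : f \in L2 -> g \in L2 -> (fun x => f x - g x) \in L2.
Proof.
move=> fL gL; have := L2D fL (L2Z (-1) gL).
by under eq_fun do rewrite mulN1r.
Qed.

Lemma L2_0 : (fun=> 0 : R) \in L2.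
Proof.
apply: L2P => //; under eq_integral do rewrite expr0n/=.
by rewrite integral0 ltry.
Qed.

Lemma L2_integrableM f g : f \in L2 -> g \in L2 ->
  mu.-integrable setT (fun x => (f x * g x)%:E).
Proof. by move=> fL gL; have /Lfun1_integrable := Lfun2_mul_Lfun1 fL gL. Qed.

Lemma ipL2E f : f \in L2 -> (ipL2 f f)%:E = (\int[mu]_x (f x ^+ 2)%:E)%E.
Proof.
move=> fL; rewrite /ipL2 /Rintegral fineK.
  by apply: eq_integral => x _; rewrite expr2.
apply: integrable_fin_num => //; exact: L2_integrableM.
Qed.

Lemma ipL2_ge0 f : 0 <= ipL2 f f.
Proof. by apply: Rintegral_ge0 => x _; rewrite -expr2 sqr_ge0. Qed.

Lemma ipL2C f g : ipL2 f g = ipL2 g f.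
Proof. by apply: eq_Rintegral => x _; rewrite mulrC. Qed.

Lemma ipL2Dl f g h : f \in L2 -> g \in L2 -> h \in L2 ->
  ipL2 (fun x => f x + g x) h = ipL2 f h + ipL2 g h.
Proof.
move=> fL gL hL; rewrite /ipL2 -RintegralD//; last 2 first.
- exact: L2_integrableM.
- exact: L2_integrableM.
by apply: eq_Rintegral => x _; rewrite mulrDl.
Qed.

Lemma ipL2Zl c f g : f \in L2 -> g \in L2 ->
  ipL2 (fun x => c * f x) g = c * ipL2 f g.
Proof.
move=> fL gL; rewrite /ipL2 -RintegralZl//; last exact: L2_integrableM.
by apply: eq_Rintegral => x _; rewrite mulrA.
Qed.

Lemma cvg_L2norm (f_ : nat -> T -> R) : (forall n, f_ n \in L2) ->
  (('N[mu]_2%:E[EFin \o f_ n])%E @[n --> \oo] --> 0%E) <->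
  (ipL2 (f_ n) (f_ n) @[n --> \oo] --> 0).
Proof.
move=> fL.
have NE n : ('N[mu]_2%:E[EFin \o f_ n] =
    (Num.sqrt (ipL2 (f_ n) (f_ n)))%:E)%E.
  rewrite unlock /= -powR12_sqrt ?ipL2_ge0// -poweR_EFin ipL2E//.
  congr (_ `^ _)%E; apply: eq_integral => x _.
  by rewrite /= powR_mulrn// -normrX ger0_norm// sqr_ge0.
under eq_fun do rewrite NE.
split=> [h|h].
  have h1 : Num.sqrt (ipL2 (f_ n) (f_ n)) @[n --> \oo] --> 0 by exact: (fine_cvg h).
  have h2 : Num.sqrt (ipL2 (f_ n) (f_ n)) * Num.sqrt (ipL2 (f_ n) (f_ n))
    @[n --> \oo] --> (0 * 0 : R) by exact: cvgM.
  move: h2; rewrite mulr0.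
  by under eq_fun do rewrite -expr2 sqr_sqrtr ?ipL2_ge0//.
apply: cvg_EFin; first by near=> n.
rewrite -[X in _ --> X](@sqrtr0 R).
by apply: continuous_cvg h; exact: sqrt_continuous.
Unshelve. all: by end_near.
Qed.

Let sqr_cvg (v : nat -> R) l a : v n @[n --> \oo] --> l ->
  (a - v n) ^+ 2 @[n --> \oo] --> (a - l) ^+ 2.
Proof.
move=> vl; have h : a - v n @[n --> \oo] --> a - l.
  by apply: cvgB => //; exact: cvg_cst.
rewrite expr2; under eq_fun do rewrite expr2.
exact: cvgM.
Qed.

(** Along a subsequence with squared distances below 8^-n the differences are
    geometrically small almost everywhere. *)
Lemma L2_subseq_ae (u : nat -> T -> R) l : (forall n, u n \in L2) -> l \in L2 ->
  ipL2 (fun x => u n x - l x) (fun x => u n x - l x) @[n --> \oo] --> 0 ->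
  exists2 k : nat -> nat, (forall n, (n <= k n)%N) &
    \forall x \ae mu, u (k n) x @[n --> \oo] --> l x.
Proof.
move=> uL lL ul.
have hk n : exists k, (n <= k)%N /\
    ipL2 (fun x => u k x - l x) (fun x => u k x - l x) <= 8^-1 ^+ n.
  have e0 : 0 < (8^-1 : R) ^+ n by rewrite exprn_gt0.
  move/cvgrPdist_le : ul => /(_ _ e0) [n0 _ hn0].
  exists (maxn n n0); split; first exact: leq_maxl.
  have := hn0 (maxn n n0) (leq_maxr _ _).
  by rewrite /= sub0r normrN ger0_norm// ipL2_ge0.
pose k n := sval (cid (hk n)).
have kn n : (n <= k n)%N by rewrite /k; case: cid => ? [].
have kd n : ipL2 (fun x => u (k n) x - l x) (fun x => u (k n) x - l x) <= 8^-1 ^+ n.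
  by rewrite /k; case: cid => ? [].
exists k => //.
have := @ae_geometric _ _ _ mu (fun n x => u (k n) x - l x) _ _.
have dL n : (fun x => u (k n) x - l x) \in L2 by exact: L2B.
move=> /(_ (fun n => L2_measurable (dL n))) h.
have {}h := h (fun n => _); apply: filterS (h _) => [x [C Cn]|n]; last first.
  by rewrite -ipL2E// lee_fin.
apply/cvgrPdist_le => e e0.
have C1 : 0 < `|C| + 1 by rewrite ltr_wpDl.
have := @cvg_expr R 2^-1; rewrite ger0_norm// invf_lt1// ltr1n => /(_ isT).
move/cvgrPdist_le => /(_ (e / (`|C| + 1))); rewrite divr_gt0// => /(_ isT).
apply: filterS => n; rewrite sub0r normrN ger0_norm ?exprn_ge0// => hn.
rewrite distrC; apply: le_trans (Cn n) _.
apply: (@le_trans _ _ ((`|C| + 1) * 2^-1 ^+ n)).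
  rewrite ler_wpM2r ?exprn_ge0//.
  by have := ler_norm C; lra.
by rewrite mulrC -ler_pdivlMr.
Qed.

(** A fast subsequence converges almost everywhere and Fatou's lemma compares
    the whole sequence with its limit. The limit is built as a limit superior,
    which is measurable whether or not the subsequence converges. *)
Lemma L2_complete (u : nat -> T -> R) : (forall n, u n \in L2) ->
  (forall e, 0 < e -> exists n0, forall m n, (n0 <= m)%N -> (n0 <= n)%N ->
     ipL2 (fun x => u m x - u n x) (fun x => u m x - u n x) <= e) ->
  exists2 l, l \in L2 &
    ipL2 (fun x => u n x - l x) (fun x => u n x - l x) @[n --> \oo] --> 0.
Proof.
move=> uL uC.
have hk n : exists k, forall m m', (k <= m)%N -> (k <= m')%N ->
    ipL2 (fun x => u m x - u m' x) (fun x => u m x - u m' x) <= 8^-1 ^+ n.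
  by apply: uC; rewrite exprn_gt0.
pose k0 n := sval (cid (hk n)).
pose k n := (\sum_(i < n.+1) (k0 i).+1)%N.
have kS n : (k n <= k n.+1)%N by rewrite /k [in leqRHS]big_ord_recr/= leq_addr.
have k0k n : (k0 n <= k n)%N.
  by rewrite /k big_ord_recr/=; apply: leq_trans (leq_addl _ _).
have kn n : (n <= k n)%N.
  elim: n => // n IH; rewrite /k big_ord_recr/= -/(k n) addnS ltnS.
  exact: leq_trans IH (leq_addr _ _).
have dL n : (fun x => u (k n.+1) x - u (k n) x) \in L2 by exact: L2B.
have kd n : (\int[mu]_x ((u (k n.+1) x - u (k n) x) ^+ 2)%:E <= (8^-1 ^+ n)%:E)%E.
  rewrite -(ipL2E (dL n)) lee_fin.
  have := k0k n; rewrite /k0; case: cid => /= m mP mk.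
  by apply: mP => //; exact: leq_trans (kS n).
have cvgx : \forall x \ae mu, cvgn (fun n => u (k n) x).
  apply: filterS (ae_geometric (fun n => L2_measurable (dL n)) kd) => x [C Cn].
  have : cvgn (series (fun n => u (k n.+1) x - u (k n) x)).
    apply: normed_cvg; apply: series_le_cvg (is_cvg_geometric_series _) => /=.
    - by move=> n; exact: normr_ge0.
    - by move=> n; apply: le_trans (Cn n); exact: normr_ge0.
    - by move=> n; exact: Cn.
    - by rewrite ger0_norm// invf_lt1// ltr1n.
  move=> /cvg_ex[/= s sx]; apply/cvg_ex; exists (s + u (k 0%N) x).
  have -> : (fun n => u (k n) x) =
      (fun n => series (fun n => u (k n.+1) x - u (k n) x) n + u (k 0%N) x).
    apply/funext => n; rewrite /series /= telescope_sumr// subrK//.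
  by apply: cvgD => //; exact: cvg_cst.
pose l x : R := fine (limn_esup (fun n => (u (k n) x)%:E)).
have ml : measurable_fun setT l.
  apply: measurableT_comp => //; apply: measurable_fun_limn_esup => n.
  by apply/measurable_EFinP; exact: L2_measurable.
have cvgl : \forall x \ae mu, u (k n) x @[n --> \oo] --> l x.
  apply: filterS cvgx => x /cvg_ex[/= a ua].
  have ua' := cvgn_EFin ua.
  suff -> : l x = a by [].
  rewrite /l is_cvg_limn_esupE; last by apply/cvg_ex; eexists; exact: ua'.
  by rewrite (cvg_lim _ ua').
have key e : 0 < e -> exists n0, forall n, (n0 <= n)%N ->
    (\int[mu]_x ((u n x - l x) ^+ 2)%:E <= e%:E)%E.
  move=> /uC [n0 Hn0]; exists n0 => n n0n.
  apply: (@fatou_ae _ _ _ mu (fun i x => (u n x - u (k (i + n0)%N) x) ^+ 2)).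
  - by move=> i; apply: measurable_funX; apply: L2_measurable; exact: L2B.
  - by apply: measurable_funX; apply: measurable_funB => //; exact: L2_measurable.
  - by move=> i x; exact: sqr_ge0.
  - by move=> x; exact: sqr_ge0.
  - apply: filterS cvgl => x ux; apply: sqr_cvg.
    by have := ux; rewrite -(cvg_shiftn n0).
  - apply: nearW => i; have dL' : (fun x => u n x - u (k (i + n0)%N) x) \in L2 by exact: L2B.
    rewrite -(ipL2E dL') lee_fin; apply: Hn0 => //.
    by apply: leq_trans (leq_addl i n0) (kn _).
have ulL n : measurable_fun setT (fun x => u n x - l x).
  by apply: measurable_funB => //; exact: L2_measurable.
have lL : l \in L2.
  have [n0 /(_ n0 (leqnn _)) h] := key _ ltr01.
  have dlL : (fun x => u n0 x - l x) \in L2.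
    by apply: L2P (ulL n0) _; apply: le_lt_trans h _; rewrite ltry.
  have := L2B (uL n0) dlL.
  by under eq_fun do rewrite opprB addrCA subrr addr0.
exists l => //; apply/cvgrPdist_le => e /key[n0 Hn0]; exists n0 => // n /= n0n.
rewrite sub0r normrN ger0_norm ?ipL2_ge0// -lee_fin ipL2E ?Hn0//.
exact: L2B.
Qed.

End square_integrable.

(** * Lebesgue measure under translations, isometries and dilations *)

(** Bundles the proof of measurability, so that the pushforward has its measure
    structure wherever it occurs. *)
Definition image_measure d1 d2 (T1 : measurableType d1) (T2 : measurableType d2)
    (R : realType) (m : {measure set T1 -> \bar R}) (f : T1 -> T2)
    (mf : measurable_fun setT f) : {measure set T2 -> \bar R} :=
  measure_function_pushforward__canonical__measure_function_Measure m mf.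

Lemma preimage_measurable d1 d2 (T1 : measurableType d1) (T2 : measurableType d2)
    (f : T1 -> T2) A : measurable_fun setT f -> measurable A ->
  measurable (f @^-1` A).
Proof. by move=> mf mA; rewrite -[X in measurable X]setTI; exact: mf. Qed.

Lemma emulI (R : realType) (a x y : \bar R) : (0 < a)%E -> a \is a fin_num ->
  (a * x = a * y)%E -> x = y.
Proof.
move=> a0 af axy; apply/eqP; rewrite eq_le.
by rewrite -(lee_pmul2l af a0) axy lexx/= -(lee_pmul2l af a0) axy lexx.
Qed.

Section row_vectors.
Context (R : realType).

Lemma lebesgue_affine (c e : R) A : 0 < c -> measurable A ->
  lebesgue_measure A =
    (c%:E * lebesgue_measure ((fun x : measurableTypeR R => (c * x + e)%R) @^-1` A))%E.
Proof.
move=> c0 mA.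
have mf : measurable_fun [set: measurableTypeR R]
    (fun x : measurableTypeR R => (c * x + e : measurableTypeR R)).
  by apply: measurable_funD => //; exact: measurable_funM.
pose m := mscale (NngNum (ltW c0)) (image_measure (@lebesgue_measure R) mf).
apply: (lebesgue_measure_unique (mu := m)) mA => _ [[a b] _ <-] /=.
rewrite /m /mscale/= /image_measure/= /pushforward.
have -> : (fun x : measurableTypeR R => c * x + e) @^-1` `]a, b]%classic =
    `]((a - e) / c), ((b - e) / c)]%classic.
  apply/seteqP; split=> x /=; rewrite !in_itv/= ltr_pdivrMr// ler_pdivlMr//
    (mulrC x); lra.
rewrite !lebesgue_measure_itv/= !lte_fin ltr_pM2r ?invr_gt0// ltrD2r.
case: ifPn => _; last by rewrite mule0.
by rewrite -EFinM; congr EFin; field; rewrite gt_eqF.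
Qed.

Lemma rV_cons0 n (p : measurableTypeR R * 'rV[R]_n) :
  rV_cons p ord0 ord0 = p.1.
Proof. exact: (congr1 fst (rV_consK p)). Qed.

Lemma rV_consS n (p : measurableTypeR R * 'rV[R]_n) j :
  rV_cons p ord0 (lift ord0 j) = p.2 ord0 j.
Proof. by have /rowP/(_ j) := congr1 snd (rV_consK p); rewrite mxE. Qed.

Lemma rV_consD n (p : measurableTypeR R * 'rV[R]_n) (a : 'rV[R]_n.+1) :
  rV_cons p + a =
  rV_cons ((p.1 + (rV_uncons a).1 : measurableTypeR R), p.2 + (rV_uncons a).2).
Proof.
apply/rowP => i; rewrite mxE; have [j ->|->] := unliftP ord0 i.
  by rewrite !rV_consS/= !mxE.
by rewrite !rV_cons0.
Qed.

Section measurability.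
Context d (T : measurableType d) (n : nat).
Implicit Types f g : T -> 'rV[R]_n.

Lemma measurable_rVcoord f i : measurable_fun setT f ->
  measurable_fun setT (fun x => f x ord0 i).
Proof. by move=> mf; exact: (measurableT_comp (measurable_rV_coord i) mf). Qed.

Lemma measurable_rVD f g : measurable_fun setT f -> measurable_fun setT g ->
  measurable_fun setT (fun x => f x + g x).
Proof.
move=> mf mg; apply: measurable_fun_rV => i; under eq_fun do rewrite mxE.
by apply: measurable_funD; exact: measurable_rVcoord.
Qed.

Lemma measurable_rVZ (c : T -> R) f : measurable_fun setT c ->
  measurable_fun setT f -> measurable_fun setT (fun x => c x *: f x).
Proof.
move=> mc mf; apply: measurable_fun_rV => i; under eq_fun do rewrite mxE.
by apply: measurable_funM => //; exact: measurable_rVcoord.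
Qed.

Lemma measurable_rVN f : measurable_fun setT f ->
  measurable_fun setT (fun x => - f x).
Proof.
move=> mf; under eq_fun do rewrite -scaleN1r.
exact: measurable_rVZ.
Qed.

Lemma measurable_rVB f g : measurable_fun setT f -> measurable_fun setT g ->
  measurable_fun setT (fun x => f x - g x).
Proof. by move=> mf mg; apply: measurable_rVD => //; exact: measurable_rVN. Qed.

Definition dot (x y : 'rV[R]_n) : R := \sum_(i < n) x ord0 i * y ord0 i.

Lemma measurable_dot f g : measurable_fun setT f -> measurable_fun setT g ->
  measurable_fun setT (fun x => dot (f x) (g x)).
Proof.
move=> mf mg; apply: measurable_sum => i.
by apply: measurable_funM; exact: measurable_rVcoord.
Qed.

Lemma enormE x : enorm x = Num.sqrt (dot x x).
Proof. by congr Num.sqrt; apply: eq_bigr => i _; rewrite expr2. Qed.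

Lemma measurable_enorm f : measurable_fun setT f ->
  measurable_fun setT (fun x => enorm (f x)).
Proof.
move=> mf; under eq_fun do rewrite enormE.
have ms : measurable_fun setT (Num.sqrt : R -> R).
  by apply: continuous_measurable_fun; exact: sqrt_continuous.
exact: (measurableT_comp ms (measurable_dot mf mf)).
Qed.

End measurability.

Local Notation mu := (lebesgue_rV R).

Lemma lebesgue_rV_translate n (a : 'rV[R]_n) A : measurable A ->
  mu n ((fun x => x + a) @^-1` A) = mu n A.
Proof.
elim: n a A => [|n IH] a A mA.
  congr (mu 0 _); apply/seteqP; split=> x /=; rewrite [x + a]thinmx0 [x]thinmx0//.
rewrite /= /lebesgue_rV_step /pushforward.
set m := mu n.
pose a0 : measurableTypeR R := (rV_uncons a).1.
pose t (p : measurableTypeR R * 'rV[R]_n) : measurableTypeR R * 'rV[R]_n :=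
  ((p.1 + a0)%R, p.2 + (rV_uncons a).2).
have mt : measurable_fun setT t.
  apply/measurable_fun_pairP; split => /=.
    by apply: measurable_funD.
  by apply: measurable_rVD.
have -> : (@rV_cons R n) @^-1` ((fun x => x + a) @^-1` A) =
    t @^-1` ((@rV_cons R n) @^-1` A).
  by apply/seteqP; split=> p /=; rewrite rV_consD.
have mA' : measurable ((@rV_cons R n) @^-1` A).
  by apply: preimage_measurable => //; exact: measurable_rV_cons.
apply/esym; apply: (product_measure_unique (m' := image_measure ((@lebesgue_measure R) \x m)%E mt)) mA'.
move=> B C mB mC; rewrite /image_measure/= /pushforward.
have -> : t @^-1` (B `*` C) =
    ((fun x : measurableTypeR R => (x + a0)%R) @^-1` B) `*`
    ((fun x => x + (rV_uncons a).2) @^-1` C).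
  by apply/seteqP; split=> p.
rewrite [LHS]product_measure1E; last 2 first.
- by apply: preimage_measurable => //; exact: measurable_funD.
- by apply: preimage_measurable => //; exact: measurable_rVD.
rewrite IH//; congr (_ * _)%E.
rewrite (lebesgue_affine a0 ltr01 mB) mul1e; congr lebesgue_measure.
by apply/seteqP; split=> x /=; rewrite mul1r.
Qed.

Section invariance.
Context (n : nat).
Local Notation X := 'rV[R]_n.
Local Notation mu := (lebesgue_rV R n).

(** Both sides are the measure of the set of (x, y) with x in A and x + y in B
    under nu x mu: on the left mu is translated by x, on the right nu by y. With
    nu = mu this shows invariance under x |-> - x; in general it determines nu
    from its value on one set. *)
Lemma translation_invariant_unique (nu : {sigma_finite_measure set X -> \bar R}) :
  (forall (a : X) A, measurable A -> nu ((fun x => x + a) @^-1` A) = nu A) ->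
  forall A B, measurable A -> measurable B ->
    (nu A * mu B = nu B * mu ((fun x : X => (- x)%R) @^-1` A))%E.
Proof.
move=> nuT A B mA mB.
have mfst : measurable_fun [set: X * X] fst by [].
have msnd : measurable_fun [set: X * X] snd by [].
have addr_m (a : X) : measurable_fun [set: X] (fun x => x + a) by exact: measurable_rVD.
pose E : set (X * X) := (fst @^-1` A) `&` ((fun z => z.2 + z.1) @^-1` B).
pose E' : set (X * X) := ((fun z => z.1 - z.2) @^-1` A) `&` (fst @^-1` B).
have mE : measurable E.
  apply: measurableI; first exact: preimage_measurable.
  by apply: preimage_measurable => //; exact: measurable_rVD.
have mE' : measurable E'.
  apply: measurableI; last exact: preimage_measurable.
  by apply: preimage_measurable => //; exact: measurable_rVB.
have tonelli (S : set (X * X)) : measurable S ->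
    (\int[nu]_x mu (xsection S x) = \int[mu]_y nu (ysection S y))%E.
  move=> mS; have := indic_fubini_tonelli nu mu mS.
  by rewrite indic_fubini_tonelli_FE// indic_fubini_tonelli_GE.
have int_indic (m : {measure set X -> \bar R}) S c : measurable S ->
    (0 <= c)%E -> (\int[m]_x (c * (\1_S x)%:E) = c * m S)%E.
  move=> mS c0; rewrite ge0_integralZl//; last exact/measurable_EFinP.
  by rewrite integral_indic// setIT.
transitivity (\int[nu]_x mu (xsection E x))%E.
  rewrite muleC -int_indic//; apply: eq_integral => x _.
  rewrite indicE; case: (boolP (x \in A)) => xA.
    rewrite mule1 -(lebesgue_rV_translate x mB); congr (mu _).
    apply/seteqP; split=> y /=; rewrite xsectionE/= /E/=; last by case.
    by move=> yB; split => //; rewrite inE in xA.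
  rewrite mule0 (_ : xsection E x = set0) ?measure0//.
  apply/seteqP; split=> y //=; rewrite xsectionE/= => -[/= /mem_set].
  by rewrite (negbTE xA).
rewrite tonelli//.
transitivity (\int[mu]_y nu (ysection E' y))%E.
  apply: eq_integral => y _.
  rewrite -(nuT (- y) (ysection E y)); last exact: measurable_ysection.
  congr (nu _); apply/seteqP; split=> x /=; rewrite !ysectionE /E /E' /=.
    by rewrite [y + _]addrC subrK.
  by rewrite [y + _]addrC subrK.
rewrite -tonelli// [RHS]muleC -int_indic//.
apply: eq_integral => x _.
rewrite indicE; case: (boolP (x \in B)) => xB; last first.
  rewrite mule0 (_ : xsection E' x = set0) ?measure0//.
  apply/seteqP; split=> y //=; rewrite xsectionE/= => -[/= _ /mem_set].
  by rewrite (negbTE xB).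
have mNA : measurable ((fun y : X => - y) @^-1` A).
  by apply: preimage_measurable => //; exact: measurable_rVN.
rewrite mule1 -(lebesgue_rV_translate (- x) mNA); congr (mu _).
apply/seteqP; split=> y /=; rewrite xsectionE/= /E'/= opprB; first by case.
by move=> yA; split => //; rewrite inE in xB.
Qed.

Definition ball_e (r : R) : set X := [set x | enorm x <= r].

Lemma measurable_ball_e r : measurable (ball_e r).
Proof.
rewrite (_ : ball_e r = (@enorm R n) @^-1` `]-oo, r]%classic).
  by apply: preimage_measurable => //; exact: measurable_enorm.
by apply/seteqP; split=> x /=; rewrite in_itv.
Qed.

Definition box (a b : R) : set X := [set x | forall i, x ord0 i \in `[a, b]].

Lemma lebesgue_box a b : a <= b -> mu (box a b) = ((b - a) ^+ n)%:E.
Proof.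
move=> ab; rewrite (_ : box a b = [set x : X | forall i, x ord0 i \in
    `[(const_mx a : X) ord0 i, (const_mx b : X) ord0 i]]); last first.
  by apply/seteqP; split=> x /= xab i; have := xab i; rewrite !mxE.
rewrite lebesgue_rV_box => [|i]; last by rewrite !mxE.
congr EFin; rewrite (eq_bigr (fun=> b - a)) ?prodr_const ?card_ord// => i _.
by rewrite !mxE.
Qed.

Lemma measurable_box a b : measurable (box a b).
Proof.
rewrite (_ : box a b = \bigcap_(i in [set: 'I_n])
    (@rV_coord R n i @^-1` [set` `[a, b]])).
  apply: fin_bigcap_measurable => // i _.
  by apply: preimage_measurable => //; exact: measurable_rV_coord.
by apply/seteqP; split=> x /= xB i => [_|]; exact: xB.
Qed.

Lemma enorm_ge0 (x : X) : 0 <= enorm x.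
Proof. exact: sqrtr_ge0. Qed.

Lemma enorm_sqr (x : X) : enorm x ^+ 2 = dot x x.
Proof.
rewrite enormE sqr_sqrtr//; apply: sumr_ge0 => i _.
by rewrite -expr2 sqr_ge0.
Qed.

Lemma coord_le_enorm (x : X) i : `|x ord0 i| <= enorm x.
Proof.
rewrite -sqrtr_sqr; apply: ler_wsqrtr.
rewrite (bigD1 i)//= lerDl; apply: sumr_ge0 => j _; exact: sqr_ge0.
Qed.

Lemma enorm_le_coord (x : X) r : 0 <= r -> (forall i, `|x ord0 i| <= r) ->
  enorm x <= Num.sqrt n%:R * r.
Proof.
move=> r0 xr; rewrite -[X in _ <= _ * X]ger0_norm// -sqrtr_sqr -sqrtrM ?ler0n//.
apply: ler_wsqrtr.
apply: (@le_trans _ _ (\sum_(i < n) r ^+ 2)).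
  apply: ler_sum => i _; rewrite -[leLHS]real_normK ?num_real//.
  by rewrite lerXn2r ?nnegrE.
by rewrite sumr_const card_ord mulr_natl.
Qed.

Lemma ball_e_sub_box r : ball_e r `<=` box (- r) r.
Proof.
move=> x xr i; rewrite in_itv/= -ler_norml; apply: le_trans xr.
exact: coord_le_enorm.
Qed.

Lemma lebesgue_ball_lty r : (mu (ball_e r) < +oo)%E.
Proof.
case: (ltP r 0) => [r0|r0].
  rewrite (_ : ball_e r = set0) ?measure0// -subset0 => x /= xr.
  by have := le_trans (enorm_ge0 x) xr; rewrite leNgt r0.
apply: le_lt_trans (le_measure mu _ _ (@ball_e_sub_box r)) _; rewrite ?inE.
- exact: measurable_ball_e.
- exact: measurable_box.
have rr : - r <= r by lra.
by rewrite [X in (X < _)%E](lebesgue_box rr) ltry.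
Qed.

Lemma lebesgue_ball_gt0 r : 0 < r -> (0 < mu (ball_e r))%E.
Proof.
move=> r0; pose a := r / (Num.sqrt n%:R + 1).
have n0 : 0 < Num.sqrt n%:R + 1 :> R by rewrite ltr_wpDl// sqrtr_ge0.
have a0 : 0 < a by rewrite divr_gt0.
apply: (@lt_le_trans _ _ (mu (box (- a) a))).
  rewrite lebesgue_box; last by lra.
  by rewrite lte_fin exprn_gt0//; lra.
apply: le_measure; rewrite ?inE.
- exact: measurable_box.
- exact: measurable_ball_e.
move=> x xa; rewrite /ball_e/=.
apply: le_trans (enorm_le_coord (ltW a0) _) _.
  by move=> i; rewrite ler_norml; have := xa i; rewrite in_itv.
rewrite /a mulrA ler_pdivrMr// mulrC ler_pM2l//; lra.
Qed.

(** Additivity suffices to make the image of Lebesgue measure translation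
    invariant, hence a multiple of Lebesgue measure; no determinant occurs. *)
Record additive_iso := AdditiveIso {
  iso_fun :> X -> X ; iso_inv : X -> X ;
  iso_mfun : measurable_fun setT iso_fun ;
  iso_minv : measurable_fun setT iso_inv ;
  iso_funK : cancel iso_fun iso_inv ; iso_invK : cancel iso_inv iso_fun ;
  iso_funD : forall x y, iso_fun (x + y) = iso_fun x + iso_fun y }.

Section linear_image.
Context (L : additive_iso).

Definition linear_image : set X -> \bar R := image_measure mu (iso_mfun L).
HB.instance Definition _ := Measure.copy linear_image (image_measure mu (iso_mfun L)).

Let sigma_finite_linear_image : sigma_finite setT linear_image.
Proof.
have /sigma_finiteP[G [GT ndG Gfin]] := sigma_finiteT mu.
exists (fun i => iso_inv L @^-1` (G i)).
  rewrite -preimage_bigcup; apply/esym/seteqP; split=> // v _ /=.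
  by rewrite -GT.
move=> i; have [mG Goo] := Gfin i; split.
  by apply: preimage_measurable => //; exact: iso_minv.
rewrite /linear_image/= /image_measure/= /pushforward -comp_preimage.
by rewrite (_ : _ \o _ = id)//; apply/funext => x /=; rewrite iso_funK.
Qed.

HB.instance Definition _ := Measure_isSigmaFinite.Build _ _ _ linear_image
  sigma_finite_linear_image.

Lemma linear_image_translate (a : X) C : measurable C ->
  linear_image ((fun x => x + a) @^-1` C) = linear_image C.
Proof.
move=> mC; rewrite /linear_image/= /image_measure/= /pushforward.
rewrite -[RHS](lebesgue_rV_translate (iso_inv L a)); last first.
  by apply: preimage_measurable => //; exact: iso_mfun.
by congr (mu _); apply/seteqP; split=> x /=; rewrite iso_funD iso_invK.
Qed.

End linear_image.

Lemma lebesgue_oppr A : measurable A -> mu ((fun x : X => - x) @^-1` A) = mu A.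
Proof.
move=> mA; have := translation_invariant_unique (@lebesgue_rV_translate n) mA
  (measurable_ball_e 1).
rewrite muleC => h; apply/esym/(emulI _ _ h); first exact: lebesgue_ball_gt0.
by rewrite ge0_fin_numE// lebesgue_ball_lty.
Qed.

Lemma lebesgue_linear_image (L : additive_iso) B : measurable B ->
  (0 < mu B < +oo)%E -> forall A, measurable A ->
  (mu B * mu (L @^-1` A) = mu (L @^-1` B) * mu A)%E.
Proof.
move=> mB Boo A mA.
have := translation_invariant_unique (@linear_image_translate L) mA mB.
by rewrite lebesgue_oppr// muleC.
Qed.

(** The factor is read off the unit ball, which the map preserves. *)
Lemma lebesgue_isometry (L : additive_iso) : (forall x, enorm (L x) = enorm x) ->
  forall A, measurable A -> mu (L @^-1` A) = mu A.
Proof.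
move=> Le A mA; have b0 := lebesgue_ball_gt0 ltr01.
have bf : mu (ball_e 1) \is a fin_num by rewrite ge0_fin_numE// lebesgue_ball_lty.
apply: (emulI b0 bf).
apply: etrans (lebesgue_linear_image L (measurable_ball_e 1) _ mA) _.
  by rewrite b0 lebesgue_ball_lty.
by congr (mu _ * _)%E; apply/seteqP; split=> x; rewrite /ball_e/= Le.
Qed.

Definition scale_iso (l : R) (l0 : l != 0) : additive_iso.
Proof.
apply: (@AdditiveIso (fun x => l *: x) (fun x => l^-1 *: x)).
- exact: measurable_rVZ.
- exact: measurable_rVZ.
- by move=> x; rewrite scalerA mulVf// scale1r.
- by move=> x; rewrite scalerA mulfV// scale1r.
- by move=> x y; rewrite scalerDr.
Defined.

(** The factor is read off the unit cube. *)
Lemma lebesgue_scale l A : 0 < l -> measurable A ->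
  mu ((fun x : X => l *: x) @^-1` A) = ((l^-1 ^+ n)%:E * mu A)%E.
Proof.
move=> l0 mA; have l1 : l != 0 by rewrite gt_eqF.
have b1 : mu (box 0 1) = 1%E by rewrite lebesgue_box// subr0 expr1n.
have b01 : (0 < mu (box 0 1) < +oo)%E by rewrite b1 lte01 ltry.
have E := @lebesgue_linear_image (scale_iso l1) (box 0 1) (measurable_box _ _) b01 A mA.
transitivity (mu (box 0 1) * mu (scale_iso l1 @^-1` A))%E; first by rewrite b1 mul1e.
apply: etrans E _; congr (_ * _)%E.
rewrite -[l^-1]subr0 -lebesgue_box ?invr_ge0 ?ltW//.
congr (mu _); apply/seteqP; split=> x xb i; have := xb i;
  rewrite !in_itv/= ?mxE => /andP[]; rewrite !(mulrC l) -?ler_pdivlMr// ?div1r.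
- by rewrite pmulr_lge0// => -> ->.
- by rewrite pmulr_lge0// => -> ->.
Qed.

Lemma integral_translate (a : X) (f : X -> \bar R) : measurable_fun setT f ->
  (forall x, 0 <= f x)%E ->
  (\int[mu]_x f (x + a)%R = \int[mu]_x f x)%E.
Proof.
move=> mf f0; have ma : measurable_fun [set: X] (fun x : X => x + a).
  exact: measurable_rVD.
rewrite -[LHS](@ge0_integral_pushforward _ _ _ _ _ _ ma mu setT f)//; last first.
apply: (@eq_measure_integral _ _ _ setT mu (image_measure mu ma)) => A mA _.
exact: lebesgue_rV_translate.
Qed.

Lemma integral_isometry (L : additive_iso) (f : X -> \bar R) :
  (forall x, enorm (L x) = enorm x) -> measurable_fun setT f ->
  (forall x, 0 <= f x)%E -> (\int[mu]_x f (L x) = \int[mu]_x f x)%E.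
Proof.
move=> Le mf f0.
rewrite -[LHS](@ge0_integral_pushforward _ _ _ _ _ _ (iso_mfun L) mu setT f)//.
apply: (@eq_measure_integral _ _ _ setT mu (image_measure mu (iso_mfun L))) => A mA _.
exact: lebesgue_isometry.
Qed.

Lemma integral_scale l (f : X -> \bar R) : 0 < l -> measurable_fun setT f ->
  (forall x, 0 <= f x)%E ->
  (\int[mu]_x f (l *: x)%R = (l^-1 ^+ n)%:E * \int[mu]_x f x)%E.
Proof.
move=> l0 mf f0; have l1 : l != 0 by rewrite gt_eqF.
pose L := scale_iso l1.
have li : 0 <= l^-1 ^+ n by rewrite exprn_ge0 ?invr_ge0 ?ltW.
rewrite -[LHS](@ge0_integral_pushforward _ _ _ _ _ _ (iso_mfun L) mu setT f)//.
rewrite -(@ge0_integral_mscale _ _ _ mu setT measurableT (NngNum li))//.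
apply: (@eq_measure_integral _ _ _ setT (mscale (NngNum li) mu) (image_measure mu (iso_mfun L))) => A mA _.
exact: lebesgue_scale.
Qed.

Lemma ae_preimage (L : X -> X) (c : \bar R) : measurable_fun setT L ->
  (forall A, measurable A -> mu (L @^-1` A) = c * mu A)%E ->
  forall P : X -> Prop, (\forall x \ae mu, P x) -> \forall x \ae mu, P (L x).
Proof.
move=> mL LE P [A [mA A0 PA]]; exists (L @^-1` A); split.
- exact: preimage_measurable.
- by rewrite LE// A0 mule0.
- by move=> x /= Px; exact: PA.
Qed.

End invariance.

End row_vectors.

(** * Null sets of products, Euclidean geometry, reflections *)

Section product_null_sets.
Context d1 d2 (T1 : measurableType d1) (T2 : measurableType d2) (R : realType)
  (m1 : {sigma_finite_measure set T1 -> \bar R})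
  (m2 : {sigma_finite_measure set T2 -> \bar R}).
Local Open Scope ereal_scope.

Lemma prod_tonelli_sections (B : set (T1 * T2)) : measurable B ->
  \int[m1]_x m2 (xsection B x) = \int[m2]_y m1 (ysection B y).
Proof.
move=> mB; have := indic_fubini_tonelli m1 m2 mB.
by rewrite indic_fubini_tonelli_FE// indic_fubini_tonelli_GE.
Qed.

Lemma prod_null_xsection (B : set (T1 * T2)) : measurable B ->
  (m1 \x m2) B = 0 <-> \forall x \ae m1, m2 (xsection B x) = 0.
Proof.
move=> mB; have mx := measurable_fun_xsection m2 mB.
have E : (m1 \x m2) B = \int[m1]_x `|m2 (xsection B x)|.
  by apply: eq_integral => x _; rewrite gee0_abs.
rewrite E; split.
  move/ae_eq_integral_abs => /(_ measurableT mx).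
  by apply: filterS => x /(_ I).
move=> h; apply/ae_eq_integral_abs => //.
by apply: filterS h => x + _.
Qed.

Lemma prod_null_ysection (B : set (T1 * T2)) : measurable B ->
  (m1 \x m2) B = 0 <-> \forall y \ae m2, m1 (ysection B y) = 0.
Proof.
move=> mB; have my := measurable_fun_ysection m1 mB.
have E : (m1 \x m2) B = \int[m2]_x `|m1 (ysection B x)|.
  rewrite [LHS]prod_tonelli_sections//.
  by apply: eq_integral => x _; rewrite gee0_abs.
rewrite E; split.
  move/ae_eq_integral_abs => /(_ measurableT my).
  by apply: filterS => x /(_ I).
move=> h; apply/ae_eq_integral_abs => //.
by apply: filterS h => x + _.
Qed.

End product_null_sets.

Lemma ae_measureP d (T : measurableType d) (R : realType)
    (m : {measure set T -> \bar R}) (A : set T) : measurable A ->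
  m A = 0%E <-> \forall x \ae m, ~ A x.
Proof.
move=> mA; split=> [A0|[B [mB B0 AB]]].
  by exists A; split => // x /= /contrapT.
apply/eqP; rewrite eq_le measure_ge0 andbT -B0; apply: le_measure; rewrite ?inE//.
by move=> x Ax; apply: AB => /= nAx; exact: nAx.
Qed.

Section geometry.
Context (R : realType) (n : nat).
Local Notation X := 'rV[R]_n.
Local Notation mu := (lebesgue_rV R n).
Implicit Types x y v : X.

Lemma dotC x y : dot x y = dot y x.
Proof. by apply: eq_bigr => i _; rewrite mulrC. Qed.

Lemma dotDl x y v : dot (x + y) v = dot x v + dot y v.
Proof. by rewrite /dot -big_split; apply: eq_bigr => i _; rewrite mxE mulrDl. Qed.

Lemma dotZl a x y : dot (a *: x) y = a * dot x y.
Proof. by rewrite /dot mulr_sumr; apply: eq_bigr => i _; rewrite mxE mulrA. Qed.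

Lemma dotDr x y v : dot v (x + y) = dot v x + dot v y.
Proof. by rewrite dotC dotDl !(dotC v). Qed.

Lemma dotZr a x y : dot x (a *: y) = a * dot x y.
Proof. by rewrite dotC dotZl dotC. Qed.

Lemma dotNl x y : dot (- x) y = - dot x y.
Proof. by rewrite -scaleN1r dotZl mulN1r. Qed.

Lemma dotNr x y : dot x (- y) = - dot x y.
Proof. by rewrite dotC dotNl dotC. Qed.

Definition dotE := (dotDl, dotDr, dotNl, dotNr, dotZl, dotZr).

Lemma dot_ge0 x : 0 <= dot x x.
Proof. by rewrite -enorm_sqr sqr_ge0. Qed.

Lemma dot_gt0 x : x != 0 -> 0 < dot x x.
Proof.
move=> x0; rewrite lt_neqAle dot_ge0 andbT eq_sym; apply: contra x0 => /eqP xx0.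
apply/eqP/rowP => i; rewrite mxE; apply/eqP; rewrite -normr_le0.
by apply: le_trans (coord_le_enorm x i) _; rewrite enormE xx0 sqrtr0.
Qed.

Lemma enormZ a x : enorm (a *: x) = `|a| * enorm x.
Proof. by rewrite !enormE !dotE mulrA -expr2 sqrtrM ?sqr_ge0// sqrtr_sqr. Qed.

Lemma enormN x : enorm (- x) = enorm x.
Proof. by rewrite -scaleN1r enormZ normrN1 mul1r. Qed.

Lemma enorm0 : enorm (0 : X) = 0.
Proof. by rewrite -(scale0r (0 : X)) enormZ normr0 mul0r. Qed.

Lemma enorm_gt0 x : x != 0 -> 0 < enorm x.
Proof. by move=> x0; rewrite enormE sqrtr_gt0 dot_gt0. Qed.

Lemma le_enorm_dot x y : (enorm x <= enorm y) = (dot x x <= dot y y).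
Proof. by rewrite !enormE ler_sqrt// dot_ge0. Qed.

Lemma cauchy_schwarz x y : dot x y <= enorm x * enorm y.
Proof.
have [->|x0] := eqVneq x 0.
  by rewrite enorm0 mul0r -(scale0r y) dotZl mul0r.
have [->|y0] := eqVneq y 0.
  by rewrite enorm0 mulr0 -(scale0r x) dotZr mul0r.
have ex := enorm_gt0 x0; have ey := enorm_gt0 y0.
have := dot_ge0 ((enorm y) *: x - (enorm x) *: y).
rewrite !dotE (dotC y x) -!enorm_sqr.
set a := enorm x; set b := enorm y => h.
have : 0 <= 2 * (a * b) * (a * b - dot x y) by lra.
by rewrite pmulr_rge0 ?subr_ge0// mulr_gt0// mulr_gt0.
Qed.

Lemma enormD x y : enorm (x + y) <= enorm x + enorm y.
Proof.
rewrite -[leRHS]ger0_norm ?addr_ge0 ?enorm_ge0// -sqrtr_sqr [leLHS]enormE.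
apply: ler_wsqrtr; rewrite sqrrD !enorm_sqr !dotE (dotC y x).
have := cauchy_schwarz x y; lra.
Qed.

Lemma enormB x y : enorm (x - y) = enorm (y - x).
Proof. by rewrite -enormN opprB. Qed.

Lemma ler_dist_enorm x y : `|enorm x - enorm y| <= enorm (x - y).
Proof.
have h1 := enormD (x - y) y; have h2 := enormD (y - x) x.
rewrite subrK in h1; rewrite subrK -enormB in h2.
by rewrite ler_norml; lra.
Qed.

Definition measure_preserving (s : X -> X) := measurable_fun setT s /\
  forall f : X -> \bar R, measurable_fun setT f -> (forall x, 0 <= f x)%E ->
    (\int[mu]_x f (s x) = \int[mu]_x f x)%E.

(** Reflection in the hyperplane dot z v = c. *)
Definition refl (v : X) (c : R) (z : X) : X :=
  z + ((2 * (c - dot z v)) / dot v v) *: v.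

Lemma measurable_refl v c : measurable_fun setT (refl v c).
Proof.
apply: measurable_rVD => //; apply: measurable_rVZ => //.
apply: measurable_funM => //; apply: measurable_funM => //.
by apply: measurable_funB => //; exact: measurable_dot.
Qed.

Lemma reflK v c : v != 0 -> involutive (refl v c).
Proof.
move=> /dot_gt0 v0 z; rewrite /refl -addrA -scalerDl !dotE.
rewrite (_ : _ / _ + _ / _ = 0) ?scale0r ?addr0//.
by field; rewrite gt_eqF.
Qed.

Lemma reflD v x y : v != 0 -> refl v 0 (x + y) = refl v 0 x + refl v 0 y.
Proof.
move=> /dot_gt0 v0; rewrite /refl addrACA -scalerDl dotDl; congr (_ + _ *: _).
by field; rewrite gt_eqF.
Qed.

Definition lin_refl (v : X) (v0 : v != 0) : additive_iso R n :=
  AdditiveIso (measurable_refl v 0) (measurable_refl v 0) (reflK 0 v0)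
    (reflK 0 v0) (fun x y => reflD x y v0).

Lemma enorm_refl v c x y : v != 0 -> enorm (refl v c x - refl v c y) = enorm (x - y).
Proof.
move=> /dot_gt0 v0; rewrite !enormE; congr Num.sqrt.
have -> : refl v c x - refl v c y = refl v 0 (x - y).
  rewrite /refl opprD addrACA -scalerBl; congr (_ + _ *: _).
  by rewrite !dotE; field; rewrite gt_eqF.
move: (x - y) => z; rewrite /refl !dotE (dotC v z).
by field; rewrite gt_eqF.
Qed.

Lemma refl0 v : refl v 0 0 = 0.
Proof. by rewrite /refl -(scale0r v) dotZl mul0r subr0 mulr0 mul0r !scale0r addr0. Qed.

(** A linear isometry followed by a translation. *)
Lemma refl_measure_preserving v c : v != 0 -> measure_preserving (refl v c).
Proof.
move=> v0; have vv := dot_gt0 v0.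
have reflE z : refl v c z = lin_refl v0 z + ((2 * c) / dot v v) *: v.
  have -> : lin_refl v0 z = z + ((2 * (0 - dot z v)) / dot v v) *: v by [].
  rewrite /refl -[RHS]addrA -scalerDl.
  congr (_ + _ *: _).
  by field; rewrite gt_eqF.
split; first exact: measurable_refl.
move=> f mf f0; under eq_integral do rewrite reflE.
rewrite (integral_isometry (L := lin_refl v0)
  (f := fun x => f (x + ((2 * c) / dot v v) *: v))) => [|x||x].
- exact: integral_translate.
- rewrite (_ : lin_refl v0 x = refl v 0 x)// -[refl v 0 x]subr0.
  by rewrite -[X in enorm (_ - X)](refl0 v) enorm_refl// subr0.
- apply: (measurableT_comp mf); exact: measurable_rVD.
- exact: f0.
Qed.

Lemma measurable_prod_map1 (s : X -> X) : measurable_fun setT s ->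
  measurable_fun setT (fun z : X * X => (s z.1, z.2)).
Proof.
move=> ms; apply/measurable_fun_pairP; split; last exact: measurable_snd.
exact: (measurableT_comp ms measurable_fst).
Qed.

Lemma measurable_prod_map2 (s : X -> X) : measurable_fun setT s ->
  measurable_fun setT (fun z : X * X => (z.1, s z.2)).
Proof.
move=> ms; apply/measurable_fun_pairP; split; first exact: measurable_fst.
exact: (measurableT_comp ms measurable_snd).
Qed.

Lemma prod_measure_preserving1 (s : X -> X) (f : X * X -> \bar R) :
  measure_preserving s -> measurable_fun setT f -> (forall z, 0 <= f z)%E ->
  (\int[(mu \x mu)%E]_z f (s z.1, z.2) = \int[(mu \x mu)%E]_z f z)%E.
Proof.
move=> [ms sP] mf f0.
rewrite fubini_tonelli1//; last exact: (measurableT_comp mf (measurable_prod_map1 ms)).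
rewrite fubini_tonelli1// -(sP (fubini_F mu f)) => [||x].
- by [].
- exact: measurable_fun_fubini_tonelli_F.
- by apply: integral_ge0.
Qed.

Lemma prod_measure_preserving2 (s : X -> X) (f : X * X -> \bar R) :
  measure_preserving s -> measurable_fun setT f -> (forall z, 0 <= f z)%E ->
  (\int[(mu \x mu)%E]_z f (z.1, s z.2) = \int[(mu \x mu)%E]_z f z)%E.
Proof.
move=> [ms sP] mf f0.
rewrite fubini_tonelli1//; last exact: (measurableT_comp mf (measurable_prod_map2 ms)).
rewrite fubini_tonelli1//; apply: eq_integral => x _.
rewrite /fubini_F/=; apply: (sP (fun y => f (x, y))) => //.
exact: (measurableT_comp mf).
Qed.

Lemma prod_integral_scale l (f : X * X -> \bar R) : 0 < l ->
  measurable_fun setT f -> (forall z, 0 <= f z)%E ->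
  (\int[(mu \x mu)%E]_z f (l *: z.1, l *: z.2)%R =
   ((l^-1 ^+ n) ^+ 2)%:E * \int[(mu \x mu)%E]_z f z)%E.
Proof.
move=> l0 mf f0; have ml : measurable_fun [set: X] (fun x : X => l *: x) by exact: measurable_rVZ.
have mf1 := measurableT_comp mf (measurable_prod_map1 ml).
have mf2 := measurableT_comp mf1 (measurable_prod_map2 ml).
transitivity (\int[mu]_x fubini_F mu (fun z : X * X => f (l *: z.1, l *: z.2)%R) x)%E.
  by apply: fubini_tonelli1 => //; exact: mf2.
rewrite fubini_tonelli1//.
transitivity (\int[mu]_x ((l^-1 ^+ n)%:E * fubini_F mu f (l *: x)%R))%E.
  apply: eq_integral => x _; rewrite /fubini_F/=.
  rewrite (integral_scale (f := fun y => f ((l *: x)%R, y)))//.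
  exact: (measurableT_comp mf).
have mF : measurable_fun setT (fubini_F mu f).
  exact: measurable_fun_fubini_tonelli_F.
have F0 x : (0 <= fubini_F mu f x)%E by apply: integral_ge0.
have l1 : 0 <= l^-1 ^+ n by rewrite exprn_ge0// invr_ge0 ltW.
rewrite ge0_integralZl_EFin//; last exact: (measurableT_comp mF ml).
by rewrite integral_scale// muleA -EFinM -expr2.
Qed.

End geometry.

(** * Radial integrals *)

Section powers.
Context (R : realType).
Implicit Types x y a b : R.

Lemma powR1r a : 1 `^ a = 1.
Proof. by rewrite powR1. Qed.

Lemma ler_npowR a x y : a <= 0 -> 0 < x -> x <= y -> y `^ a <= x `^ a.
Proof.
move=> a0 x0 xy; have y0 := lt_le_trans x0 xy.
rewrite -[a]opprK !(powRN _ (- a)) lef_pV2 ?posrE ?powR_gt0//.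
by rewrite ge0_ler_powR ?nnegrE ?oppr_ge0// ltW.
Qed.

Lemma powR_base_lt1 x a : 0 < x < 1 -> 0 < a -> x `^ a < 1.
Proof.
move=> /andP[x0 x1] a0; rewrite -[ltRHS](powR1r a).
by rewrite gt0_ltr_powR ?nnegrE// ltW.
Qed.

Lemma measurable_powRl d (T : measurableType d) (f : T -> R) a :
  measurable_fun setT f -> measurable_fun setT (fun t => f t `^ a).
Proof. by move=> mf; exact: (measurableT_comp (@measurable_powR R a) mf). Qed.

End powers.

Lemma int_indicE d (T : measurableType d) (R : realType)
    (m : {measure set T -> \bar R}) A : measurable A ->
  (\int[m]_x (\1_A x)%:E = m A)%E.
Proof. by move=> mA; rewrite integral_indic// setIT. Qed.

Section radial_integrals.
Context (R : realType) (n : nat).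
Local Notation X := 'rV[R]_n.
Local Notation mu := (lebesgue_rV R n).

(** A substitute for polar coordinates: as S_{i+1} lies in the union of S_0 and
    of the dilate of S_i, the integrals satisfy I_{i+1} <= C + q I_i, a recursion
    bounded by its fixed point. *)
Lemma self_similar_integral (f : X -> R) (S : nat -> set X) (l a q C : R) :
  0 < l -> 0 <= a -> measurable_fun setT f -> (forall x, 0 <= f x) ->
  (forall i, measurable (S i)) -> (forall i, S i `<=` S i.+1) ->
  (forall i x, S i.+1 x -> S 0%N x \/ S i (l^-1 *: x)) ->
  (forall x, f (l *: x) = a * f x) -> q = l ^+ n * a -> q < 1 -> 0 <= C ->
  (\int[mu]_x (f x * \1_(S 0%N) x)%:E <= C%:E)%E ->
  (\int[mu]_x (f x * \1_(\bigcup_i S i) x)%:E <= (C / (1 - q))%:E)%E.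
Proof.
move=> l0 a0 mf f0 mS ndS Sc fl qE q1 C0 IS0.
have q0 : 0 <= q by rewrite qE mulr_ge0// exprn_ge0// ltW.
have q1' : 0 < 1 - q by rewrite subr_gt0.
have mfS A : measurable A -> measurable_fun setT (fun x => f x * \1_A x).
  by move=> mA; apply: measurable_funM => //; exact: measurable_indic.
have fS0 A x : 0 <= f x * \1_A x by rewrite mulr_ge0.
have mUS : measurable (\bigcup_i S i) by exact: bigcup_measurable.
have I i : (\int[mu]_x (f x * \1_(S i) x)%:E <= (C / (1 - q))%:E)%E.
  elim: i => [|i IH].
    by apply: le_trans IS0 _; rewrite lee_fin ler_pdivlMr//; nra.
  have ml : measurable_fun [set: X] (fun x : X => l^-1 *: x) by exact: measurable_rVZ.
  pose g y := a * (f y * \1_(S i) y).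
  have mg : measurable_fun setT g by apply: measurable_funM => //; exact: mfS.
  have g0 y : 0 <= g y by rewrite mulr_ge0.
  apply: (@le_trans _ _ (\int[mu]_x (f x * \1_(S 0%N) x + g (l^-1 *: x))%:E)%E).
    apply: le_int => //; first exact: mfS.
      by apply: measurable_funD; [exact: mfS|exact: (measurableT_comp mg ml)].
    move=> x; rewrite /g mulrA -fl scalerA divff ?gt_eqF// scale1r -mulrDr.
    apply: ler_wpM2l => //; rewrite !indicE.
    have [/set_mem Sx|_] := boolP (x \in S i.+1); last by rewrite addr_ge0.
    have [S0x|Six] := Sc _ _ Sx.
      by rewrite (mem_set S0x) lerDl.
    by rewrite [in leRHS](mem_set Six) lerDr.
  rewrite intD//; last 2 first.
    - exact: mfS.
    - exact: (measurableT_comp mg ml).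
  rewrite (integral_scale (f := fun y => (g y)%:E)) ?invr_gt0//; last exact/measurable_EFinP.
  rewrite invrK /g intZ//; last exact: mfS.
  rewrite muleA -EFinM -qE.
  apply: (@le_trans _ _ (C%:E + q%:E * (C / (1 - q))%:E)%E).
    by apply: leeD => //; rewrite lee_wpmul2l.
  rewrite -EFinM -EFinD lee_fin le_eqVlt; apply/orP; left; apply/eqP.
  by field; rewrite gt_eqF.
apply: (@fatou_ae _ _ _ mu (fun i x => f x * \1_(S i) x)) => //.
- by move=> i; exact: mfS.
- exact: mfS.
- apply: aeW => x; apply: cvgMl_tmp; rewrite !indicE.
  case: (boolP (x \in \bigcup_i S i)) => [/set_mem[i _ Six]|xS].
    apply: cvg_near_cst; exists i => // j /= ij; rewrite indicE mem_set//.
    by rewrite -(subnK ij); elim: (j - i)%N => // k IHk; exact: ndS.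
  apply: cvg_near_cst; apply: nearW => j /=; rewrite indicE memNset// => Sj.
  by move/negP : xS; apply; apply/mem_set; exists j.
- exact: nearW.
Qed.

Lemma int_enorm_near0 a : - n%:R < a -> a != 0 -> exists2 C : R, 0 <= C &
  (\int[mu]_x (enorm x `^ a * \1_(ball_e 1) x)%:E <= C%:E)%E.
Proof.
move=> na a0; pose f (x : X) := enorm x `^ a.
have mf : measurable_fun setT f.
  by apply: measurable_powRl; exact: measurable_enorm.
have f0 x : 0 <= f x by exact: powR_ge0.
pose S i : set X := [set x | 2^-1 ^+ i.+1 < enorm x <= 1].
have mS i : measurable (S i).
  rewrite (_ : S i = (@enorm R n) @^-1` `]2^-1 ^+ i.+1, 1]%classic).
    by apply: preimage_measurable => //; exact: measurable_enorm.
  by apply/seteqP; split=> x /=; rewrite in_itv.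
pose q : R := 2^-1 ^+ n * 2^-1 `^ a.
have qE : q = 2^-1 `^ (n%:R + a).
  by rewrite powRD ?powR_mulrn//; apply/implyP => _; rewrite invr_eq0.
have half : 0 < (2^-1 : R) < 1 by lra.
have q1 : q < 1 by rewrite qE powR_base_lt1//; lra.
pose M := 1 + 2^-1 `^ a.
have M0 : 0 <= M by rewrite addr_ge0// powR_ge0.
have fM x : S 0%N x -> f x <= M.
  move=> /andP[]; rewrite expr1 => x1 x2.
  have e0 : 0 < enorm x by lra.
  have [a_ge0|a_lt0] := leP 0 a.
    apply: (@le_trans _ _ 1); last by rewrite lerDl powR_ge0.
    by rewrite /f -[leRHS](powR1r a) ge0_ler_powR ?nnegrE// ltW.
  apply: (@le_trans _ _ (2^-1 `^ a)); last by rewrite lerDr.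
  by rewrite /f ler_npowR// ltW.
pose C := M * fine (mu (ball_e 1)).
have bfin : mu (ball_e 1) \is a fin_num by rewrite ge0_fin_numE// lebesgue_ball_lty.
have C0 : 0 <= C by rewrite mulr_ge0// fine_ge0.
have IS0 : (\int[mu]_x (f x * \1_(S 0%N) x)%:E <= C%:E)%E.
  apply: (@le_trans _ _ (\int[mu]_x (M * \1_(ball_e 1) x)%:E)%E).
    apply: le_int => //.
    - by apply: measurable_funM => //; exact: measurable_indic.
    - by apply: measurable_funM => //; apply: measurable_indic; exact: measurable_ball_e.
    - by move=> x; rewrite mulr_ge0.
    move=> x; rewrite !indicE; have [/set_mem Sx|_] := boolP (x \in S 0%N).
      rewrite (mem_set (_ : ball_e 1 x)) ?mulr1 ?fM//.
      by case/andP : Sx.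
    by rewrite mulr0 mulr_ge0.
  rewrite intZ//; last by apply: measurable_indic; exact: measurable_ball_e.
  by rewrite int_indicE; [rewrite /C EFinM fineK|exact: measurable_ball_e].
have key : (\int[mu]_x (f x * \1_(\bigcup_i S i) x)%:E <= (C / (1 - q))%:E)%E.
  apply: (@self_similar_integral f S 2^-1 (2^-1 `^ a) q C) => //.
  - move=> i x /= /andP[xi x1]; rewrite /S/= x1 andbT; apply: le_lt_trans xi.
    by rewrite ler_wiXn2l//; lra.
  - move=> i x /= /andP[xi x1]; rewrite invrK.
    have [xh|xh] := ltP 2^-1 (enorm x); first by left; rewrite /S/= expr1 xh.
    right; rewrite /S/= enormZ ger0_norm//; rewrite exprS in xi; lra.
  - move=> x; rewrite /f enormZ ger0_norm ?invr_ge0// powRM//; exact: enorm_ge0.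
exists (C / (1 - q)); first by rewrite divr_ge0//; lra.
apply: le_trans key; rewrite le_eqVlt; apply/orP; left; apply/eqP.
apply: eq_integral => x _; congr EFin; rewrite -/(f x) !indicE.
(* The shells miss the origin, where the integrand is 0 because 0 `^ a = 0. *)
have [->|x0] := eqVneq x 0.
  by rewrite /f enorm0 powR0// !mul0r.
congr (_ * (nat_of_bool _)%:R); apply/idP/idP => /set_mem xS; apply/mem_set.
  have e0 := enorm_gt0 x0.
  have := @cvg_expr R 2^-1; rewrite ger0_norm// invf_lt1// ltr1n => /(_ isT).
  move/cvgrPdist_lt => /(_ _ e0) [i _ Hi]; exists i => //=.
  have := Hi i.+1 (leqnSn i); rewrite sub0r normrN ger0_norm ?exprn_ge0// => h.
  by rewrite /S/= h; exact: xS.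
by case: xS => i _ /andP[].
Qed.

Lemma int_enorm_oo b : n%:R < b -> exists2 C : R, 0 <= C &
  (\int[mu]_x (enorm x `^ (- b) * \1_[set x : X | (1 <= enorm x)%R] x)%:E <= C%:E)%E.
Proof.
move=> nb; pose f (x : X) := enorm x `^ (- b).
have b0 : 0 < b by apply: le_lt_trans nb; rewrite ler0n.
have mf : measurable_fun setT f.
  by apply: measurable_powRl; exact: measurable_enorm.
have f0 x : 0 <= f x by exact: powR_ge0.
pose S i : set X := [set x | 1 <= enorm x < 2 ^+ i.+1].
have mS i : measurable (S i).
  rewrite (_ : S i = (@enorm R n) @^-1` `[1, 2 ^+ i.+1[%classic).
    by apply: preimage_measurable => //; exact: measurable_enorm.
  by apply/seteqP; split=> x /=; rewrite in_itv.
pose q : R := 2 ^+ n * 2 `^ (- b).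
have qE : q = 2^-1 `^ (b - n%:R).
  rewrite -powR_inv1// -powRrM mulN1r opprB powRD ?powR_mulrn//.
  by apply/implyP => _; rewrite pnatr_eq0.
have half : 0 < (2^-1 : R) < 1 by lra.
have q1 : q < 1 by rewrite qE powR_base_lt1//; lra.
pose C := fine (mu (ball_e 2)).
have bfin : mu (ball_e 2) \is a fin_num by rewrite ge0_fin_numE// lebesgue_ball_lty.
have C0 : 0 <= C by rewrite fine_ge0.
have IS0 : (\int[mu]_x (f x * \1_(S 0%N) x)%:E <= C%:E)%E.
  apply: (@le_trans _ _ (\int[mu]_x (\1_(ball_e 2) x)%:E)%E).
    apply: le_int => //.
    - by apply: measurable_funM => //; exact: measurable_indic.
    - by apply: measurable_indic; exact: measurable_ball_e.
    - by move=> x; rewrite mulr_ge0.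
    move=> x; rewrite !indicE; have [/set_mem|_] := boolP (x \in S 0%N); last by rewrite mulr0.
    rewrite /S/= expr1 => /andP[x1 x2]; rewrite mem_set ?mulr1; last by rewrite /ball_e/= ltW.
    by rewrite /f -[leRHS](powR1r (- b)) ler_npowR//; lra.
  by rewrite int_indicE; [rewrite /C fineK|exact: measurable_ball_e].
have key : (\int[mu]_x (f x * \1_(\bigcup_i S i) x)%:E <= (C / (1 - q))%:E)%E.
  apply: (@self_similar_integral f S 2 (2 `^ (- b)) q C) => //.
  - move=> i x /= /andP[x1 xi]; rewrite /S/= x1/=; apply: lt_le_trans xi _.
    by rewrite ler_weXn2l//; lra.
  - move=> i x /= /andP[x1 xi].
    have [xh|xh] := ltP (enorm x) 2; first by left; rewrite /S/= expr1 x1.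
    right; rewrite /S/= enormZ ger0_norm ?invr_ge0//; rewrite exprS in xi.
    by apply/andP; split; lra.
  - move=> x; rewrite /f enormZ ger0_norm// powRM//; exact: enorm_ge0.
exists (C / (1 - q)); first by rewrite divr_ge0//; lra.
apply: le_trans key; rewrite le_eqVlt; apply/orP; left; apply/eqP.
apply: eq_integral => x _; congr EFin; rewrite -/(f x) !indicE.
congr (_ * (nat_of_bool _)%:R); apply/idP/idP => /set_mem xS; apply/mem_set.
  have e0 : 0 < (enorm x)^-1 by rewrite invr_gt0; apply: lt_le_trans xS.
  have := @cvg_expr R 2^-1; rewrite ger0_norm// invf_lt1// ltr1n => /(_ isT).
  move/cvgrPdist_lt => /(_ _ e0) [i _ Hi]; exists i => //=.
  have := Hi i.+1 (leqnSn i); rewrite sub0r normrN ger0_norm ?exprn_ge0//.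
  rewrite exprVn ltf_pV2 ?posrE ?exprn_gt0// => [h|]; last exact: lt_le_trans xS.
  by rewrite /S/= h andbT.
by case: xS => i _ /andP[].
Qed.

Lemma set1_box (x : X) : [set x] = (fun y : X => y - x) @^-1` (box 0 0).
Proof.
apply/seteqP; split=> [y ->|y /= yx].
  by rewrite /= subrr => i; rewrite mxE in_itv/= lexx.
apply/rowP => i; apply/eqP; rewrite -subr_eq0.
by have := yx i; rewrite in_itv/= !mxE -eq_le eq_sym.
Qed.

Lemma measurable_rV1 (x : X) : measurable [set x].
Proof.
rewrite set1_box; apply: preimage_measurable; last exact: measurable_box.
exact: measurable_rVD.
Qed.

Lemma lebesgue_set1 (x : X) : (0 < n)%N -> mu [set x] = 0%E.
Proof.
move=> n0; rewrite set1_box lebesgue_rV_translate; last exact: measurable_box.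
by rewrite [LHS](lebesgue_box n (lexx 0)) subrr expr0n eqn0Ngt n0.
Qed.

(** m times the value of the kernel at the half-diagonal of a cube of measure
    2m. *)
Definition kernel_mass (b m : R) : R :=
  m / (Num.sqrt n%:R * ((2 * m) `^ n%:R^-1 / 2)) `^ b.

(** At least half of a cube of measure 2m centred at x lies outside E. *)
Lemma kernel_mass_outside (E : set X) (m b : R) (x : X) : (0 < n)%N ->
  measurable E -> 0 < m -> (mu E <= m%:E)%E -> 0 <= b ->
  ((kernel_mass b m)%:E <=
   \int[mu]_y (\1_(~` E) y / enorm (x - y) `^ b)%:E)%E.
Proof.
move=> n0 mE m0 Em b0; have n0' : 0 < (n%:R : R) by rewrite ltr0n.
pose a := (2 * m) `^ n%:R^-1 / 2.
have a0 : 0 < a by rewrite divr_gt0// powR_gt0// mulr_gt0.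
pose B := (fun y : X => y - x) @^-1` (box (- a) a).
have mB : measurable B.
  by apply: preimage_measurable; [exact: measurable_rVD|exact: measurable_box].
have muB : mu B = (2 * m)%:E.
  have aa : - a <= a by lra.
  rewrite /B lebesgue_rV_translate; last exact: measurable_box.
  rewrite [LHS](lebesgue_box n aa); congr EFin.
  have -> : a - - a = (2 * m) `^ n%:R^-1 by rewrite /a; field.
  by rewrite -powR_mulrn ?powR_ge0// -powRrM mulVf ?powRr1 ?gt_eqF// mulr_ge0 ?ltW.
pose D := B `\` (E `|` [set x]).
have mx := measurable_rV1 x.
have mEx : measurable (E `|` [set x]) by exact: measurableU.
have mD : measurable D by exact: measurableD.
have muD : (m%:E <= mu D)%E.
  have : (mu B <= mu D + mu (E `|` [set x]))%E.
    apply: le_trans (measureU2 _ mD mEx); apply: le_measure; rewrite ?inE//.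
      exact: measurableU.
    by move=> y By; have [?|?] := pselect ((E `|` [set x]) y); [right|left].
  have h : (mu (E `|` [set x]) <= m%:E)%E.
    apply: le_trans (measureU2 _ mE mx) _.
    by rewrite [X in (_ + X <= _)%E](lebesgue_set1 x n0) adde0.
  rewrite muB => h2.
  have : ((2 * m)%:E <= mu D + m%:E)%E by apply: le_trans h2 _; rewrite leeD2l.
  rewrite -leeBlDr// -EFinB; apply: le_trans; rewrite lee_fin; lra.
set r := Num.sqrt n%:R * a.
have r0 : 0 < r by rewrite mulr_gt0// sqrtr_gt0.
have rb : 0 < r `^ b by rewrite powR_gt0.
apply: (@le_trans _ _ (\int[mu]_y ((r `^ b)^-1 * \1_D y)%:E)%E).
  rewrite intZ//; last by rewrite invr_ge0 powR_ge0.
  rewrite int_indicE// /kernel_mass -/a -/r mulrC EFinM.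
  by rewrite lee_pmul2l// lte_fin invr_gt0.
have mker : measurable_fun setT (fun y : X => (enorm (x - y) `^ b)^-1).
  under eq_fun do rewrite -powRN; apply: measurable_powRl.
  by apply: measurable_enorm; exact: measurable_rVB.
apply: le_int.
- by apply: measurable_funM => //; exact: measurable_indic.
- by apply: measurable_funM => //; apply: measurable_indic; exact: measurableC.
- by move=> y; rewrite mulr_ge0// invr_ge0 powR_ge0.
move=> y; rewrite !indicE; have [/set_mem [By Exy]|_] := boolP (y \in D); last first.
  by rewrite mulr0 divr_ge0// powR_ge0.
rewrite mulr1 mem_set ?mul1r; last by move=> Ey; apply: Exy; left.
have yx : x - y != 0.
  by rewrite subr_eq0; apply/eqP => xy; apply: Exy; right; rewrite xy.
rewrite lef_pV2 ?posrE ?powR_gt0 ?enorm_gt0//.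
apply: ge0_ler_powR; rewrite ?nnegrE ?enorm_ge0 ?(ltW r0)//.
rewrite enormB; apply: enorm_le_coord; first exact: ltW.
by move=> i; rewrite ler_norml; have := By i; rewrite in_itv.
Qed.

End radial_integrals.

(** * The Gagliardo energy *)

Section power_convexity.
Context (R : realType).
Implicit Types a b t x p : R.

Lemma normpowR_convex p t a b : 1 <= p -> 0 <= t <= 1 ->
  `|t * a + (1 - t) * b| `^ p <= t * `|a| `^ p + (1 - t) * `|b| `^ p.
Proof.
move=> p1 /andP[t0 t1]; have t1' : 0 <= 1 - t by rewrite subr_ge0.
have p0 : 0 <= p by lra.
apply: (@le_trans _ _ ((t * `|a| + (1 - t) * `|b|) `^ p)).
  apply: ge0_ler_powR; rewrite ?nnegrE//; first by rewrite addr_ge0// mulr_ge0.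
  by apply: le_trans (ler_normD _ _) _; rewrite !normrM (ger0_norm t0) (ger0_norm t1').
pose T : {i01 R} := Itv01 t0 t1.
have := @convex_powR R p p1 T `|a| `|b|.
by rewrite !inE/= !in_itv/= !normr_ge0 => /(_ isT isT).
Qed.

(** Moving a and b towards each other, at most until they are exchanged, makes a
    convex combination of the pairs (a, b) and (b, a). *)
Lemma normpowR_contract p a b d : 1 <= p ->
  (0 <= d <= a - b) || (a - b <= d <= 0) ->
  `|a - d| `^ p + `|b + d| `^ p <= `|a| `^ p + `|b| `^ p.
Proof.
move=> p1 dab; have [ab|ab] := eqVneq a b.
  have -> : d = 0 by move: dab; rewrite ab subrr => /orP[] /andP[]; lra.
  by rewrite subr0 addr0.
pose t := 1 - d / (a - b).
have ab0 : a - b != 0 by rewrite subr_eq0.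
have t01 : 0 <= t <= 1.
  rewrite /t; case/orP : dab => /andP[d1 d2].
    have h : 0 < a - b by rewrite lt_neqAle eq_sym ab0 (le_trans d1).
    by rewrite subr_ge0 ler_pdivrMr// mul1r d2 gerBl divr_ge0// ltW.
  have h : a - b < 0 by rewrite lt_neqAle ab0 (le_trans d1).
  rewrite subr_ge0 ler_ndivrMr// mul1r d1/= gerBl.
  by rewrite -mulrNN -invrN divr_ge0 ?oppr_ge0// ltW.
have e1 : a - d = t * a + (1 - t) * b by rewrite /t; field.
have e2 : b + d = t * b + (1 - t) * a by rewrite /t; field.
have := normpowR_convex a b p1 t01; have := normpowR_convex b a p1 t01.
rewrite -e1 -e2; lra.
Qed.

(** x^p is x times x^(p-1), and the second factor is at least c^(p-1) from c
    on. *)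
Lemma powR_trunc p a b c : 1 <= p -> 0 <= c -> c <= b -> b <= a ->
  b `^ p + c `^ (p - 1) * (a - b) <= a `^ p.
Proof.
move=> p1 c0 cb ba; have b0 := le_trans c0 cb; have a0 := le_trans b0 ba.
have E x : 0 <= x -> x `^ p = x * x `^ (p - 1).
  move=> x0; have [->|xn0] := eqVneq x 0.
    by rewrite mul0r powR0// gt_eqF//; lra.
  have e : p = 1 + (p - 1) by lra.
  have h : x `^ (1 + (p - 1)) = x `^ 1 * x `^ (p - 1).
    by apply: powRD; apply/implyP => _; exact: xn0.
  by rewrite [in LHS]e h powRr1.
have p0 : 0 <= p - 1 by lra.
rewrite !E//.
have h1 : c `^ (p - 1) <= b `^ (p - 1) by rewrite ge0_ler_powR ?nnegrE.
have h2 : b `^ (p - 1) <= a `^ (p - 1) by rewrite ge0_ler_powR ?nnegrE.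
have h3 : 0 <= (b `^ (p - 1) - c `^ (p - 1)) * (a - b) by rewrite mulr_ge0 ?subr_ge0.
have h4 : 0 <= (a `^ (p - 1) - b `^ (p - 1)) * a by rewrite mulr_ge0 ?subr_ge0.
nra.
Qed.

Lemma cvg_normpowR (u : nat -> R) l p : 0 < p -> u n @[n --> \oo] --> l ->
  `|u n| `^ p @[n --> \oo] --> `|l| `^ p.
Proof.
move=> p0 ul; have ul' : `|u n| @[n --> \oo] --> `|l| by exact: cvg_norm.
have [l0|l0] := eqVneq l 0; last first.
  have l1 : 0 < `|l| by rewrite normr_gt0.
  rewrite {2}/powR gt_eqF//.
  have h : expR (p * ln `|u n|) @[n --> \oo] --> expR (p * ln `|l|).
    apply: continuous_cvg; first exact: continuous_expR.
    apply: cvgMl_tmp; apply: continuous_cvg ul'; exact: continuous_ln.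
  apply: cvg_trans h; apply: near_eq_cvg.
  have := ul'; move/cvgrPdist_lt => /(_ _ l1); apply: filterS => n.
  move=> hn; rewrite /powR gt_eqF//; move: hn; rewrite ltr_norml; lra.
rewrite l0 normr0 powR0 ?gt_eqF//; apply/cvgrPdist_le => e e0.
have ep : 0 < e `^ p^-1 by rewrite powR_gt0.
move/cvgrPdist_le : ul' => /(_ _ ep); apply: filterS => n.
rewrite l0 normr0 !sub0r !normrN normr_id (ger0_norm (powR_ge0 _ _)) => h.
have -> : e = (e `^ p^-1) `^ p by rewrite -powRrM mulVf ?gt_eqF// powRr1// ltW.
by rewrite ge0_ler_powR ?nnegrE ?powR_ge0// ltW.
Qed.

End power_convexity.

Section energy.
Context (R : realType) (N : nat) (s p : R).
Context (p12 : 1 < p < 2) (s01 : 0 < s < 1).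
Local Notation X := 'rV[R]_N.
Local Notation mu := (lebesgue_rV R N).
Local Notation mu2 := (mu \x mu)%E.
Local Notation L2 := (Lfun mu 2%:E).
Local Notation J := (gagliardo_energy s p).
Implicit Types u v g w : X -> R.

Let p1 : 1 <= p. Proof. by case/andP : p12 => /ltW. Qed.
Let p0 : 0 < p. Proof. exact: lt_le_trans p1. Qed.
Let sp0 : 0 < s * p. Proof. by case/andP: s01 => s0 _; rewrite mulr_gt0. Qed.

Definition sing_exp : R := N%:R + s * p.

Lemma sing_exp_gt : N%:R < sing_exp. Proof. by rewrite /sing_exp ltrDl. Qed.
Lemma sing_exp_gt0 : 0 < sing_exp.
Proof. by apply: le_lt_trans sing_exp_gt; rewrite ler0n. Qed.

Definition energy_density u (z : X * X) : R :=
  `|u z.1 - u z.2| `^ p / enorm (z.1 - z.2) `^ sing_exp.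

Lemma gagliardoE u :
  J u = (((2 * p)^-1)%:E * \int[mu2]_z (energy_density u z)%:E)%E.
Proof. by []. Qed.

Let c2p : 0 < (2 * p)^-1. Proof. by rewrite invr_gt0 mulr_gt0. Qed.

Lemma measurable_sing_kernel :
  measurable_fun [set: X * X] (fun z => (enorm (z.1 - z.2) `^ sing_exp)^-1).
Proof.
under eq_fun do rewrite -powRN; apply: measurable_powRl; apply: measurable_enorm.
exact: measurable_rVB.
Qed.

Lemma kernel_ge0 (x : X) : 0 <= (enorm x `^ sing_exp)^-1.
Proof. by rewrite invr_ge0 powR_ge0. Qed.

Lemma measurable_diff u : measurable_fun setT u ->
  measurable_fun [set: X * X] (fun z => u z.1 - u z.2).
Proof.
move=> mu_; apply: measurable_funB.
  exact: (measurableT_comp mu_ measurable_fst).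
exact: (measurableT_comp mu_ measurable_snd).
Qed.

Lemma measurable_energy_density u : measurable_fun setT u ->
  measurable_fun setT (energy_density u).
Proof.
move=> mu_; apply: measurable_funM; last exact: measurable_sing_kernel.
apply: measurable_powRl; apply: measurableT_comp => //; exact: measurable_diff.
Qed.

Lemma energy_density_ge0 u z : 0 <= energy_density u z.
Proof. by rewrite mulr_ge0 ?powR_ge0 ?kernel_ge0. Qed.

Lemma gagliardo_ge0 u : (0 <= J u)%E.
Proof.
rewrite gagliardoE mule_ge0 ?lee_fin ?(ltW c2p)//; apply: integral_ge0 => z _.
by rewrite lee_fin; exact: energy_density_ge0.
Qed.

Lemma gagliardo0 : J ((fun=> 0) : X -> R) = 0%E.
Proof.
rewrite gagliardoE integral0_eq ?mule0// => z _.
by rewrite /energy_density subrr normr0 powR0 ?mul0r// gt_eqF.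
Qed.

Lemma gagliardo_le2 v1 v2 u1 u2 : measurable_fun setT v1 -> measurable_fun setT v2 ->
  measurable_fun setT u1 -> measurable_fun setT u2 ->
  (forall z, energy_density v1 z + energy_density v2 z <=
             energy_density u1 z + energy_density u2 z) ->
  (J v1 + J v2 <= J u1 + J u2)%E.
Proof.
move=> mv1 mv2 mu1 mu2_ H; rewrite !gagliardoE.
have m1 := measurable_energy_density mv1; have m2 := measurable_energy_density mv2.
have m3 := measurable_energy_density mu1; have m4 := measurable_energy_density mu2_.
have D0 u := energy_density_ge0 u.
have : (\int[mu2]_z (energy_density v1 z)%:E + \int[mu2]_z (energy_density v2 z)%:E
    <= \int[mu2]_z (energy_density u1 z)%:E + \int[mu2]_z (energy_density u2 z)%:E)%E.
  rewrite -(intD _ m1 m2 (D0 _) (D0 _)) -(intD _ m3 m4 (D0 _) (D0 _)).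
  apply: le_int H; [exact: measurable_funD|exact: measurable_funD|].
  by move=> z; rewrite addr_ge0.
have I0 f : (0 <= \int[mu2]_z (energy_density f z)%:E)%E.
  by apply: integral_ge0 => z _; rewrite lee_fin; exact: energy_density_ge0.
move: (I0 v1) (I0 v2) (I0 u1) (I0 u2).
move: (\int[mu2]_z _)%E (\int[mu2]_z _)%E (\int[mu2]_z _)%E (\int[mu2]_z _)%E.
move=> a b c d a0 b0 c0 d0 h.
rewrite -(ge0_muleDr _ a0 b0) -(ge0_muleDr _ c0 d0).
by rewrite lee_wpmul2l// lee_fin ltW.
Qed.

Lemma gagliardo_convex t u v a b : measurable_fun setT u -> measurable_fun setT v ->
  0 <= t <= 1 -> (J u <= a%:E)%E -> (J v <= b%:E)%E ->
  (J (fun x => t * u x + (1 - t) * v x)%R <= (t * a + (1 - t) * b)%:E)%E.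
Proof.
move=> mu_ mv t01 Ju Jv; have /andP[t0 t1] := t01.
have t1' : 0 <= 1 - t by rewrite subr_ge0.
apply: (@le_trans _ _ (t%:E * J u + (1 - t)%:E * J v)%E); last first.
  by rewrite [leRHS]EFinD [X in (_ <= X + _)%E]EFinM [X in (_ <= _ + X)%E]EFinM leeD// lee_wpmul2l.
have mE := measurable_energy_density mu_; have mE' := measurable_energy_density mv.
have D0 w := energy_density_ge0 w.
set w := (fun x => _).
have mw : measurable_fun setT w by apply: measurable_funD; exact: measurable_funM.
have : (\int[mu2]_z (energy_density w z)%:E <=
    t%:E * \int[mu2]_z (energy_density u z)%:E +
    (1 - t)%:E * \int[mu2]_z (energy_density v z)%:E)%E.
  rewrite -(intZ _ mE (D0 _) t0) -(intZ _ mE' (D0 _) t1').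
  have mtE : measurable_fun setT (fun z => t * energy_density u z).
    exact: measurable_funM.
  have mtE' : measurable_fun setT (fun z => (1 - t) * energy_density v z).
    exact: measurable_funM.
  rewrite -(intD _ mtE mtE'); [|by move=> z; rewrite mulr_ge0..].
  apply: le_int; [exact: measurable_energy_density|exact: measurable_funD|exact: D0|].
  move=> z; rewrite /energy_density !mulrA -mulrDl ler_wpM2r ?kernel_ge0//.
  have -> : w z.1 - w z.2 = t * (u z.1 - u z.2) + (1 - t) * (v z.1 - v z.2).
    by rewrite /w; ring.
  exact: normpowR_convex.
have I0 f : (0 <= \int[mu2]_z (energy_density f z)%:E)%E.
  by apply: integral_ge0 => z _; rewrite lee_fin; exact: energy_density_ge0.
rewrite !gagliardoE; move: (I0 w) (I0 u) (I0 v).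
move: (\int[mu2]_z _)%E (\int[mu2]_z _)%E (\int[mu2]_z _)%E.
move=> A B C A0 B0 C0 h.
rewrite muleCA [X in (_ <= _ + X)%E]muleCA -ge0_muleDr ?mule_ge0//.
by rewrite lee_wpmul2l// lee_fin ltW.
Qed.

Lemma ae_prod_both (P : X -> Prop) : (\forall x \ae mu, P x) ->
  \forall z \ae mu2, P z.1 /\ P z.2.
Proof.
move=> [A [mA A0 PA]]; exists ((A `*` setT) `|` (setT `*` A)); split.
- by apply: measurableU; exact: measurableX.
- apply/eqP; rewrite eq_le measure_ge0 andbT.
  have h1 : mu2 (A `*` setT) = 0%E by rewrite product_measure1E// [X in (X * _)%E]A0 mul0e.
  have h2 : mu2 (setT `*` A) = 0%E by rewrite product_measure1E// [X in (_ * X)%E]A0 mule0.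
  apply: le_trans (measureU2 _ _ _) _; [exact: measurableX|exact: measurableX|].
  by rewrite [X in (X + _ <= _)%E]h1 [X in (_ + X <= _)%E]h2 adde0.
- move=> [x y] /= /not_andP[nP|nP]; [left|right]; split=> //=; exact: PA.
Qed.

Lemma gagliardo_lsc (u : nat -> X -> R) l (C : R) : (forall n, u n \in L2) ->
  l \in L2 ->
  ipL2 mu (fun x => u n x - l x) (fun x => u n x - l x) @[n --> \oo] --> 0 ->
  (\forall n \near \oo, (J (u n) <= C%:E)%E) -> (J l <= C%:E)%E.
Proof.
move=> uL lL ul uC; have [k kn ae_ul] := L2_subseq_ae uL lL ul.
rewrite gagliardoE -lee_pdivlMl// invrK -EFinM.
apply: (@fatou_ae _ _ _ mu2 (fun n => energy_density (u (k n)))).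
- by move=> n; apply: measurable_energy_density; exact: (L2_measurable (uL _)).
- exact: (measurable_energy_density (L2_measurable lL)).
- by move=> n z; exact: energy_density_ge0.
- by move=> z; exact: energy_density_ge0.
- apply: filterS (ae_prod_both ae_ul) => z [h1 h2].
  by apply: cvgMr_tmp; apply: cvg_normpowR => //; exact: cvgB.
- case: uC => n0 _ uC; exists n0 => // n /= n0n.
  have := uC (k n) (leq_trans n0n (kn n)).
  by rewrite gagliardoE -lee_pdivlMl// invrK -EFinM.
Qed.

End energy.

(** * Contraction of the implicit step *)

Section accretivity.
Context (R : realType) (N : nat) (s p : R).
Context (p12 : 1 < p < 2).
Local Notation X := 'rV[R]_N.
Local Notation mu := (lebesgue_rV R N).
Local Notation mu2 := (mu \x mu)%E.
Local Notation L2 := (Lfun mu 2%:E).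
Local Notation J := (gagliardo_energy s p).
Local Notation ip := (ipL2 mu).
Local Notation pos r := (Num.max r 0).
Implicit Types u v g w : X -> R.

Let p1 : 1 <= p. Proof. by case/andP : p12 => /ltW. Qed.
Let p0 : 0 < p. Proof. exact: lt_le_trans p1. Qed.

Lemma ipL2Zr c f g : f \in L2 -> g \in L2 -> ip g (fun x => c * f x) = c * ip g f.
Proof. by move=> fL gL; rewrite ipL2C ipL2Zl// ipL2C. Qed.

Lemma ipL2Nr f g : f \in L2 -> g \in L2 -> ip g (fun x => - f x) = - ip g f.
Proof.
by move=> fL gL; under eq_fun do rewrite -mulN1r; rewrite ipL2Zr// mulN1r.
Qed.

Lemma ipL2Bl f g v : f \in L2 -> g \in L2 -> v \in L2 ->
  ip (fun x => f x - g x) v = ip f v - ip g v.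
Proof.
move=> fL gL vL; under eq_fun do rewrite -[X in _ + X]mulN1r.
by rewrite ipL2Dl ?ipL2Zl ?mulN1r//; exact: L2Z.
Qed.

Lemma subgradient_fin_num u g : subgradient s p u g -> J u \is a fin_num.
Proof.
move=> [uL gL /(_ _ (L2_0 _))]; rewrite gagliardo0//.
rewrite ge0_fin_numE ?gagliardo_ge0// ltey.
by case: (J u) (gagliardo_ge0 s p12 u).
Qed.

(** The subgradient inequalities are tested with u1 - q (u1 - u2) and
    u2 + q (u1 - u2). Being monotone with slope at most 1, q moves each pair of
    differences u1 x - u1 y, u2 x - u2 y towards each other, so the total energy
    does not increase. *)
Lemma subgradient_T_accretive u1 g1 u2 g2 (q : R -> R) :
  subgradient s p u1 g1 -> subgradient s p u2 g2 ->
  measurable_fun setT q -> q 0 = 0 ->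
  (forall r r', r <= r' -> 0 <= q r' - q r <= r' - r) ->
  0 <= ip (fun x => g1 x - g2 x) (fun x => q (u1 x - u2 x)).
Proof.
move=> S1 S2 mq q0 qL; have [u1L g1L H1] := S1; have [u2L g2L H2] := S2.
pose f x := q (u1 x - u2 x).
have mu1 := L2_measurable u1L; have mu2 := L2_measurable u2L.
have mf : measurable_fun setT f by apply: (measurableT_comp mq); exact: measurable_funB.
have fL : f \in L2.
  apply: (L2_le mf (L2B u1L u2L)) => x; rewrite /f.
  have [h|/ltW h] := leP 0 (u1 x - u2 x).
    have := qL _ _ h; rewrite q0 !subr0 => /andP[a b].
    by rewrite !ger0_norm.
  have := qL _ _ h; rewrite q0 !sub0r => /andP[a b].
  by rewrite !ler0_norm// -oppr_ge0.
have := H1 _ (L2B u1L fL); have := H2 _ (L2D u2L fL).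
have : (J (fun x => (u1 x - f x)%R) + J (fun x => (u2 x + f x)%R) <= J u1 + J u2)%E.
  apply: gagliardo_le2 => //.
  - exact: measurable_funB.
  - exact: measurable_funD.
  move=> z; rewrite /energy_density -!mulrDl ler_wpM2r ?kernel_ge0//.
  have -> : u1 z.1 - f z.1 - (u1 z.2 - f z.2) = (u1 z.1 - u1 z.2) - (f z.1 - f z.2) by ring.
  have -> : u2 z.1 + f z.1 - (u2 z.2 + f z.2) = (u2 z.1 - u2 z.2) + (f z.1 - f z.2) by ring.
  apply: normpowR_contract => //; rewrite /f.
  have e : u1 z.1 - u1 z.2 - (u2 z.1 - u2 z.2) = u1 z.1 - u2 z.1 - (u1 z.2 - u2 z.2) by ring.
  rewrite e; have [h|/ltW h] := leP (u1 z.2 - u2 z.2) (u1 z.1 - u2 z.1).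
    by rewrite qL.
  have /andP[a b] := qL _ _ h.
  by apply/orP; right; move: a b; lra.
have := subgradient_fin_num S1; have := subgradient_fin_num S2.
have -> : (\int[mu]_x (g1 x * (u1 x - f x - u1 x))) = - ip g1 f.
  rewrite -ipL2Nr//; congr (ip _ _); apply/funext => x; ring.
have -> : (\int[mu]_x (g2 x * (u2 x + f x - u2 x))) = ip g2 f.
  congr (ip _ _); apply/funext => x; ring.
rewrite ipL2Bl//.
case: (J u1) => [a| |]//; case: (J u2) => [b| |]// _ _.
case: (J _) => [a'| |]; case: (J _) => [b'| |]//.
rewrite -!EFinD !lee_fin; lra.
Qed.

Lemma implicit_step_L2 h w u : 0 < h -> implicit_step s p h w u ->
  u \in L2 /\ w \in L2.
Proof.
move=> h0 [uL gL _]; split => //.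
have := L2D (L2Z h gL) uL; set f := (fun x => _); suff -> : f = w by [].
by apply/funext => x; rewrite /f; field; rewrite gt_eqF.
Qed.

Lemma measurable_pos (f : X -> R) : measurable_fun setT f ->
  measurable_fun setT (fun x => pos (f x)).
Proof. by move=> mf; apply: measurable_maxr. Qed.

Lemma pos_ge0 (r : R) : 0 <= pos r. Proof. by rewrite le_max lexx orbT. Qed.

(** The test function min(e, (r - c)_+), divided by e, tends to the indicator of
    r > c as e tends to 0. *)
Lemma implicit_step_T_contraction h c w1 u1 w2 u2 : 0 < h -> 0 <= c ->
  implicit_step s p h w1 u1 -> implicit_step s p h w2 u2 ->
  (\int[mu]_x (pos (u1 x - u2 x - c))%:E <=
   \int[mu]_x (pos (w1 x - w2 x - c))%:E)%E.
Proof.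
move=> h0 c0 S1 S2.
have [u1L w1L] := implicit_step_L2 h0 S1; have [u2L w2L] := implicit_step_L2 h0 S2.
pose d x := u1 x - u2 x; pose a x := w1 x - w2 x.
have dL : d \in L2 by exact: L2B.
have aL : a \in L2 by exact: L2B.
have md := L2_measurable dL; have ma := L2_measurable aL.
have mpd : measurable_fun setT (fun x => pos (d x - c)).
  by apply: measurable_pos; exact: measurable_funB.
have mpa : measurable_fun setT (fun x => pos (a x - c)).
  by apply: measurable_pos; exact: measurable_funB.
have key e : 0 < e -> (\int[mu]_x (pos (d x - c) * Num.min e (pos (d x - c)))%:E <=
    e%:E * \int[mu]_x (pos (a x - c))%:E)%E.
  move=> e0; pose q (r : R) := Num.min e (pos (r - c)).
  have mq : measurable_fun setT q.
    apply: measurable_minr => //; apply: measurable_maxr => //.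
    exact: measurable_funB.
  have q0 : q 0 = 0.
    rewrite /q sub0r (max_idPr _) ?oppr_le0// min_r// ltW//.
  have qL r r' : r <= r' -> 0 <= q r' - q r <= r' - r.
    move=> rr'; rewrite /q !maxEle !minEle; do ! case: ifP; rewrite -?ltNge => *; lra.
  have q_ge0 r : 0 <= q r by rewrite /q le_min (ltW e0) pos_ge0.
  have := subgradient_T_accretive S1 S2 mq q0 qL.
  have qd_le x : q (d x) <= pos (d x - c) by rewrite /q ge_min lexx orbT.
  have mqd : measurable_fun setT (fun x => q (d x)) by exact: (measurableT_comp mq).
  have qdL : (fun x => q (d x)) \in L2.
    apply: (L2_le mqd dL) => x; rewrite ger0_norm//; apply: le_trans (qd_le x) _.
    by rewrite ge_max normr_ge0 andbT; apply: le_trans (ler_norm _); rewrite gerBl.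
  have -> : (fun x => (w1 x - u1 x) / h - (w2 x - u2 x) / h) =
      (fun x => h^-1 * (a x - d x)).
    by apply/funext => x; rewrite /a /d; ring.
  rewrite ipL2Zl//; last exact: L2B.
  rewrite pmulr_rge0 ?invr_gt0// => ip0.
  rewrite -intZ ?(ltW e0)//; last by move=> x; exact: pos_ge0.
  have [ooE|] := eqVneq (\int[mu]_x (e * pos (a x - c))%:E)%E +oo%E.
    by rewrite ooE leey.
  rewrite -ltey => fin.
  have mf : measurable_fun setT (fun x => pos (d x - c) * q (d x)) by exact: measurable_funM.
  have f0 x : 0 <= pos (d x - c) * q (d x) by rewrite mulr_ge0// pos_ge0.
  have iadq := L2_integrableM (L2B aL dL) qdL.
  have if_ : mu.-integrable setT (fun x => (pos (d x - c) * q (d x))%:E).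
    have := L2_integrableM dL dL; apply: le_integrable => //.
      exact/measurable_EFinP.
    move=> x _; rewrite lee_fin (ger0_norm (f0 x)) -expr2 ger0_norm ?sqr_ge0//.
    have hd : pos (d x - c) <= `|d x|.
      by rewrite ge_max normr_ge0 andbT; apply: le_trans (ler_norm _); rewrite gerBl.
    rewrite -real_normK ?num_real// expr2 ler_pM ?pos_ge0//.
    exact: le_trans (qd_le x) hd.
  have ia : mu.-integrable setT (fun x => (e * pos (a x - c))%:E).
    apply/integrableP; split.
      by apply/measurable_EFinP; exact: measurable_funM.
    apply: le_lt_trans fin; rewrite le_eqVlt; apply/orP; left; apply/eqP.
    by apply: eq_integral => x _; rewrite gee0_abs// lee_fin mulr_ge0 ?pos_ge0 ?ltW.
  apply: (@le_trans _ _ (\int[mu]_x ((pos (d x - c) * q (d x))%:E + ((a x - d x) * q (d x))%:E))%E).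
    rewrite integralD// leeDl//.
    have -> : (\int[mu]_x ((a x - d x) * q (d x))%:E = (ip (fun x => a x - d x) (fun x => q (d x)))%:E)%E.
      by rewrite /ipL2 /Rintegral fineK//; exact: integrable_fin_num.
    by rewrite lee_fin.
  apply: le_integral => //; first exact: integrableD.
  move=> x _; rewrite -EFinD lee_fin /q.
  have := q_ge0 (d x); rewrite /q.
  have hq : Num.min e (pos (d x - c)) <= e by rewrite ge_min lexx.
  have [hd|hd] := leP (d x - c) 0.
    rewrite (min_idPr _) ?mulr0 ?addr0 ?(ltW e0)// => _.
    by rewrite mulr_ge0 ?pos_ge0 ?ltW.
  move=> h1; rewrite -mulrDl.
  apply: (@le_trans _ _ (pos (a x - c) * Num.min e (d x - c))).
    by rewrite ler_wpM2r// le_max; apply/orP; left; lra.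
  by rewrite mulrC ler_wpM2r ?pos_ge0// ge_min lexx.
(* The estimate for e = 1 / (n + 1), divided by e. *)
apply: (@fatou_ae _ _ _ mu (fun n x => pos (d x - c) * Num.min 1 (n.+1%:R * pos (d x - c)))).
- move=> n; apply: measurable_funM => //; apply: measurable_minr => //.
  exact: measurable_funM.
- exact: mpd.
- by move=> n x; rewrite mulr_ge0 ?pos_ge0// le_min ler01 mulr_ge0 ?pos_ge0.
- by move=> x; exact: pos_ge0.
- apply: aeW => x; set r := pos (d x - c).
  have [r0|r0] := leP r 0.
    have -> : r = 0 by apply/eqP; rewrite eq_le r0 pos_ge0.
    by under eq_fun do rewrite mul0r; exact: cvg_cst.
  rewrite -[X in _ --> X]mulr1; apply: cvgMl_tmp.
  apply: cvg_near_cst.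
  have := @cvg_harmonic R; move/cvgrPdist_le => /(_ _ r0).
  apply: filterS => n; rewrite /= sub0r normrN ger0_norm ?invr_ge0// => hn.
  by apply/min_idPl; rewrite -ler_pdivrMl// mulr1.
- apply: nearW => n.
  have n0 : 0 < (n.+1%:R^-1 : R) by rewrite invr_gt0.
  have := key _ n0; rewrite -lee_pdivrMl// invrK; apply: le_trans.
  rewrite le_eqVlt; apply/orP; left; apply/eqP.
  rewrite -intZ//; last 2 first.
  - by apply: measurable_funM => //; exact: measurable_minr.
  - by move=> x; rewrite mulr_ge0 ?pos_ge0// le_min (ltW n0) pos_ge0.
  apply: eq_integral => x _; congr EFin; rewrite mulrCA; congr (_ * _).
  by rewrite minr_pMr// mulfV// gt_eqF.
Qed.

End accretivity.

(** * Truncation and the supremum of an implicit step *)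

Lemma le_integral_ae d (T : measurableType d) (R : realType)
    (m : {measure set T -> \bar R}) (f g : T -> \bar R) :
  m.-integrable setT f -> m.-integrable setT g ->
  (\forall x \ae m, (f x <= g x)%E) ->
  (\int[m]_x f x <= \int[m]_x g x)%E.
Proof.
move=> fi gi [A [mA A0 fgA]].
rewrite (negligible_integral mA measurableT fi A0).
rewrite [leRHS](negligible_integral mA measurableT gi A0).
have mTA : measurable (setT `\` A) by exact: measurableD.
apply: le_integral => //; [exact: integrableS fi|exact: integrableS gi|].
move=> x; rewrite inE => -[_ Ax]; apply: contrapT => nfg; apply: Ax.
exact: fgA.
Qed.

Section steps.
Context (R : realType) (N : nat) (s p : R).
Context (N0 : (0 < N)%N) (p12 : 1 < p < 2) (s01 : 0 < s < 1).
Local Notation X := 'rV[R]_N.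
Local Notation mu := (lebesgue_rV R N).
Local Notation mu2 := (mu \x mu)%E.
Local Notation L2 := (Lfun mu 2%:E).
Local Notation J := (gagliardo_energy s p).
Local Notation ip := (ipL2 mu).
Local Notation pos r := (Num.max r 0).
Implicit Types u v g w : X -> R.

Let p1 : 1 <= p. Proof. by case/andP : p12 => /ltW. Qed.
Let p0 : 0 < p. Proof. exact: lt_le_trans p1. Qed.
Let b0 := sing_exp_gt0 N p12 s01.
Local Notation sing := (sing_exp N s p).

(** Energy released per unit of the integral of (u - k)_+ by truncating u at
    level k, when u exceeds k / 2 on a set of measure at most m. *)
Definition sup_gain (k m : R) : R :=
  (2 * p)^-1 * ((k / 2) `^ (p - 1) * kernel_mass N sing m).

(** Truncation shortens the difference u x - u y when u x > k and u y <= k / 2,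
    and leaves it above k / 2. For fixed x such points y fill the complement of
    a set of measure at most m, on which the kernel keeps a definite mass. *)
Lemma gagliardo_truncate u (k m : R) : measurable_fun setT u -> 0 < k -> 0 < m ->
  (mu [set x | (k / 2 < u x)%R] <= m%:E)%E ->
  (J (fun x => Num.min (u x) k) +
    (sup_gain k m)%:E * \int[mu]_x (pos (u x - k))%:E <= J u)%E.
Proof.
move=> mu_ k0 m0 Em; set E := [set x | _] in Em.
have mE : measurable E.
  rewrite (_ : E = u @^-1` `]k / 2, +oo[%classic).
    exact: preimage_measurable.
  by apply/seteqP; split=> x /=; rewrite in_itv/= andbT.
pose f x := pos (u x - k); pose v x := Num.min (u x) k.
have mf : measurable_fun setT f by apply: measurable_pos; exact: measurable_funB.
have mv : measurable_fun setT v by exact: measurable_minr.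
pose c := (k / 2) `^ (p - 1).
have c0 : 0 <= c by exact: powR_ge0.
pose ex (z : X * X) := c * f z.1 * (\1_(~` E) z.2 / enorm (z.1 - z.2) `^ sing).
have mf1 : measurable_fun setT (fun z : X * X => f z.1).
  exact: (measurableT_comp mf measurable_fst).
have m1E : measurable_fun setT (fun z : X * X => \1_(~` E) z.2 : R).
  by apply: (measurableT_comp (measurable_indic (measurableC mE)) measurable_snd).
have mex : measurable_fun setT ex.
  apply: measurable_funM; first exact: measurable_funM.
  have mk : measurable_fun setT (fun z : X * X => (enorm (z.1 - z.2) `^ sing)^-1).
    exact: measurable_sing_kernel.
  exact: (measurable_funM m1E mk).
have f0 x : 0 <= f x by exact: pos_ge0.
have ex0 z : 0 <= ex z.
  by rewrite mulr_ge0// ?mulr_ge0 ?kernel_ge0.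
have pw z : energy_density s p v z + ex z <= energy_density s p u z.
  rewrite /energy_density /ex mulrA -mulrDl ler_wpM2r ?kernel_ge0//.
  have lip : `|v z.1 - v z.2| <= `|u z.1 - u z.2|.
    rewrite /v !minEle; do 2 case: ifP; rewrite -?ltNge => h1 h2 //;
      rewrite ?subrr ?normr0 ?normr_ge0//.
    - by rewrite !ler0_norm; lra.
    - by rewrite !ger0_norm; lra.
  have wk : `|v z.1 - v z.2| `^ p <= `|u z.1 - u z.2| `^ p.
    by apply: ge0_ler_powR; rewrite ?nnegrE// ltW.
  rewrite indicE; case: (boolP (z.2 \in ~` E)) => [|_]; last by rewrite mulr0 addr0.
  rewrite in_setC mulr1 => /negP zE.
  have z2 : u z.2 <= k / 2.
    by rewrite leNgt; apply/negP => h; apply: zE; exact/mem_set.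
  have [z1|z1] := leP (u z.1) k.
    by rewrite /f max_r ?subr_le0// mulr0 addr0.
  rewrite /f max_l; last by lra.
  rewrite /v (min_r (ltW z1)) min_l; last by lra.
  rewrite !ger0_norm; [|lra..].
  have := @powR_trunc _ p (u z.1 - u z.2) (k - u z.2) (k / 2) p1.
  have -> : u z.1 - u z.2 - (k - u z.2) = u z.1 - k by ring.
  by apply; lra.
have D0 w z : 0 <= energy_density s p w z by exact: energy_density_ge0.
have mDv := measurable_energy_density s p mv.
have mDu := measurable_energy_density s p mu_.
have h1 : (\int[mu2]_z (energy_density s p v z)%:E + \int[mu2]_z (ex z)%:E <=
    \int[mu2]_z (energy_density s p u z)%:E)%E.
  rewrite -(intD _ mDv mex (D0 v) ex0).
  apply: (le_int _ _ mDu _ pw); first exact: measurable_funD.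
  by move=> z; rewrite addr_ge0.
have km0 : 0 <= kernel_mass N sing m.
  by apply: divr_ge0; [exact: ltW|exact: powR_ge0].
have h2 : ((c * kernel_mass N sing m)%:E * \int[mu]_x (f x)%:E <=
    \int[mu2]_z (ex z)%:E)%E.
  rewrite fubini_tonelli1; last 2 first.
  - exact/measurable_EFinP.
  - by move=> z; rewrite lee_fin.
  rewrite -(intZ mu mf f0 (mulr_ge0 c0 km0)).
  apply: ge0_le_integral => //.
  - by move=> x _; rewrite lee_fin mulr_ge0// mulr_ge0.
  - by apply/measurable_EFinP; exact: measurable_funM.
  - apply: measurable_fun_fubini_tonelli_F => //; last exact/measurable_EFinP.
  move=> x _; rewrite /fubini_F/= /ex/=.
  have mg : measurable_fun setT (fun y => \1_(~` E) y / enorm (x - y) `^ sing).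
    apply: measurable_funM; first exact: (measurable_indic (measurableC mE)).
    under eq_fun do rewrite -powRN; apply: measurable_powRl; apply: measurable_enorm.
    exact: measurable_rVB.
  have g0 y : 0 <= \1_(~` E) y / enorm (x - y) `^ sing.
    by rewrite mulr_ge0 ?kernel_ge0.
  have := intZ mu mg g0 (mulr_ge0 c0 (f0 x)) => ->.
  rewrite mulrAC EFinM; apply: lee_wpmul2l; first by rewrite lee_fin mulr_ge0.
  exact: kernel_mass_outside N0 mE m0 Em (ltW b0).
have c2p : 0 < (2 * p)^-1 by rewrite invr_gt0 mulr_gt0.
have I0 (g : X * X -> R) : (forall z, 0 <= g z) -> (0 <= \int[mu2]_z (g z)%:E)%E.
  by move=> g0; apply: integral_ge0 => z _; rewrite lee_fin.
rewrite !gagliardoE /sup_gain EFinM -muleA -ge0_muleDr; last 2 first.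
- exact: I0.
- rewrite mule_ge0// ?lee_fin; first exact: mulr_ge0 (powR_ge0 _ _) km0.
  by apply: integral_ge0 => x _; rewrite lee_fin; exact: f0.
rewrite lee_wpmul2l ?lee_fin ?(ltW c2p)//.
by apply: le_trans h1; rewrite leeD2l.
Qed.

(** Testing with the truncation of u at level k, the released energy is at most
    (M - k) / h times the integral of (u - k)_+, which must therefore vanish. *)
Lemma implicit_step_sup h w u (M k m : R) : 0 < h -> 0 < k -> 0 < m ->
  implicit_step s p h w u -> (\forall x \ae mu, w x <= M) ->
  (mu [set x | (k / 2 < u x)%R] <= m%:E)%E ->
  M < k + h * sup_gain k m -> \forall x \ae mu, u x <= k.
Proof.
move=> h0 k0 m0 S wM Em Mk.
have [uL wL] := implicit_step_L2 h0 S; have mu_ := L2_measurable uL.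
pose f x := pos (u x - k); pose g x := (w x - u x) / h.
have mf : measurable_fun setT f by apply: measurable_pos; exact: measurable_funB.
have f0 x : 0 <= f x by exact: pos_ge0.
have fL : f \in L2.
  apply: (L2_le mf uL) => x; rewrite ger0_norm// /f ge_max normr_ge0 andbT.
  by apply: le_trans (ler_norm _); rewrite gerBl ltW.
have vE : (fun x => Num.min (u x) k) = (fun x => u x - f x).
  apply/funext => x; rewrite /f; case: (leP (u x) k) => hx.
    by rewrite max_r ?subr0// subr_le0.
  by rewrite max_l ?subr_ge0 ?ltW//; ring.
have [_ gL /(_ _ (L2B uL fL))] := S.
have -> : (\int[mu]_x ((w x - u x) / h * (u x - f x - u x))) = - ip g f.
  rewrite -(ipL2Nr fL gL); congr (ip _ _); apply/funext => x; ring.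
have := gagliardo_truncate mu_ k0 m0 Em; rewrite vE -/f.
have km0 : 0 < kernel_mass N sing m.
  rewrite divr_gt0// powR_gt0// mulr_gt0// ?sqrtr_gt0 ?ltr0n// divr_gt0//.
  by rewrite powR_gt0// mulr_gt0.
have C0 : 0 < sup_gain k m.
  have c2 : 0 < (2 * p)^-1 by rewrite invr_gt0 mulr_gt0.
  have k2 : 0 < (k / 2) `^ (p - 1) by rewrite powR_gt0// divr_gt0.
  exact: mulr_gt0 c2 (mulr_gt0 k2 km0).
have I0 : (0 <= \int[mu]_x (f x)%:E)%E by apply: integral_ge0 => x _; rewrite lee_fin.
move: (subgradient_fin_num p12 S) (gagliardo_ge0 s p12 (fun x => u x - f x)).
case: (J u) => [a| |]// _; case IE : (\int[mu]_x (f x)%:E)%E I0 => [i| |]// i0; last first.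
  by case: (J _) => [b| |]// _; rewrite gt0_muley ?lte_fin.
case: (J _) => [b| |]// _.
rewrite -EFinM -!EFinD !lee_fin => H1 H2.
have fi : mu.-integrable setT (EFin \o f).
  apply/integrableP; split; first exact/measurable_EFinP.
  rewrite (_ : \int[mu]_x _ = i%:E)%E ?ltry// -IE; apply: eq_integral => x _.
  by rewrite /= ger0_norm.
have H3 : ip g f <= (M - k) / h * i.
  have igf := L2_integrableM gL fL.
  rewrite -lee_fin EFinM -IE /ipL2 /Rintegral fineK; last exact: integrable_fin_num.
  have := @integralZl _ _ _ mu setT measurableT _ fi ((M - k) / h).
  move=> /= <-; apply: le_integral_ae => //; first exact: integrableZl.
  apply: filterS wM => x wx; rewrite -EFinM lee_fin /f.
  have [hx|hx] := leP (u x - k) 0; first by rewrite !mulr0.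
  rewrite ler_wpM2r ?(ltW hx)// ler_wpM2r ?invr_ge0 ?(ltW h0)//; lra.
have i_0 : i = 0.
  rewrite lee_fin in i0; apply/eqP; rewrite eq_le i0 andbT.
  have : (sup_gain k m - (M - k) / h) * i <= 0 by rewrite mulrBl; lra.
  rewrite pmulr_rle0// subr_gt0 ltr_pdivrMr//; lra.
rewrite i_0 in IE.
have := int_eq0_ae mf f0 IE.
apply: filterS => x; rewrite /f => /eqP; rewrite eq_le => /andP[+ _].
by rewrite ge_max lexx andbT subr_le0.
Qed.

End steps.

(** * Polarization *)

Lemma ler_powR_inv (R : realType) (a b r : R) : 0 < a -> a <= b -> 0 <= r ->
  (b `^ r)^-1 <= (a `^ r)^-1.
Proof.
move=> a0 ab r0; have b0 := lt_le_trans a0 ab.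
rewrite lef_pV2 ?posrE ?powR_gt0//; apply: ge0_ler_powR; rewrite ?nnegrE//; exact: ltW.
Qed.

Lemma int_four d (T : measurableType d) (R : realType)
    (m : {measure set T -> \bar R}) (f1 f2 f3 f4 : T -> R) (I : \bar R) :
  measurable_fun setT f1 -> measurable_fun setT f2 ->
  measurable_fun setT f3 -> measurable_fun setT f4 ->
  (forall x, 0 <= f1 x) -> (forall x, 0 <= f2 x) ->
  (forall x, 0 <= f3 x) -> (forall x, 0 <= f4 x) ->
  (\int[m]_x (f1 x)%:E = I)%E -> (\int[m]_x (f2 x)%:E = I)%E ->
  (\int[m]_x (f3 x)%:E = I)%E -> (\int[m]_x (f4 x)%:E = I)%E ->
  (\int[m]_x (f1 x + f2 x + (f3 x + f4 x))%:E = 4%:E * I)%E.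
Proof.
move=> m1 m2 m3 m4 p1 p2 p3 p4 I1 I2 I3 I4.
have I0 : (0 <= I)%E by rewrite -I1; apply: integral_ge0 => x _; rewrite lee_fin.
rewrite intD; [|exact: measurable_funD|exact: measurable_funD|
  by move=> x; exact: addr_ge0..].
rewrite !intD// I1 I2 I3 I4 (_ : 4 = 1 + 1 + (1 + 1))//; last by ring.
by rewrite !EFinD !ge0_muleDl ?adde_ge0// mul1e.
Qed.

Lemma lee_pmul4 (R : realType) (c : R) (a b : \bar R) : 0 <= c ->
  (4%:E * a <= 4%:E * b -> c%:E * a <= c%:E * b)%E.
Proof. by move=> c0; rewrite lee_pmul2l ?lte_fin// => ab; rewrite lee_wpmul2l. Qed.

(** Sorting both pairs, so that the heavier weight k1 joins the larger values
    with each other, lowers the cost. *)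
Lemma powR_rearrange (R : realType) (p k1 k2 a a' b b' : R) : 1 <= p -> k2 <= k1 ->
  k1 * (`|Num.max a a' - Num.max b b'| `^ p + `|Num.min a a' - Num.min b b'| `^ p) +
  k2 * (`|Num.max a a' - Num.min b b'| `^ p + `|Num.min a a' - Num.max b b'| `^ p) <=
  k1 * (`|a - b| `^ p + `|a' - b'| `^ p) + k2 * (`|a - b'| `^ p + `|a' - b| `^ p).
Proof.
move=> p1 k12.
have key x x' y y' : x' <= x -> y' <= y ->
    (k1 - k2) * (`|x - y| `^ p + `|x' - y'| `^ p) <=
    (k1 - k2) * (`|x - y'| `^ p + `|x' - y| `^ p).
  move=> xx yy; rewrite ler_wpM2l ?subr_ge0//.
  have -> : x - y = (x - y') - (y - y') by ring.
  have -> : x' - y' = (x' - y) + (y - y') by ring.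
  apply: normpowR_contract => //; apply/orP; left; lra.
case: (leP a a') => ha; case: (leP b b') => hb; rewrite ?(addrC (`|a' - _| `^ p)) //.
- by move: (key a' a b b' ha (ltW hb)); lra.
- by move: (key a a' b' b (ltW ha) hb); lra.
Qed.

Section change_of_variables.
Context (R : realType) (N : nat).
Local Notation X := 'rV[R]_N.
Local Notation mu := (lebesgue_rV R N).
Local Notation L2 := (Lfun mu 2%:E).
Local Notation ip := (ipL2 mu).
Implicit Types f g : X -> R.

Lemma integral_measure_preserving (t : X -> X) (f : X -> \bar R) :
  measure_preserving t -> measurable_fun setT f ->
  (\int[mu]_x f (t x) = \int[mu]_x f x)%E.
Proof.
move=> [mt tP] mf; rewrite integralE [RHS]integralE; congr (_ - _)%E.
  rewrite -(tP (f^\+)%E (measurable_funepos mf) (funepos_ge0 f)).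
  by apply: eq_integral => x _; rewrite !funeposE.
rewrite -(tP (f^\-)%E (measurable_funeneg mf) (funeneg_ge0 f)).
  by apply: eq_integral => x _; rewrite !funenegE.
Qed.

Lemma integrable_scale l (f : X -> \bar R) : 0 < l -> mu.-integrable setT f ->
  (\int[mu]_x f (l *: x)%R = (l^-1 ^+ N)%:E * \int[mu]_x f x)%E.
Proof.
move=> l0 fi; have mf := measurable_int _ fi.
rewrite integralE [in RHS]integralE muleBr//; last first.
  by apply: fin_num_adde_defr; exact: integrable_pos_fin_num.
congr (_ - _)%E.
  rewrite -(integral_scale l0 (measurable_funepos mf) (funepos_ge0 f)).
  by apply: eq_integral => x _; rewrite !funeposE.
rewrite -(integral_scale l0 (measurable_funeneg mf) (funeneg_ge0 f)).
  by apply: eq_integral => x _; rewrite !funenegE.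
Qed.

Lemma L2_measure_preserving (t : X -> X) f : measure_preserving t ->
  f \in L2 -> (fun x => f (t x)) \in L2.
Proof.
move=> [mt tP] fL; have mf := L2_measurable fL.
apply: L2P; first exact: (measurableT_comp mf mt).
rewrite (tP (fun x => (f x ^+ 2)%:E)); first exact: L2_lty.
- by apply/measurable_EFinP; exact: measurable_funX.
- by move=> x; rewrite lee_fin sqr_ge0.
Qed.

Lemma L2_scale l f : 0 < l -> f \in L2 -> (fun x => f (l *: x)) \in L2.
Proof.
move=> l0 fL; have mf := L2_measurable fL.
apply: L2P; first by apply: (measurableT_comp mf); exact: measurable_rVZ.
rewrite (integral_scale (f := fun x => (f x ^+ 2)%:E))//.
- rewrite lte_mul_pinfty ?lee_fin ?exprn_ge0 ?invr_ge0 ?(ltW l0)//; exact: L2_lty.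
- by apply/measurable_EFinP; exact: measurable_funX.
- by move=> x; rewrite lee_fin sqr_ge0.
Qed.

Lemma ipL2_measure_preserving (t : X -> X) f g : measure_preserving t ->
  f \in L2 -> g \in L2 -> ip (fun x => f (t x)) (fun x => g (t x)) = ip f g.
Proof.
move=> tP fL gL; rewrite /ipL2 /Rintegral.
rewrite (integral_measure_preserving (f := fun x => (f x * g x)%:E))//.
have mf := L2_measurable fL; have mg := L2_measurable gL.
by apply/measurable_EFinP; exact: measurable_funM.
Qed.

Lemma ipL2_scale l f g : 0 < l -> f \in L2 -> g \in L2 ->
  ip (fun x => f (l *: x)) (fun x => g (l *: x)) = l^-1 ^+ N * ip f g.
Proof.
move=> l0 fL gL; rewrite /ipL2 /Rintegral.
have fgi := L2_integrableM fL gL.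
rewrite (integrable_scale (f := fun x => (f x * g x)%:E))//.
by rewrite fineM//; exact: integrable_fin_num.
Qed.

Lemma measurable_orbit (t : X -> X) (d : X * X -> R) : measurable_fun setT t ->
  measurable_fun setT d -> measurable_fun setT (fun z : X * X =>
    d (z.1, z.2) + d (t z.1, t z.2) + (d (z.1, t z.2) + d (t z.1, z.2))).
Proof.
move=> mt mD; have m1 := measurable_prod_map1 mt; have m2 := measurable_prod_map2 mt.
have md2 : measurable_fun setT (fun z : X * X => d (z.1, t z.2)).
  exact: (measurableT_comp mD m2).
apply: measurable_funD; apply: measurable_funD.
- by under eq_fun do rewrite -surjective_pairing; exact: mD.
- exact: (measurableT_comp md2 m1).
- exact: md2.
- exact: (measurableT_comp mD m1).
Qed.

(** Energies are compared after summing over the four points obtained by applying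
    the transformation to either variable. *)
Lemma int_orbit (t : X -> X) (d : X * X -> R) : measure_preserving t ->
  measurable_fun setT d -> (forall z, 0 <= d z) ->
  (\int[(mu \x mu)%E]_z
     (d (z.1, z.2) + d (t z.1, t z.2) + (d (z.1, t z.2) + d (t z.1, z.2)))%:E =
   4%:E * \int[(mu \x mu)%E]_z (d z)%:E)%E.
Proof.
move=> tP mD d0; have [mt _] := tP.
have m1 := measurable_prod_map1 mt; have m2 := measurable_prod_map2 mt.
have md1 : measurable_fun setT (fun z : X * X => d (t z.1, z.2)) by exact: (measurableT_comp mD m1).
have md2 : measurable_fun setT (fun z : X * X => d (z.1, t z.2)) by exact: (measurableT_comp mD m2).
have md12 : measurable_fun setT (fun z : X * X => d (t z.1, t z.2)).
  exact: (measurableT_comp md2 m1).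
have mdd : measurable_fun setT (fun z : X * X => d (z.1, z.2)).
  by under eq_fun do rewrite -surjective_pairing; exact: mD.
have md' : measurable_fun setT (fun z => (d z)%:E) by exact/measurable_EFinP.
have d0' z : (0 <= (d z)%:E)%E by rewrite lee_fin.
have md2' : measurable_fun setT (fun z : X * X => (d (z.1, t z.2))%:E) by exact/measurable_EFinP.
have d20' (z : X * X) : (0 <= (d (z.1, t z.2))%:E)%E by rewrite lee_fin.
have e0 : (\int[(mu \x mu)%E]_z (d (z.1, z.2))%:E = \int[(mu \x mu)%E]_z (d z)%:E)%E.
  by apply: eq_integral => -[].
have e1 := prod_measure_preserving1 tP md' d0'.
have e2 := prod_measure_preserving2 tP md' d0'.
have e12 := etrans (prod_measure_preserving1 tP md2' d20') e2.
exact: (int_four mdd md12 md2 md1 (fun z => d0 _) (fun z => d0 _) (fun z => d0 _)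
  (fun z => d0 _) e0 e12 e2 e1).
Qed.

End change_of_variables.

Section polarization.
Context (R : realType) (N : nat) (s p : R).
Context (p12 : 1 < p < 2) (s01 : 0 < s < 1).
Local Notation X := 'rV[R]_N.
Local Notation mu := (lebesgue_rV R N).
Local Notation mu2 := (mu \x mu)%E.
Local Notation L2 := (Lfun mu 2%:E).
Local Notation J := (gagliardo_energy s p).
Local Notation ip := (ipL2 mu).
Local Notation pos r := (Num.max r 0).
Implicit Types u w : X -> R.
Context (v : X) (c : R) (v0 : v != 0).
Local Notation sg := (refl v c).

Let p1 : 1 <= p. Proof. by case/andP : p12 => /ltW. Qed.
Let p0 : 0 < p. Proof. exact: lt_le_trans p1. Qed.

(** Polarization, the two-point rearrangement that moves the larger of the values
    at x and at its mirror image to the half-space dot x v <= c. *)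
Definition polarize u (x : X) : R :=
  if dot x v <= c then Num.max (u x) (u (sg x)) else Num.min (u x) (u (sg x)).

Lemma dot_refl x : dot (sg x) v = 2 * c - dot x v.
Proof. by have vv := dot_gt0 v0; rewrite /refl !dotE; field; rewrite gt_eqF. Qed.

Lemma refl_hyperplane x : dot x v = c -> sg x = x.
Proof. by move=> xc; rewrite /refl xc subrr mulr0 mul0r scale0r addr0. Qed.

Lemma polarize_half u x : dot x v <= c ->
  polarize u x = Num.max (u x) (u (sg x)) /\
  polarize u (sg x) = Num.min (u x) (u (sg x)).
Proof.
move=> xc; rewrite /polarize xc; split => //; rewrite dot_refl reflK//.
have [h|h] := leP; last by rewrite minC.
have xE : dot x v = c by lra.
by rewrite (refl_hyperplane xE) maxxx minxx.
Qed.

Lemma enorm_refl_half x y : dot x v <= c -> dot y v <= c ->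
  enorm (x - y) <= enorm (x - sg y).
Proof.
move=> xc yc; rewrite le_enorm_dot; have vv := dot_gt0 v0.
have -> : dot (x - sg y) (x - sg y) = dot (x - y) (x - y) +
   4 * (c - dot y v) * (c - dot x v) / dot v v.
  rewrite /refl opprD addrA.
  have : dot (x - y) v = dot x v - dot y v by rewrite !dotE.
  move: (x - y) => z zv; rewrite !dotE (dotC v z) zv; field; by rewrite gt_eqF.
by rewrite lerDl divr_ge0 ?(ltW vv)// mulr_ge0 ?subr_ge0// mulr_ge0// subr_ge0.
Qed.

Let D u x y : R := energy_density s p u (x, y).
Let orbit_sum u x y := D u x y + D u (sg x) (sg y) + (D u x (sg y) + D u (sg x) y).

Let orbit_le_half u x y : dot x v <= c -> dot y v <= c ->
  orbit_sum (polarize u) x y <= orbit_sum u x y.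
Proof.
move=> xc yc; rewrite /orbit_sum /D /energy_density/=.
have [-> ->] := polarize_half u xc; have [-> ->] := polarize_half u yc.
have e1 : enorm (sg x - sg y) = enorm (x - y) by exact: enorm_refl.
have e2 : enorm (sg x - y) = enorm (x - sg y).
  by rewrite -(enorm_refl c (sg x) y v0) reflK.
have e3 := enorm_refl_half xc yc.
have e4 : x = y -> sg x = sg y by move=> ->.
move: e1 e2 e3 e4; move: (sg x) (sg y) => x' y' -> -> e3 e4.
have [xy|xy] := eqVneq x y.
  rewrite -(e4 xy) -xy !subrr normr0 powR0 ?gt_eqF// !mul0r !add0r.
  by case: (leP (u x)) => // _; rewrite addrC.
have exy : 0 < enorm (x - y) by rewrite enorm_gt0// subr_eq0.
have exy' := lt_le_trans exy e3.
have k12 : (enorm (x - y') `^ sing_exp N s p)^-1 <= (enorm (x - y) `^ sing_exp N s p)^-1.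
  exact: ler_powR_inv exy e3 (ltW (sing_exp_gt0 N p12 s01)).
have := powR_rearrange (u x) (u x') (u y) (u y') p1 k12.
move=> H; have E (a b d e a' b' d' e' k1 k2 : R) :
    k1 * (a + b) + k2 * (d + e) <= k1 * (a' + b') + k2 * (d' + e') ->
    a * k1 + b * k1 + (d * k2 + e * k2) <= a' * k1 + b' * k1 + (d' * k2 + e' * k2).
  by rewrite -!mulrDl ![_ * k1]mulrC ![_ * k2]mulrC.
exact: E H.
Qed.

Let orbit_sum1 u x y : orbit_sum u (sg x) y = orbit_sum u x y.
Proof.
rewrite /orbit_sum (reflK c v0 x); move: (D u) => d.
by rewrite addrC [X in X + _ = _]addrC [X in _ + X = _]addrC.
Qed.

Let orbit_sum2 u x y : orbit_sum u x (sg y) = orbit_sum u x y.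
Proof. by rewrite /orbit_sum (reflK c v0 y); move: (D u) => d; rewrite addrC. Qed.

Let orbit_le u x y : orbit_sum (polarize u) x y <= orbit_sum u x y.
Proof.
have H x' : dot x' v <= c \/ dot (sg x') v <= c.
  by rewrite dot_refl; have [|/ltW] := leP (dot x' v) c; [left|right; lra].
case: (H x) (H y) => hx [] hy.
- exact: orbit_le_half.
- by rewrite -(orbit_sum2 _ x y) -(orbit_sum2 u x y); exact: orbit_le_half.
- by rewrite -(orbit_sum1 _ x y) -(orbit_sum1 u x y); exact: orbit_le_half.
- rewrite -(orbit_sum1 _ x y) -(orbit_sum1 u x y).
  by rewrite -(orbit_sum2 _ _ y) -(orbit_sum2 u _ y); exact: orbit_le_half.
Qed.

Let sgP := refl_measure_preserving c v0.

Lemma measurable_polarize u : measurable_fun setT u -> measurable_fun setT (polarize u).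
Proof.
move=> mu_; have mus : measurable_fun setT (fun x => u (sg x)).
  exact: (measurableT_comp mu_ (measurable_refl v c)).
apply: measurable_fun_ifT.
- apply: measurable_fun_ler => //; exact: measurable_dot.
- exact: measurable_maxr.
- exact: measurable_minr.
Qed.

Let measurable_orbit_sum u : measurable_fun setT u ->
  measurable_fun setT (fun z : X * X => orbit_sum u z.1 z.2).
Proof.
move=> mu_; exact: (measurable_orbit (measurable_refl v c)
  (measurable_energy_density s p mu_)).
Qed.

Let orbit_int u : measurable_fun setT u ->
  (\int[mu2]_z (orbit_sum u z.1 z.2)%:E =
   4%:E * \int[mu2]_z (energy_density s p u z)%:E)%E.
Proof.
move=> mu_; exact: (int_orbit sgP (measurable_energy_density s p mu_)
  (energy_density_ge0 s p u)).
Qed.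

(** On an orbit the kernel takes two values, the larger one for two points on the
    same side, and polarization joins the larger values of u there. *)
Lemma polarize_energy u : measurable_fun setT u -> (J (polarize u) <= J u)%E.
Proof.
move=> mu_; have mpu := measurable_polarize mu_.
have c0 : 0 <= (2 * p)^-1 by rewrite invr_ge0 mulr_ge0// ltW.
apply: (lee_pmul4 c0); rewrite -(orbit_int mpu) -(orbit_int mu_); apply: le_int.
- exact: measurable_orbit_sum.
- exact: measurable_orbit_sum.
- by move=> z; rewrite !addr_ge0 ?energy_density_ge0.
- by move=> z; exact: orbit_le.
Qed.

(** The polarization of u is u + phi - phi o s for phi = (u o s - u)_+ on the
    half-space. As it does not increase the energy, testing with it gives
    int (g - g o s) phi <= 0 for g = (w - u) / h; but h (g - g o s) >= phi where
    phi is positive, so phi vanishes. *)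
Lemma implicit_step_polar h w u : 0 < h -> implicit_step s p h w u ->
  (\forall x \ae mu, dot x v <= c -> w (sg x) <= w x) ->
  \forall x \ae mu, dot x v <= c -> u (sg x) <= u x.
Proof.
move=> h0 S wsym; have [uL wL] := implicit_step_L2 h0 S.
have mu_ := L2_measurable uL.
pose usg x := u (sg x); pose wsg x := w (sg x).
have usL : usg \in L2 by exact: L2_measure_preserving.
have wsL : wsg \in L2 by exact: L2_measure_preserving.
pose phi x := if dot x v <= c then pos (u (sg x) - u x) else 0.
have mphi : measurable_fun setT phi.
  apply: measurable_fun_ifT => //.
    by apply: measurable_fun_ler => //; exact: measurable_dot.
  apply: measurable_pos; apply: (measurable_funB (L2_measurable usL) mu_).
have phiL : phi \in L2.
  apply: (L2_le mphi (L2B usL uL)) => x; rewrite /phi; case: ifP => _.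
    by rewrite ger0_norm ?pos_ge0// ge_max ler_norm normr_ge0.
  by rewrite normr0 normr_ge0.
pose phis x := phi (sg x).
have phisL : phis \in L2 by exact: L2_measure_preserving.
have polE : polarize u = (fun x => u x + (phi x - phis x)).
  apply/funext => x; rewrite /phis /phi dot_refl (reflK c v0).
  have uE : dot x v = c -> u (sg x) = u x by move=> xE; rewrite refl_hyperplane.
  rewrite /polarize; move: (u x) (u (sg x)) uE => a b.
  have [xc|xc] := leP (dot x v) c; have [xc'|xc'] := leP (2 * c - dot x v) c => uE.
  - by rewrite uE ?subrr ?maxxx ?subrr ?addr0//; lra.
  - by rewrite subr0 !maxEle; do 2 case: ifP; rewrite -?ltNge => *; lra.
  - by rewrite sub0r maxEle minEle; do 2 case: ifP; rewrite -?ltNge => *; lra.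
  - by exfalso; lra.
have [_ gL /(_ _ (L2D uL (L2B phiL phisL)))] := S.
set g := (fun x => (w x - u x) / h) in gL *.
have -> : (\int[mu]_x (g x * (u x + (phi x - phis x) - u x))) =
    ip g phi - ip (fun x => g (sg x)) phi.
  transitivity (ip g (fun x => phi x - phis x)).
    by congr (ip _ _); apply/funext => x; ring.
  rewrite ipL2C ipL2Bl// !(ipL2C _ _ g); congr (_ - _).
  rewrite -(ipL2_measure_preserving sgP gL phisL); congr (ip _ _).
  by apply/funext => x; rewrite /phis reflK.
rewrite -ipL2Bl//; last exact: L2_measure_preserving.
set dg := (fun x => g x - g (sg x)).
have dgL : dg \in L2 by apply: L2B => //; exact: L2_measure_preserving.
rewrite -polE => H.
have H1 : ip dg phi <= 0.
  have := le_trans H (polarize_energy mu_).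
  have := subgradient_fin_num p12 S; case: (J u) => [a| |]// _.
  by rewrite -EFinD lee_fin gerDl.
have H2 : ip phi phi <= h * ip dg phi.
  rewrite -ipL2Zl// /ipL2 /Rintegral fine_le//.
  - exact: integrable_fin_num (L2_integrableM phiL phiL).
  - by apply: integrable_fin_num => //; exact: L2_integrableM (L2Z h dgL) phiL.
  - apply: le_integral_ae; [exact: L2_integrableM|by apply: L2_integrableM => //; exact: L2Z|].
    apply: filterS wsym => x wx; rewrite lee_fin /phi.
    case: ifP => [xc|_]; last by rewrite !mulr0.
    have := wx xc; rewrite /dg /g => wx'.
    have -> : h * ((w x - u x) / h - (w (sg x) - u (sg x)) / h) =
        (w x - w (sg x)) + (u (sg x) - u x) by field; rewrite gt_eqF.
    have [ux|ux] := leP (u (sg x) - u x) 0; first by rewrite !mulr0.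
    by rewrite ler_wpM2r ?(ltW ux)// lerDr subr_ge0.
have phi0 : (\int[mu]_x (phi x ^+ 2)%:E = 0)%E.
  rewrite -ipL2E//; congr EFin; apply/eqP; rewrite eq_le ipL2_ge0 andbT.
  by apply: le_trans H2 _; rewrite pmulr_rle0.
have := int_eq0_ae (measurable_funX 2 mphi) (fun x => sqr_ge0 (phi x)) phi0.
apply: filterS => x /eqP; rewrite sqrf_eq0 /phi => /eqP + xc; rewrite xc => px.
by rewrite -subr_le0 -px le_max lexx.
Qed.

End polarization.

(** * Rescaling, and functions of finite energy *)

Section scaling.
Context (R : realType) (N : nat) (s p : R).
Context (p12 : 1 < p < 2).
Local Notation X := 'rV[R]_N.
Local Notation mu := (lebesgue_rV R N).
Local Notation mu2 := (mu \x mu)%E.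
Local Notation L2 := (Lfun mu 2%:E).
Local Notation J := (gagliardo_energy s p).
Local Notation ip := (ipL2 mu).
Implicit Types u w : X -> R.
Context (a l : R) (a0 : 0 < a) (l0 : 0 < l).

Definition rescale u (x : X) : R := a * u (l *: x).

(** Rescaling divides time by this factor. *)
Definition rescale_rate : R := a `^ (p - 2) * l `^ (s * p).

Lemma rescale_rate_gt0 : 0 < rescale_rate.
Proof. by rewrite mulr_gt0// powR_gt0. Qed.

Let cI : R := a ^+ 2 * l^-1 ^+ N.

Let cI_gt0 : 0 < cI.
Proof. by rewrite mulr_gt0 ?exprn_gt0 ?invr_gt0. Qed.

Lemma rescale_L2 u : u \in L2 -> rescale u \in L2.
Proof. by move=> uL; apply: L2Z; exact: L2_scale. Qed.

Let rescale_density u z : energy_density s p (rescale u) z =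
  a `^ p * l `^ sing_exp N s p * energy_density s p u (l *: z.1, l *: z.2).
Proof.
rewrite /energy_density /rescale /= -mulrBr normrM (gtr0_norm a0) powRM ?(ltW a0)//.
rewrite -scalerBr enormZ (gtr0_norm l0) powRM ?enorm_ge0 ?(ltW l0)//.
have lb : l `^ sing_exp N s p != 0 by rewrite gt_eqF ?powR_gt0.
rewrite invfM.
move: (enorm _ `^ _)^-1 (`| _ | `^ p) => e A.
by field.
Qed.

Let rate_const : a `^ p * l `^ sing_exp N s p * (l^-1 ^+ N) ^+ 2 = cI * rescale_rate.
Proof.
have -> : a `^ p = a ^+ 2 * a `^ (p - 2).
  rewrite -powR_mulrn ?(ltW a0)// -powRD; last by apply/implyP => _; rewrite gt_eqF.
  by congr (_ `^ _); ring.
have -> : l `^ sing_exp N s p = l ^+ N * l `^ (s * p).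
  by rewrite -powR_mulrn ?(ltW l0)// -powRD//; apply/implyP => _; rewrite gt_eqF.
rewrite /cI /rescale_rate exprVn.
have lN : l ^+ N != 0 by rewrite gt_eqF ?exprn_gt0.
move: (l ^+ N) (l `^ (s * p)) (a `^ (p - 2)) lN => A B C A0.
by field.
Qed.

Lemma rescale_energy u : measurable_fun setT u ->
  J (rescale u) = ((cI * rescale_rate)%:E * J u)%E.
Proof.
move=> mu_; rewrite !gagliardoE.
have mD : measurable_fun setT (fun z => (energy_density s p u z)%:E).
  by apply/measurable_EFinP; exact: measurable_energy_density.
have D0 z : (0 <= (energy_density s p u z)%:E)%E.
  by rewrite lee_fin; exact: energy_density_ge0.
have ml : measurable_fun [set: X] (fun x : X => l *: x) by exact: measurable_rVZ.
have mDl : measurable_fun setT (fun z : X * X => energy_density s p u (l *: z.1, l *: z.2)).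
  have m2 := measurableT_comp (measurable_energy_density s p mu_) (measurable_prod_map2 ml).
  exact: (measurableT_comp m2 (measurable_prod_map1 ml)).
have E1 : (\int[mu2]_z (energy_density s p (rescale u) z)%:E =
    \int[mu2]_z (a `^ p * l `^ sing_exp N s p *
      energy_density s p u (l *: z.1, l *: z.2))%:E)%E.
  by apply: eq_integral => z _; rewrite rescale_density.
have c0 : 0 <= a `^ p * l `^ sing_exp N s p by rewrite mulr_ge0 ?powR_ge0.
have E2 := intZ mu2 mDl (fun z => energy_density_ge0 s p u _) c0.
have E3 := prod_integral_scale l0 mD D0.
have E4 := etrans E1 (etrans E2 (congr1 _ E3)).
rewrite E4 !muleA; congr (_ * _)%E; rewrite -!EFinM; congr EFin.
by rewrite -rate_const; move: (_^-1) => c2; rewrite -mulrA mulrC.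
Qed.

(** The energy is multiplied by rescale_rate times the factor of the inner
    product; their quotient goes into the length of the step. *)
Lemma implicit_step_scale h w u : 0 < h -> implicit_step s p h w u ->
  implicit_step s p (h / rescale_rate) (rescale w) (rescale u).
Proof.
move=> h0 S; have [uL wL] := implicit_step_L2 h0 S; have [_ gL H] := S.
have k0 := rescale_rate_gt0.
have gE : (fun x => (rescale w x - rescale u x) / (h / rescale_rate)) =
    rescale (fun x => rescale_rate * ((w x - u x) / h)).
  apply/funext => x; rewrite /rescale; field.
  by rewrite !gt_eqF.
rewrite /implicit_step gE; split; [exact: rescale_L2| |].
  by apply: rescale_L2; exact: L2Z.
move=> V VL; pose v x := a^-1 * V (l^-1 *: x).
have vL : v \in L2 by apply: L2Z; apply: L2_scale => //; rewrite invr_gt0.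
have VE : rescale v = V.
  apply/funext => x; rewrite /rescale /v scalerA mulVf ?gt_eqF// scale1r.
  by rewrite mulrA divff ?gt_eqF// mul1r.
have := H v vL; set r1 := (\int[mu]_x _) => Hv.
set r2 := (\int[mu]_x _).
have r2E : r2 = cI * rescale_rate * r1.
  have kgL := L2Z rescale_rate gL.
  have -> : r2 = ip (rescale (fun x => rescale_rate * ((w x - u x) / h)))
      (rescale (fun x => v x - u x)).
    congr (ip _ _); apply/funext => x; rewrite -VE /rescale; ring.
  have vuL := L2B vL uL.
  rewrite /rescale ipL2Zl; [|exact: (L2_scale l0 kgL)|exact: (L2Z a (L2_scale l0 vuL))].
  rewrite (ipL2Zr a (L2_scale l0 vuL) (L2_scale l0 kgL)).
  rewrite (ipL2_scale l0 kgL vuL) ipL2Zl//.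
  have -> : ip (fun x => (w x - u x) / h) (fun x => v x - u x) = r1 by [].
  by rewrite /cI; ring.
rewrite -VE !rescale_energy; [|exact: L2_measurable vL|exact: L2_measurable uL].
have c0 : 0 < cI * rescale_rate by rewrite mulr_gt0.
rewrite r2E; move: (cI * rescale_rate) c0 => C C0; rewrite EFinM.
have := subgradient_fin_num p12 S; move: Hv.
case: (J u) => [b| |]// Hv _; rewrite -muleDr//.
by rewrite lee_pmul2l// lte_fin.
Qed.

End scaling.

Section lipschitz_energy.
Context (R : realType) (N : nat) (s p : R).
Context (N0 : (0 < N)%N) (p12 : 1 < p < 2) (s01 : 0 < s < 1).
Local Notation X := 'rV[R]_N.
Local Notation mu := (lebesgue_rV R N).
Local Notation mu2 := (mu \x mu)%E.
Local Notation J := (gagliardo_energy s p).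
Local Notation sing := (sing_exp N s p).

Let p0 : 0 < p. Proof. by case/andP : p12 => /(lt_trans ltr01). Qed.

(* The exponent q replaces p - sing near the diagonal: it is kept nonzero as the
   radial integral requires, and lowering an exponent only enlarges the power in
   the unit ball. *)
Let E1 (x : X) : R := \1_(ball_e 1) x.
Let Eoo (x : X) : R := \1_[set x : X | (1 <= enorm x)%R] x.
Let q : R := Num.min (p - sing) (- 2^-1).

Let q_le : q <= p - sing. Proof. by rewrite ge_min lexx. Qed.

Let q_lt0 : q < 0. Proof. by rewrite gt_min; apply/orP; right; lra. Qed.

Let q_gt : - N%:R < q.
Proof.
have [p1 p2] := andP p12; have [s0 s1] := andP s01.
have N1 : 1 <= N%:R :> R by rewrite ler1n.
rewrite lt_min; apply/andP; split; last lra.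
by rewrite /sing_exp; nra.
Qed.

Let majorant (L M : R) (x : X) : R :=
  L `^ p * (enorm x `^ q * E1 x) + (2 * M) `^ p * (enorm x `^ (- sing) * Eoo x).

Let E1_ge0 x : 0 <= E1 x. Proof. by rewrite /E1 indicE ler0n. Qed.
Let Eoo_ge0 x : 0 <= Eoo x. Proof. by rewrite /Eoo indicE ler0n. Qed.

Let majorant_ge0 L M x : 0 <= majorant L M x.
Proof. by rewrite addr_ge0// mulr_ge0 ?powR_ge0// mulr_ge0 ?powR_ge0. Qed.

(* Close to the diagonal the Lipschitz bound leaves an integrable singularity,
   away from it boundedness leaves the integrable tail of the kernel. *)
Let lipschitz_density_le (G : X -> R) (L M : R) : 0 <= L -> 0 <= M ->
  (forall x y, `|G x - G y| <= L * enorm (x - y)) -> (forall x, `|G x| <= M) ->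
  forall x y, energy_density s p G (x, y) <= majorant L M (x - y).
Proof.
move=> L0 M0 GL GM x y; rewrite /energy_density/= /majorant.
have [->|xy] := eqVneq x y.
  rewrite !subrr normr0 powR0 ?gt_eqF// mul0r; exact: majorant_ge0.
have e0 : 0 < enorm (x - y) by rewrite enorm_gt0// subr_eq0.
have p00 := ltW p0.
have sq : 0 <= (enorm (x - y) `^ sing)^-1 by rewrite invr_ge0 powR_ge0.
have [le1|gt1] := leP (enorm (x - y)) 1.
  apply: (@le_trans _ _ (L `^ p * (enorm (x - y) `^ q * E1 (x - y)))); last first.
    by rewrite lerDl mulr_ge0 ?powR_ge0// mulr_ge0 ?powR_ge0.
  rewrite /E1 indicE mem_set// mulr1.
  apply: (@le_trans _ _ (L `^ p * enorm (x - y) `^ (p - sing))); last first.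
    by apply: ler_wpM2l; rewrite ?powR_ge0//; apply: ger_powR => //; rewrite e0.
  rewrite powRD; last by apply/implyP => _; rewrite gt_eqF.
  rewrite powRN mulrA; apply: ler_wpM2r => //.
  rewrite -powRM ?enorm_ge0//; apply: ge0_ler_powR => //; rewrite nnegrE ?normr_ge0//.
  by rewrite mulr_ge0 ?enorm_ge0.
apply: (@le_trans _ _ ((2 * M) `^ p * (enorm (x - y) `^ (- sing) * Eoo (x - y)))); last first.
  by rewrite lerDr mulr_ge0 ?powR_ge0// mulr_ge0 ?powR_ge0.
rewrite /Eoo indicE mem_set/= ?(ltW gt1)// mulr1 powRN; apply: ler_wpM2r => //.
apply: ge0_ler_powR => //; rewrite ?nnegrE ?normr_ge0// ?mulr_ge0//.
have := GM x; have := GM y; have := ler_normB (G x) (G y); lra.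
Qed.

Let measurable_far : measurable [set x : X | (1 <= enorm x)%R].
Proof.
rewrite (_ : mkset _ = (@enorm R N) @^-1` `[1, +oo[%classic).
  by apply: preimage_measurable => //; exact: measurable_enorm.
by apply/seteqP; split=> x /=; rewrite in_itv/= andbT.
Qed.

Let measurable_m1 : measurable_fun setT (fun x : X => enorm x `^ q * E1 x).
Proof.
apply: measurable_funM; first by apply: measurable_powRl; exact: measurable_enorm.
by apply: measurable_indic; exact: measurable_ball_e.
Qed.

Let measurable_m2 : measurable_fun setT (fun x : X => enorm x `^ (- sing) * Eoo x).
Proof.
apply: measurable_funM; first by apply: measurable_powRl; exact: measurable_enorm.
exact: (measurable_indic measurable_far).
Qed.

Let measurable_majorant L M : measurable_fun setT (majorant L M).
Proof.
have h1 := measurable_funM (measurable_cst (L `^ p)) measurable_m1.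
have h2 := measurable_funM (measurable_cst ((2 * M) `^ p)) measurable_m2.
exact: (measurable_funD h1 h2).
Qed.

Let int_majorant L M : (\int[mu]_x (majorant L M x)%:E < +oo)%E.
Proof.
have [C1 C10 H1] := int_enorm_near0 q_gt (ltr0_neq0 q_lt0).
have [C2 C20 H2] := int_enorm_oo (sing_exp_gt N p12 s01).
have a1 x : 0 <= enorm x `^ q * E1 x by rewrite mulr_ge0 ?powR_ge0.
have a2 x : 0 <= enorm x `^ (- sing) * Eoo x by rewrite mulr_ge0 ?powR_ge0.
have b1 x : 0 <= L `^ p * (enorm x `^ q * E1 x) by rewrite mulr_ge0 ?powR_ge0.
have b2 x : 0 <= (2 * M) `^ p * (enorm x `^ (- sing) * Eoo x) by rewrite mulr_ge0 ?powR_ge0.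
have mb1 : measurable_fun setT (fun x : X => L `^ p * (enorm x `^ q * E1 x)).
  exact: measurable_funM.
have mb2 : measurable_fun setT (fun x : X => (2 * M) `^ p * (enorm x `^ (- sing) * Eoo x)).
  exact: measurable_funM.
rewrite (intD mu mb1 mb2 b1 b2).
rewrite (intZ mu measurable_m1 a1 (powR_ge0 _ _)) (intZ mu measurable_m2 a2 (powR_ge0 _ _)).
by rewrite lte_add_pinfty// lte_mul_pinfty ?lee_fin ?powR_ge0//;
  [exact: le_lt_trans H1 (ltry _)|exact: le_lt_trans H2 (ltry _)].
Qed.

Let int_convolve (K : X -> R) (B : set X) : measurable_fun setT K ->
  (forall x, 0 <= K x) -> measurable B ->
  (\int[mu2]_z (\1_B z.1 * K (z.2 - z.1))%:E = mu B * \int[mu]_x (K x)%:E)%E.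
Proof.
move=> mK K0 mB.
have mKz : measurable_fun setT (fun z : X * X => \1_B z.1 * K (z.2 - z.1)).
  apply: measurable_funM.
    exact: (measurableT_comp (measurable_indic mB) measurable_fst).
  apply: (measurableT_comp mK); exact: measurable_rVB.
have b0 (y : X) : 0 <= \1_B y :> R by rewrite indicE ler0n.
have mKz' : measurable_fun setT (fun z : X * X => (\1_B z.1 * K (z.2 - z.1))%:E).
  exact/measurable_EFinP.
have Kz0 (z : X * X) : (0 <= (\1_B z.1 * K (z.2 - z.1))%:E)%E.
  by rewrite lee_fin mulr_ge0.
have mK' : measurable_fun setT (fun x => (K x)%:E) by exact/measurable_EFinP.
have K0' x : (0 <= (K x)%:E)%E by rewrite lee_fin.
transitivity (\int[mu]_x fubini_F mu (fun z : X * X => (\1_B z.1 * K (z.2 - z.1))%:E) x)%E.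
  exact: fubini_tonelli1.
transitivity (\int[mu]_y ((\int[mu]_x (K x)%:E) * (\1_B y)%:E))%E.
  apply: eq_integral => x _; rewrite /fubini_F/=.
  have mKx : measurable_fun setT (fun y : X => K (y - x)).
    by apply: (measurableT_comp mK); exact: measurable_rVB.
  rewrite (intZ mu mKx (fun y => K0 _) (b0 x)) muleC; congr (_ * _)%E.
  exact: (integral_translate (- x) mK' K0').
rewrite ge0_integralZl//=.
- by rewrite integral_indic// setIT muleC.
- by apply/measurable_EFinP; exact: measurable_indic.
- by apply: integral_ge0 => x _; exact: K0'.
Qed.

Let int_swap (f : X * X -> R) : measurable_fun setT f -> (forall z, 0 <= f z) ->
  (\int[mu2]_z (f (z.2, z.1))%:E = \int[mu2]_z (f z)%:E)%E.
Proof.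
move=> mf f0; have mf' : measurable_fun setT (fun z => (f z)%:E) by exact/measurable_EFinP.
have f0' z : (0 <= (f z)%:E)%E by rewrite lee_fin.
have ms : measurable_fun setT (fun z : X * X => (z.2, z.1)).
  by apply/measurable_fun_pairP; split; [exact: measurable_snd|exact: measurable_fst].
have mfs := measurableT_comp mf' ms.
transitivity (\int[mu]_x fubini_F mu (fun z : X * X => (f (z.2, z.1))%:E) x)%E.
  by apply: fubini_tonelli1 => //; exact: mfs.
transitivity (\int[mu]_y fubini_G mu (fun z : X * X => (f z)%:E) y)%E; first by [].
by apply/esym; exact: fubini_tonelli2.
Qed.

(** The density is bounded by an integrable function of x - y, and it vanishes
    unless x or y lies in the ball that carries G. *)
Lemma lipschitz_energy_lty (G : X -> R) (L M r : R) : 0 <= L -> 0 <= M -> 0 < r ->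
  measurable_fun setT G ->
  (forall x y, `|G x - G y| <= L * enorm (x - y)) -> (forall x, `|G x| <= M) ->
  (forall x, r < enorm x -> G x = 0) -> (J G < +oo)%E.
Proof.
move=> L0 M0 r0 mG GL GM Gr; pose K := majorant L M.
have mK : measurable_fun setT K by exact: measurable_majorant.
have K0 x : 0 <= K x by exact: majorant_ge0.
have KN x : K (- x) = K x.
  rewrite /K /majorant enormN /E1 /Eoo !indicE.
  congr (_ * (_ * (nat_of_bool _)%:R) + _ * (_ * (nat_of_bool _)%:R));
    by apply/idP/idP => /set_mem h; apply/mem_set; move: h; rewrite /ball_e/= enormN.
have mB := @measurable_ball_e R N r.
have b0 (y : X) : 0 <= \1_(ball_e r) y :> R by rewrite indicE ler0n.
pose k1 (z : X * X) := \1_(ball_e r) z.1 * K (z.2 - z.1).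
pose k2 (z : X * X) := \1_(ball_e r) z.2 * K (z.1 - z.2).
have mk2 : measurable_fun setT k2.
  apply: measurable_funM.
    exact: (measurableT_comp (measurable_indic mB) measurable_snd).
  apply: (measurableT_comp mK); exact: measurable_rVB.
have mk1 : measurable_fun setT k1.
  apply: measurable_funM.
    exact: (measurableT_comp (measurable_indic mB) measurable_fst).
  apply: (measurableT_comp mK); exact: measurable_rVB.
have k10 z : 0 <= k1 z by rewrite mulr_ge0.
have k20 z : 0 <= k2 z by rewrite mulr_ge0.
have fin : (mu (ball_e r) * \int[mu]_x (K x)%:E < +oo)%E.
  rewrite lte_mul_pinfty ?measure_ge0 ?int_majorant//.
  by rewrite ge0_fin_numE ?measure_ge0// lebesgue_ball_lty.
have I1 : (\int[mu2]_z (k1 z)%:E = mu (ball_e r) * \int[mu]_x (K x)%:E)%E.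
  exact: int_convolve.
have I2 : (\int[mu2]_z (k2 z)%:E = mu (ball_e r) * \int[mu]_x (K x)%:E)%E.
  by rewrite -I1 -(int_swap mk1 k10).
have le z : energy_density s p G z <= k1 z + k2 z.
  case: z => x y; rewrite /k1 /k2/= !indicE.
  have le1 := lipschitz_density_le L0 M0 GL GM x y.
  have Kyx : K (y - x) = K (x - y) by rewrite -KN opprB.
  rewrite Kyx; have [rx|rx] := leP (enorm x) r.
    rewrite mem_set// mul1r; apply: le_trans le1 _.
    by rewrite lerDl mulr_ge0.
  have [ry|ry] := leP (enorm y) r.
    rewrite (mem_set (A := ball_e r) (u := y))// mul1r; apply: le_trans le1 _.
    by rewrite lerDr mulr_ge0.
  rewrite /energy_density/= (Gr _ rx) (Gr _ ry) subrr normr0 powR0 ?gt_eqF// mul0r.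
  by rewrite addr_ge0// mulr_ge0.
rewrite gagliardoE lte_mul_pinfty ?lee_fin ?invr_ge0 ?mulr_ge0 ?(ltW p0)//.
have mD := measurable_energy_density s p mG.
apply: le_lt_trans (le_int mu2 mD (measurable_funD mk1 mk2) (energy_density_ge0 s p G) le) _.
have -> := intD mu2 mk1 mk2 k10 k20.
by rewrite I1 I2 lte_add_pinfty.
Qed.

End lipschitz_energy.

(** * The semigroup *)

Lemma ae_refl (R : realType) (N : nat) (v : 'rV[R]_N) c (P : 'rV[R]_N -> Prop) :
  v != 0 -> (\forall x \ae lebesgue_rV R N, P x) ->
  \forall x \ae lebesgue_rV R N, P (refl v c x).
Proof.
move=> v0; apply: (ae_preimage (measurable_refl v c) (c := 1%E)) => A mA.
have [_ rP] := refl_measure_preserving c v0.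
have mI : measurable_fun setT (fun x : 'rV[R]_N => (\1_A x)%:E : \bar R).
  by apply/measurable_EFinP; exact: measurable_indic.
have I0 (x : 'rV[R]_N) : (0 <= (\1_A x)%:E :> \bar R)%E by rewrite lee_fin indicE ler0n.
have mrA : measurable (refl v c @^-1` A).
  by apply: preimage_measurable => //; exact: measurable_refl.
by rewrite mul1e -(int_indicE _ mA) -(int_indicE _ mrA) -(rP _ mI I0).
Qed.

Section semigroup.
Context (R : realType) (N : nat) (s p : R).
Context (p12 : 1 < p < 2) (s01 : 0 < s < 1).
Local Notation X := 'rV[R]_N.
Local Notation mu := (lebesgue_rV R N).
Local Notation L2 := (Lfun mu 2%:E).
Local Notation J := (gagliardo_energy s p).
Local Notation ip := (ipL2 mu).
Local Notation pos r := (Num.max r 0).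
Local Notation S := (semigroup_at s p).
Implicit Types (f g : X -> R) (t c : R).

Let one_le2 : (1 <= 2%:E :> \bar R)%E. Proof. by rewrite lee_fin ler1n. Qed.
Local Notation V := (LfunType mu one_le2).
Local Notation val v := (v : X -> R).
Let ipV (u v : V) : R := ip (val u) (val v).
Let JV (u : V) : \bar R := J (val u).

Let valL (v : V) : val v \in L2. Proof. exact: LfunP. Qed.
Let mk f (fL : f \in L2) : {v : V | val v = f}.
Proof. by exists (Lfun_Sub one_le2 fL); exact: Lfun_valP. Qed.

Let valD (u v : V) : val (u + v) = (fun x => val u x + val v x). Proof. by []. Qed.
Let valB (u v : V) : val (u - v) = (fun x => val u x - val v x). Proof. by []. Qed.
Let valZ a (v : V) : val (a *: v) = (fun x => a * val v x). Proof. by []. Qed.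
Let val0 : val (0 : V) = (fun=> 0). Proof. by []. Qed.

Let ipVC (u v : V) : ipV u v = ipV v u. Proof. exact: ipL2C. Qed.
Let ipVD (u v w : V) : ipV (u + v) w = ipV u w + ipV v w.
Proof. by rewrite /ipV valD; apply: ipL2Dl; exact: valL. Qed.
Let ipVZ (a : R) (u w : V) : ipV (a *: u) w = a * ipV u w.
Proof. by rewrite /ipV valZ; apply: ipL2Zl; exact: valL. Qed.
Let ipV_ge0 (u : V) : 0 <= ipV u u. Proof. exact: ipL2_ge0. Qed.
Let JV_ge0 (u : V) : (0 <= JV u)%E. Proof. exact: gagliardo_ge0. Qed.
Let JV0 : JV 0 = 0%E. Proof. by rewrite /JV val0; exact: gagliardo0. Qed.
Let JV_convex t (u v : V) a b : 0 <= t <= 1 -> (JV u <= a%:E)%E -> (JV v <= b%:E)%E ->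
  (JV (t *: u + (1 - t) *: v)%R <= (t * a + (1 - t) * b)%:E)%E.
Proof.
move=> t01 Ja Jb; rewrite /JV valD !valZ.
by apply: gagliardo_convex => //; apply: L2_measurable; exact: valL.
Qed.
Let JV_lsc (u : nat -> V) l (c : nat -> R) d :
  ipV (u n - l) (u n - l) @[n --> \oo] --> 0 ->
  (forall n, (JV (u n) <= (c n)%:E)%E) -> c n @[n --> \oo] --> d ->
  (JV l <= d%:E)%E.
Proof.
move=> ul Ju cd; apply/lee_addgt0Pr => e e0; rewrite -EFinD.
apply: (gagliardo_lsc p12 (u := fun n => val (u n)) _ (valL l) ul) => //.
move/cvgrPdist_le : cd => /(_ _ e0); apply: filterS => n /= cn.
apply: le_trans (Ju n) _; rewrite lee_fin.
by move: cn; rewrite ler_norml => /andP[]; lra.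
Qed.
Let ipV_complete (u : nat -> V) :
  (forall e, 0 < e -> exists n0, forall m n, (n0 <= m)%N -> (n0 <= n)%N ->
    ipV (u m - u n) (u m - u n) <= e) ->
  exists l, ipV (u n - l) (u n - l) @[n --> \oo] --> 0.
Proof.
move=> uC; have [l lL ul] := L2_complete (fun n => valL (u n)) uC.
by have [l' l'E] := mk lL; exists l'; rewrite /ipV; under eq_fun do rewrite valB l'E.
Qed.

Let stepE h (w u : V) : 0 < h -> euler_step ipV JV h w u <->
  implicit_step s p h (val w) (val u).
Proof.
move=> h0.
have gE : val (h^-1 *: (w - u)) = (fun x => (val w x - val u x) / h).
  by rewrite valZ valB; apply/funext => x; rewrite mulrC.
split=> [H|[_ _ H]].
  split; [exact: valL|by rewrite -gE; exact: valL|].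
  by move=> v vL; have [v' <-] := mk vL; have := H v'; rewrite /ipV /JV gE valB.
by move=> v; have := H _ (valL v); rewrite /ipV /JV gE valB.
Qed.

Lemma semigroup_exists t f : f \in L2 -> 0 < t -> exists g, S t f g.
Proof.
move=> fL t0; have [w wE] := mk fL.
have [l /= ll] := exponential_formula ipVC ipVD ipVZ ipV_ge0 JV_ge0 JV0
  JV_convex JV_lsc ipV_complete w t0.
exists (val l); split; first exact: valL.
exists (fun n k => val (iter k (resolvent ipV JV (t / n.+1%:R)) w)); split.
- by move=> n /=; exact: wE.
- move=> n k _ /=; have h0 : 0 < t / n.+1%:R by rewrite divr_gt0.
  have := resolventP ipVC ipVD ipVZ ipV_ge0 JV_ge0 JV0 JV_convex JV_lsc ipV_complete
    (iter k (resolvent ipV JV (t / n.+1%:R)) w) h0.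
  by move/(stepE _ _ h0).
- apply/cvg_L2norm => [n|]; first by apply: L2B; exact: valL.
  exact: ll.
Qed.

Lemma semigroup_L2 t f g : 0 < t -> S t f g -> f \in L2 /\ g \in L2.
Proof.
move=> t0 [gL [w [w0 wS _]]]; split => //; rewrite -(w0 0%N).
by have [] := implicit_step_L2 _ (wS 0%N 0%N isT); rewrite ?divr_gt0.
Qed.

Lemma semigroup_chain t f g : 0 < t -> S t f g -> exists w : nat -> nat -> X -> R,
  [/\ forall n, w n 0%N = f,
      forall n k, (k < n.+1)%N -> implicit_step s p (t / n.+1%:R) (w n k) (w n k.+1),
      forall n k, (k <= n.+1)%N -> w n k \in L2 &
      ip (fun x => w n n.+1 x - g x) (fun x => w n n.+1 x - g x) @[n --> \oo] --> 0].
Proof.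
move=> t0 H; have [fL gL] := semigroup_L2 t0 H; have [_ [w [w0 wS wl]]] := H.
have h0 n : 0 < t / n.+1%:R by rewrite divr_gt0.
have wL n k : (k <= n.+1)%N -> w n k \in L2.
  case: k => [_|k kn]; first by rewrite w0.
  by have [] := implicit_step_L2 (h0 n) (wS n k kn).
exists w; split => //.
apply/(cvg_L2norm (f_ := fun n x => w n n.+1 x - g x)) => [n|]; last exact: wl.
by apply: L2B => //; exact: wL.
Qed.

(** The contraction of single steps is iterated along the two chains; Fatou's
    lemma carries it to the limit. *)
Lemma semigroup_T_contraction t c f1 g1 f2 g2 : 0 < t -> 0 <= c ->
  S t f1 g1 -> S t f2 g2 ->
  (\int[mu]_x (pos (g1 x - g2 x - c))%:E <= \int[mu]_x (pos (f1 x - f2 x - c))%:E)%E.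
Proof.
move=> t0 c0 S1 S2; have [f1L g1L] := semigroup_L2 t0 S1; have [f2L g2L] := semigroup_L2 t0 S2.
have [w1 [w10 w1S w1L w1l]] := semigroup_chain t0 S1.
have [w2 [w20 w2S w2L w2l]] := semigroup_chain t0 S2.
pose d n x := w1 n n.+1 x - w2 n n.+1 x; pose g x := g1 x - g2 x.
have dL n : d n \in L2 by apply: L2B; [exact: w1L|exact: w2L].
have gL : g \in L2 by exact: L2B.
have dg : ip (fun x => d n x - g x) (fun x => d n x - g x) @[n --> \oo] --> 0.
  have h2 : (2 * ip (fun x => w1 n n.+1 x - g1 x) (fun x => w1 n n.+1 x - g1 x) +
     2 * ip (fun x => w2 n n.+1 x - g2 x) (fun x => w2 n n.+1 x - g2 x)) @[n --> \oo] --> (0 : R).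
    rewrite -[X in _ --> X](addr0 0) -[X in _ --> X + _](mulr0 2) -[X in _ --> _ + X](mulr0 2).
    by apply: cvgD; apply: cvgMl_tmp.
  apply: squeeze_cvgr h2; last exact: cvg_cst.
  apply: nearW => n; rewrite ipL2_ge0/=.
  have a1L : (fun x => w1 n n.+1 x - g1 x) \in L2 by apply: L2B => //; exact: w1L.
  have a2L : (fun x => w2 n n.+1 x - g2 x) \in L2 by apply: L2B => //; exact: w2L.
  move: (a1L) (a2L); set a1 := (fun x => w1 n n.+1 x - g1 x).
  set a2 := (fun x => w2 n n.+1 x - g2 x) => _ _.
  have -> : (fun x => d n x - g x) = (fun x => a1 x - a2 x).
    by apply/funext => x; rewrite /d /g /a1 /a2; ring.
  have sL := L2D a1L a2L; have := ipL2_ge0 mu (fun x => a1 x + a2 x).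
  have aL := L2B a1L a2L.
  rewrite (ipL2Dl a1L a2L sL) (ipL2Bl a1L a2L aL).
  rewrite !(ipL2C _ _ (fun x => a1 x + a2 x)) !(ipL2C _ _ (fun x => a1 x - a2 x)).
  rewrite !(ipL2Dl a1L a2L)// !(ipL2Bl a1L a2L)// (ipL2C _ a2 a1); lra.
have [k _ dk] := L2_subseq_ae dL gL dg.
apply: (fatou_ae (f_ := fun n x => pos (d (k n) x - c))).
- move=> n; apply: measurable_pos; apply: measurable_funB => //.
  exact: L2_measurable.
- by apply: measurable_pos; apply: measurable_funB => //; exact: L2_measurable gL.
- by move=> n x; exact: pos_ge0.
- by move=> x; exact: pos_ge0.
- apply: filterS dk => x dx.
  apply: (@continuous_cvg _ _ _ _ _ _ (fun r : R => pos (r - c))) => //.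
  by apply: continuous_max; [apply: continuousB; [exact: cvg_id|exact: cvg_cst]|exact: cvg_cst].
- apply: nearW => n; rewrite /d; set m := k n.
  have h0 : 0 < t / m.+1%:R by rewrite divr_gt0.
  suff H j : (j <= m.+1)%N -> (\int[mu]_x (pos (w1 m j x - w2 m j x - c))%:E <=
      \int[mu]_x (pos (f1 x - f2 x - c))%:E)%E by exact: H.
  elim: j => [_|j IH jm]; first by rewrite w10 w20.
  apply: le_trans (IH (ltnW jm)).
  exact: (implicit_step_T_contraction p12 h0 c0 (w1S m j jm) (w2S m j jm)).
Qed.

Lemma semigroup_le t f1 g1 f2 g2 : 0 < t -> S t f1 g1 -> S t f2 g2 ->
  (\forall x \ae mu, f1 x <= f2 x) -> \forall x \ae mu, g1 x <= g2 x.
Proof.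
move=> t0 S1 S2 f12; have [f1L g1L] := semigroup_L2 t0 S1; have [f2L g2L] := semigroup_L2 t0 S2.
have := semigroup_T_contraction t0 (lexx 0) S1 S2.
have mf : measurable_fun setT (fun x => pos (f1 x - f2 x - 0)).
  apply: measurable_pos; apply: measurable_funB => //; exact: L2_measurable (L2B f1L f2L).
have mg : measurable_fun setT (fun x => pos (g1 x - g2 x - 0)).
  apply: measurable_pos; apply: measurable_funB => //; exact: L2_measurable (L2B g1L g2L).
have -> : (\int[mu]_x (pos (f1 x - f2 x - 0))%:E = 0)%E.
  apply/eqP; rewrite eq_le; apply/andP; split; last first.
    by apply: integral_ge0 => x _; rewrite lee_fin pos_ge0.
  rewrite -[leRHS](integral0 mu setT); apply: le_int_ae => //.
  - by move=> x; exact: pos_ge0.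
  - by apply: filterS f12 => x; rewrite subr0 ge_max lexx andbT subr_le0.
move=> I0; have I00 : (\int[mu]_x (pos (g1 x - g2 x - 0))%:E = 0)%E.
  apply/eqP; rewrite eq_le I0/=; by apply: integral_ge0 => x _; rewrite lee_fin pos_ge0.
have := int_eq0_ae mg (fun x => pos_ge0 _) I00; apply: filterS => x gx.
by move/eqP: gx; rewrite eq_le ge_max subr0 subr_le0 => /andP[/andP[]].
Qed.

Lemma implicit_step0 h : implicit_step s p h ((fun=> 0) : X -> R) (fun=> 0).
Proof.
rewrite /implicit_step.
rewrite (_ : (fun x : X => _) = (fun=> 0)); last by apply/funext => x; rewrite subrr mul0r.
split; [exact: L2_0|exact: L2_0|].
move=> v _; rewrite gagliardo0// add0e.
have -> : (\int[mu]_x (0 * (v x - 0)) = 0)%R.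
  by rewrite /Rintegral; under eq_integral do rewrite mul0r; rewrite integral0.
exact: gagliardo_ge0.
Qed.

Let semigroup0 t : 0 < t -> S t ((fun=> 0) : X -> R) (fun=> 0).
Proof.
move=> t0; split; first exact: L2_0.
exists (fun _ _ _ => 0); split => //; first by move=> n k _; exact: implicit_step0.
apply/(cvg_L2norm (f_ := fun _ _ => 0 - 0)) => [n|].
  by under eq_fun do rewrite subrr; exact: L2_0.
rewrite /ipL2; under eq_fun do (under eq_Rintegral do rewrite subrr mul0r).
by rewrite /Rintegral integral0; exact: cvg_cst.
Qed.

Lemma semigroup_ge0 t f g : 0 < t -> S t f g -> (\forall x \ae mu, 0 <= f x) ->
  \forall x \ae mu, 0 <= g x.
Proof. by move=> t0 S1; exact: semigroup_le (semigroup0 t0) S1. Qed.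

Lemma semigroup_scale t a l f g : 0 < t -> 0 < a -> 0 < l -> S t f g ->
  S (t / rescale_rate s p a l) (rescale a l f) (rescale a l g).
Proof.
move=> t0 a0 l0 H; have [fL gL] := semigroup_L2 t0 H.
have [w [w0 wS wL wl]] := semigroup_chain t0 H.
split; first exact: rescale_L2.
exists (fun n k => rescale a l (w n k)); split.
- by move=> n; rewrite w0.
- move=> n k kn; rewrite mulrAC; apply: implicit_step_scale => //; last exact: wS.
  by rewrite divr_gt0.
- apply/(cvg_L2norm (f_ := fun n x => rescale a l (w n n.+1) x - rescale a l g x)).
    by move=> n; apply: L2B; apply: rescale_L2 => //; exact: wL.
  have dL n : (fun x => w n n.+1 x - g x) \in L2 by apply: L2B => //; exact: wL.
  have -> : (fun n => ip (fun x => rescale a l (w n n.+1) x - rescale a l g x)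
      (fun x => rescale a l (w n n.+1) x - rescale a l g x)) =
      (fun n => (a * a * l^-1 ^+ N) * ip (fun x => w n n.+1 x - g x) (fun x => w n n.+1 x - g x)).
    apply/funext => n; have dlL := L2_scale l0 (dL n).
    have -> : (fun x => rescale a l (w n n.+1) x - rescale a l g x) =
        (fun x => a * (w n n.+1 (l *: x) - g (l *: x))).
      by apply/funext => x; rewrite /rescale mulrBr.
    rewrite (ipL2Zl a dlL (L2Z a dlL)) (ipL2Zr a dlL dlL).
    by rewrite (ipL2_scale l0 (dL n) (dL n)) !mulrA.
  rewrite -[X in _ --> X](mulr0 (a * a * l^-1 ^+ N)).
  by apply: cvgMl_tmp; exact: wl.
Qed.

Lemma semigroup_polar t f g v c : 0 < t -> v != 0 -> S t f g ->
  (\forall x \ae mu, dot x v <= c -> f (refl v c x) <= f x) ->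
  \forall x \ae mu, dot x v <= c -> g (refl v c x) <= g x.
Proof.
move=> t0 v0 H fsym; have [fL gL] := semigroup_L2 t0 H.
have [w [w0 wS wL wl]] := semigroup_chain t0 H.
have [k _ wk] := L2_subseq_ae (fun n => wL n n.+1 (leqnn _)) gL wl.
have key n j : (j <= n.+1)%N -> \forall x \ae mu, dot x v <= c -> w n j (refl v c x) <= w n j x.
  elim: j => [_|j IH jn]; first by rewrite w0.
  have h0 : 0 < t / n.+1%:R by rewrite divr_gt0.
  exact: (implicit_step_polar p12 s01 v0 h0 (wS n j jn) (IH (ltnW jn))).
have key' : \forall x \ae mu, forall n, dot x v <= c ->
    w (k n) (k n).+1 (refl v c x) <= w (k n) (k n).+1 x.
  by apply/ae_foralln => n; exact: key.
have wk' := ae_refl c v0 wk.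
apply: filterS3 key' wk wk' => x xk xw xw' xv; apply: ler_cvg_to xw' xw _.
by apply: nearW => n; exact: xk.
Qed.

(** The squared displacement of a chain is at most the elapsed time multiplied by
    the initial energy. *)
Lemma semigroup_energy t f g (C : R) : 0 < t -> S t f g -> J f = C%:E ->
  (\int[mu]_x ((g x - f x) ^+ 2)%:E <= (t * C)%:E)%E.
Proof.
move=> t0 H JC; have [fL gL] := semigroup_L2 t0 H.
have [w [w0 wS wL wl]] := semigroup_chain t0 H.
have [k _ wk] := L2_subseq_ae (fun n => wL n n.+1 (leqnn _)) gL wl.
have wfL n : (fun x => w n n.+1 x - f x) \in L2.
  by apply: L2B => //; exact: (wL n n.+1 (leqnn _)).
apply: (fatou_ae (f_ := fun n x => (w (k n) (k n).+1 x - f x) ^+ 2)).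
- by move=> n; apply: measurable_funX; exact: L2_measurable (wfL (k n)).
- by apply: measurable_funX; exact: L2_measurable (L2B gL fL).
- by move=> n x; exact: sqr_ge0.
- by move=> x; exact: sqr_ge0.
- apply: filterS wk => x wx.
  by apply: (@continuous_cvg _ _ _ _ _ _ (fun r : R => r ^+ 2)); [exact: exprn_continuous|
    apply: cvgB => //; exact: cvg_cst].
- apply: nearW => n; set m := k n.
  have h0 : 0 < t / m.+1%:R by rewrite divr_gt0.
  rewrite -ipL2E; last exact: wfL.
  pose x j : V := sval (mk (wL m (minn j m.+1) (geq_minr _ _))).
  have xE j : (j <= m.+1)%N -> val (x j) = w m j.
    by move=> jm; rewrite /x; case: mk => v /= ->; rewrite (minn_idPl jm).
  have xS j : (j < m.+1)%N -> euler_step ipV JV (t / m.+1%:R) (x j) (x j.+1).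
    by move=> jm; apply/(stepE _ _ h0); rewrite !xE//; [exact: wS|exact: ltnW].
  have Jx0 : JV (x 0%N) = C%:E.
    by rewrite /JV (xE 0%N isT) w0; exact: JC.
  have [d Jd] := euler_chain_energy ipVC ipVD ipVZ ipV_ge0 JV_ge0 JV0 h0 xS Jx0 (leqnn m.+1).
  rewrite /ipV valB !xE// w0 lee_fin => /le_trans; apply.
  have -> : m.+1%:R * (t / m.+1%:R) = t by rewrite mulrC divfK// pnatr_eq0.
  have d0 : (0 <= d%:E)%E by rewrite -Jd; exact: JV_ge0.
  by rewrite ler_wpM2l ?(ltW t0)// gerBl -lee_fin.
Unshelve. all: by end_near.
Qed.

End semigroup.

(** * Smoothing *)

Section barrier.
Context (R : realType).

Let pow_chord m (x : R) : 0 <= x <= 1 -> (1 + x) ^+ m <= 1 + (2 ^+ m - 1) * x.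
Proof.
move=> /andP[x0 x1]; elim: m => [|m IH]; first by rewrite !expr0 subrr mul0r addr0.
rewrite !exprS; apply: (@le_trans _ _ ((1 + x) * (1 + (2 ^+ m - 1) * x))).
  by rewrite ler_wpM2l// addr_ge0.
have m1 : 1 <= 2 ^+ m :> R by rewrite exprn_ege1// ler1n.
move: (2 ^+ m) m1 => q q1.
have : 0 <= (q - 1) * (x * (1 - x)) by rewrite !mulr_ge0// subr_ge0.
lra.
Qed.

(** A discrete supersolution of M' = - C M^(1 + r): up to a constant, the
    singular solution t^(-1/r) of that equation at the times j * h. *)
Lemma discrete_barrier (r C : R) : 0 < r -> 0 < C -> exists2 K : R, 0 < K &
  forall h j, 0 < h -> (0 < j)%N -> let M j := K * (j%:R * h) `^ (- r^-1) in
    M j < M j.+1 + h * (C * M j.+1 `^ (1 + r)).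
Proof.
move=> r0 C0; pose a := r^-1; have a0 : 0 < a by rewrite invr_gt0.
pose m := (Num.trunc a).+1.
have am : a <= m%:R by rewrite ltW// truncnS_gt.
pose L : R := 2 ^+ m.+1 / C; have L0 : 0 < L by rewrite divr_gt0// exprn_gt0.
exists (L `^ a); first exact: powR_gt0.
move=> h j h0 j0; set M := (fun i : nat => _) => /=.
have K0 : 0 < L `^ a by exact: powR_gt0.
have jp : 0 < j%:R :> R by rewrite ltr0n.
have jS : 0 < j.+1%:R :> R by rewrite ltr0n.
have Mp i : 0 < i%:R :> R -> 0 < M i by move=> i0; rewrite mulr_gt0// powR_gt0// mulr_gt0.
have quot y z : 0 < y -> 0 < z -> z `^ (- a) = y `^ (- a) * (y / z) `^ a.
  move=> y0 z0; rewrite powRM ?invr_ge0 ?ltW// mulrA -powRD; last first.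
    by apply/implyP => _; rewrite gt_eqF.
  by rewrite addNr powRr0 mul1r -powR_inv1 ?ltW// -powRrM mulN1r.
have ME : M j = M j.+1 * (1 + j%:R^-1) `^ a.
  rewrite /M -mulrA; congr (_ * _).
  have -> : 1 + j%:R^-1 = (j.+1%:R * h) * (j%:R * h)^-1 :> R.
    by rewrite -natr1; field; rewrite !gt_eqF.
  by apply: quot; rewrite mulr_gt0.
have MS : M j.+1 `^ (1 + r) = M j.+1 * (L / (j.+1%:R * h)).
  rewrite powRD; last by apply/implyP => _; rewrite gt_eqF// Mp.
  rewrite powRr1 ?(ltW (Mp _ jS))//; congr (_ * _).
  rewrite /M powRM ?powR_ge0// -!powRrM mulVf ?gt_eqF// mulNr mulVf ?gt_eqF//.
  by rewrite powRr1 ?(ltW L0)// powR_inv1// mulr_ge0 ?ltW.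
rewrite ME MS -[X in _ < X + _]mulr1.
have -> : h * (C * (M j.+1 * (L / (j.+1%:R * h)))) = M j.+1 * (2 ^+ m.+1 / j.+1%:R).
  by rewrite /L; field; rewrite !gt_eqF.
rewrite -mulrDr ltr_pM2l ?Mp//.
have j1 : 0 <= (j%:R^-1 : R) <= 1.
  by rewrite invr_ge0 ltW//= invf_le1// ler1n.
have /andP[j10 j11] := j1.
apply: (@le_lt_trans _ _ ((1 + j%:R^-1) ^+ m)).
  rewrite -powR_mulrn ?addr_ge0//; apply: ler_powR => //; lra.
apply: le_lt_trans (pow_chord m j1) _; rewrite ltrD2l exprS.
have q1 : 1 <= 2 ^+ m :> R by rewrite exprn_ege1// ler1n.
move: (2 ^+ m) q1 => q q1.
have j1' : 1 <= j%:R :> R by rewrite ler1n.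
have h1 : j.+1%:R <= 2 * j%:R :> R by rewrite -natr1; lra.
rewrite ltr_pdivlMr// mulrAC ltr_pdivrMr//.
apply: (@le_lt_trans _ _ ((q - 1) * (2 * j%:R))).
  by rewrite ler_wpM2l// subr_ge0.
have : 0 < j%:R * 2 :> R by lra.
nra.
Qed.

End barrier.

Section smoothing.
Context (R : realType) (N : nat) (s p : R).
Context (N0 : (0 < N)%N) (p12 : 1 < p < 2) (s01 : 0 < s < 1).
Local Notation X := 'rV[R]_N.
Local Notation mu := (lebesgue_rV R N).
Local Notation L2 := (Lfun mu 2%:E).
Local Notation pos r := (Num.max r 0).
Local Notation S := (semigroup_at s p).
Local Notation sing := (sing_exp N s p).
Context (A gam : R) (A0 : 0 < A) (gam_bound : - N%:R < gam < 0)
  (gam_sub : 0 < s * p + gam * (2 - p)).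

Let g : R := - gam.
Let g0 : 0 < g. Proof. by rewrite /g; case/andP: gam_bound => _; lra. Qed.
Let gn0 : g != 0. Proof. by rewrite gt_eqF. Qed.
Let p0 : 0 < p. Proof. by case/andP : p12 => /(lt_trans ltr01). Qed.

Lemma measurable_power_data : measurable_fun setT (power_data A gam : X -> R).
Proof.
by apply: measurable_funM => //; apply: measurable_powRl; exact: measurable_enorm.
Qed.

Lemma power_data_ge0 (x : X) : 0 <= power_data A gam x.
Proof. by rewrite mulr_ge0 ?powR_ge0// ltW. Qed.

Lemma power_data_small (x : X) c : 0 < c -> (A / c) `^ g^-1 < enorm x ->
  power_data A gam x <= c.
Proof.
move=> c0 xc; have Ac0 : 0 < (A / c) `^ g^-1 by rewrite powR_gt0// divr_gt0.
have x0 := lt_trans Ac0 xc.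
rewrite /power_data -[gam]opprK -/g powRN ler_pdivrMr ?powR_gt0// mulrC -ler_pdivrMr//.
rewrite -[leLHS](powRr1 (ltW (divr_gt0 A0 c0))) -(mulVf gn0) powRrM.
by apply: ge0_ler_powR; rewrite ?nnegrE ?ltW.
Qed.

(** The data exceed c in the ball of radius (A / c)^(1/g); dilating it to the
    unit ball leaves the integral of the power there. *)
Lemma int_power_data_tail : exists2 I : R, 0 < I & forall c, 0 < c ->
  (\int[mu]_x (pos (power_data A gam x - c))%:E <= (c * ((A / c) `^ g^-1) ^+ N * I)%:E)%E.
Proof.
have [/andP[gN g_]] := (gam_bound, tt).
have gamn0 : gam != 0 by rewrite lt_eqF.
have [I I0 HI] := int_enorm_near0 gN gamn0.
exists (I + 1); first by rewrite ltr_wpDl.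
move=> c c0; set r := (A / c) `^ g^-1.
have r0 : 0 < r by rewrite powR_gt0// divr_gt0.
have rg : A * r `^ gam = c.
  rewrite /r -powRrM -[gam]opprK -/g mulrN mulVf ?gt_eqF// powR_inv1; last first.
    by rewrite divr_ge0 ?ltW.
  by rewrite invf_div mulrC divfK// gt_eqF.
pose k (x : X) := enorm x `^ gam * \1_(ball_e 1) x : R.
have mk : measurable_fun setT k.
  apply: measurable_funM; first by apply: measurable_powRl; exact: measurable_enorm.
  by apply: measurable_indic; exact: measurable_ball_e.
have k0 x : 0 <= k x by rewrite mulr_ge0 ?powR_ge0// indicE ler0n.
have rV0 : 0 < r^-1 by rewrite invr_gt0.
have mkr : measurable_fun setT (fun x : X => k (r^-1 *: x)).
  by apply: (measurableT_comp mk); exact: measurable_rVZ.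
have mpd : measurable_fun setT (fun x : X => pos (power_data A gam x - c)).
  by apply: measurable_pos; apply: measurable_funB => //; exact: measurable_power_data.
have mck : measurable_fun setT (fun x : X => c * k (r^-1 *: x)).
  exact: measurable_funM.
apply: (@le_trans _ _ (\int[mu]_x (c * k (r^-1 *: x))%:E)%E).
  apply: (le_int mu mpd mck) => x; first exact: pos_ge0.
  have ck : 0 <= c * k (r^-1 *: x) by rewrite mulr_ge0// ltW.
  rewrite ge_max ck andbT.
  have [xr|xr] := leP (enorm x) r; last first.
    by apply: le_trans ck; rewrite subr_le0; exact: power_data_small.
  have -> : c * k (r^-1 *: x) = power_data A gam x.
    rewrite /k indicE mem_set; last first.
      by rewrite /ball_e/= enormZ gtr0_norm// ler_pdivrMl// mulr1.
    rewrite mulr1 enormZ gtr0_norm// powRM ?enorm_ge0 ?(ltW rV0)//.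
    have rr : r `^ gam * r^-1 `^ gam = 1.
      by rewrite -powRM ?(ltW r0) ?(ltW rV0)// mulfV ?gt_eqF// powR1.
    transitivity (A * (r `^ gam * r^-1 `^ gam) * enorm x `^ gam).
      by rewrite -[in LHS]rg; ring.
    by rewrite rr mulr1.
  by rewrite gerBl ltW.
have mk' : measurable_fun setT (fun x => (k x)%:E) by exact/measurable_EFinP.
have k0' x : (0 <= (k x)%:E)%E by rewrite lee_fin.
rewrite (intZ mu mkr (fun x => k0 _) (ltW c0)) (integral_scale rV0 mk' k0') invrK.
rewrite muleA -EFinM [leRHS]EFinM; apply: lee_wpmul2l.
  by rewrite lee_fin mulr_ge0 ?exprn_ge0 ?ltW.
by apply: le_trans HI _; rewrite lee_fin lerDl.
Qed.

(* Chebyshev's inequality at level k / 4 for the measure of {w > k / 2}, where the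
   integral of (w - k / 4)_+ is bounded by that of the data. *)
Let mass I k : R := ((4 * A / k) `^ g^-1) ^+ N * I.

Let mass_gt0 I k : 0 < I -> 0 < k -> 0 < mass I k.
Proof.
by move=> I0 k0; rewrite mulr_gt0// exprn_gt0// powR_gt0// divr_gt0// mulr_gt0.
Qed.

(* The supremum M obeys M' <= - C M^(1 + rate); the power comes from inserting
   mass k for m in sup_gain. *)
Let rate : R := p - 2 + s * p / g.

Let rate_gt0 : 0 < rate.
Proof.
rewrite /rate; have -> : p - 2 + s * p / g = (s * p + gam * (2 - p)) / g.
  by rewrite /g; field; move: g0; rewrite /g => h; rewrite -oppr_eq0 gt_eqF.
by rewrite divr_gt0.
Qed.

(* For m = mass I k the cube has size proportional to k^(-1/g), so the kernel mass
   is proportional to k^(sp/g). *)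
Let sup_gain_mass I : 0 < I -> exists2 C : R, 0 < C & forall k, 0 < k ->
  sup_gain N s p k (mass I k) = C * k `^ (1 + rate).
Proof.
move=> I0; have b0 := sing_exp_gt0 N p12 s01.
have NR : 0 < N%:R :> R by rewrite ltr0n.
pose d := Num.sqrt N%:R * ((2 * I) `^ N%:R^-1 / 2) : R.
have d0 : 0 < d by rewrite mulr_gt0 ?sqrtr_gt0// divr_gt0// powR_gt0// mulr_gt0.
pose e : R := s * p / g.
pose C := (2 * p)^-1 * (2 `^ (1 - p) * (I / d `^ sing * (4 * A) `^ (- e))).
exists C.
  rewrite /C !mulr_gt0 ?invr_gt0 ?powR_gt0//; first by rewrite mulr_gt0.
  by rewrite mulr_gt0.
move=> k k0; rewrite /sup_gain /C -!mulrA; congr (_ * _).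
have k00 := ltW k0.
have -> : 1 + rate = (p - 1) + e by rewrite /rate /e; ring.
have kE : k `^ (p - 1 + e) = k `^ (p - 1) * k `^ e.
  by apply: powRD; apply/implyP => _; rewrite gt_eqF.
have k2 : (k / 2) `^ (p - 1) = k `^ (p - 1) * 2 `^ (1 - p).
  by rewrite powRM ?invr_ge0// -powR_inv1// -powRrM mulN1r opprB.
rewrite kE k2.
set r := (4 * A / k) `^ g^-1.
have r0 : 0 < r by rewrite powR_gt0// divr_gt0// mulr_gt0.
rewrite /kernel_mass /mass -/r.
have -> : Num.sqrt N%:R * ((2 * (r ^+ N * I)) `^ N%:R^-1 / 2) = d * r.
  have root z : 0 < z -> (2 * (z ^+ N * I)) `^ N%:R^-1 = (2 * I) `^ N%:R^-1 * z.
    move=> z0; have -> : 2 * (z ^+ N * I) = 2 * I * z ^+ N by ring.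
    rewrite (powRM _ (ltW (mulr_gt0 _ I0)))// ?exprn_ge0 ?(ltW z0)//; congr (_ * _).
    by rewrite -powR_mulrn ?(ltW z0)// -powRrM mulfV ?gt_eqF// powRr1 ?(ltW z0).
  by rewrite (root _ r0) /d; ring.
rewrite powRM ?(ltW d0) ?(ltW r0)//.
have rN : r ^+ N / r `^ sing = (4 * A) `^ (- e) * k `^ e.
  rewrite -powR_mulrn ?(ltW r0)// -powRN -powRD; last by apply/implyP => _; rewrite gt_eqF.
  have -> : N%:R - sing = - (s * p) by rewrite /sing_exp; ring.
  rewrite /r -powRrM; have -> : g^-1 * - (s * p) = - e by rewrite /e; ring.
  rewrite powRM ?invr_ge0 ?mulr_ge0 ?ltW//; congr (_ * _).
  by rewrite -powR_inv1// -powRrM mulN1r opprK.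
have -> : r ^+ N * I / (d `^ sing * r `^ sing) = I / d `^ sing * (r ^+ N / r `^ sing).
  by rewrite invfM; ring.
by rewrite rN; ring.
Qed.

Let chain_mass I h n (w : nat -> X -> R) : 0 < h ->
  (forall c, 0 < c -> (\int[mu]_x (pos (power_data A gam x - c))%:E <=
     (c * ((A / c) `^ g^-1) ^+ N * I)%:E)%E) ->
  (\forall x \ae mu, w 0%N x <= power_data A gam x) -> w 0%N \in L2 ->
  (forall i, (i < n)%N -> implicit_step s p h (w i) (w i.+1)) ->
  forall j k, (j <= n)%N -> 0 < k ->
    (mu [set x | (k / 2 < w j x)%R] <= (mass I k)%:E)%E.
Proof.
move=> h0 HI w0 w0L wS j k jn k0.
have wL i : (i <= n)%N -> w i \in L2.
  by case: i => [//|i] ilt; have [] := implicit_step_L2 h0 (wS i ilt).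
have mw := L2_measurable (wL j jn).
have c0 : 0 < k / 4 by rewrite divr_gt0.
have mp i : (i <= n)%N -> measurable_fun setT (fun x => pos (w i x - 0 - k / 4)).
  move=> ilt; apply: measurable_pos; apply: measurable_funB => //.
  by apply: measurable_funB => //; exact: L2_measurable (wL i ilt).
have step i : (i <= n)%N -> (\int[mu]_x (pos (w i x - 0 - k / 4))%:E <=
    \int[mu]_x (pos (w 0%N x - 0 - k / 4))%:E)%E.
  elim: i => [//|i IH] ilt; apply: le_trans (IH (ltnW ilt)).
  exact: (implicit_step_T_contraction p12 h0 (ltW c0) (wS i ilt)
    (implicit_step0 N s p12 h)).
have init : (\int[mu]_x (pos (w 0%N x - 0 - k / 4))%:E <=
    \int[mu]_x (pos (power_data A gam x - k / 4))%:E)%E.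
  apply: le_int_ae.
  - exact: mp.
  - by apply: measurable_pos; apply: measurable_funB => //; exact: measurable_power_data.
  - by move=> x; exact: pos_ge0.
  - by move=> x; exact: pos_ge0.
  - by apply: filterS w0 => x wx; rewrite subr0 ge_max pos_ge0 andbT le_max; apply/orP; left; lra.
have tot := le_trans (step j jn) (le_trans init (HI _ c0)).
set E := [set x | _].
have mE : measurable E.
  rewrite (_ : E = w j @^-1` `]k / 2, +oo[%classic).
    exact: preimage_measurable.
  by apply/seteqP; split=> x /=; rewrite in_itv/= andbT.
rewrite -(int_indicE mu mE).
apply: (@le_trans _ _ (\int[mu]_x (4 / k * pos (w j x - 0 - k / 4))%:E)%E).
  apply: le_int.
  - exact: measurable_indic.
  - by apply: measurable_funM => //; exact: mp.
  - by move=> x; rewrite indicE ler0n.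
  move=> x; rewrite indicE; case: (boolP (x \in E)) => [/set_mem xE|_]; last first.
    by rewrite mulr_ge0 ?pos_ge0// divr_ge0// ltW.
  rewrite mulrC -ler_pdivrMr ?divr_gt0// mul1r invf_div le_max; apply/orP; left.
  by move: xE; rewrite /E/=; lra.
rewrite (intZ mu (mp j jn) (fun x => pos_ge0 _)); last by rewrite divr_ge0// ltW.
apply: le_trans (lee_wpmul2l _ tot) _; first by rewrite lee_fin divr_ge0// ltW.
rewrite -EFinM lee_fin /mass.
have -> : A / (k / 4) = 4 * A / k by field; rewrite gt_eqF.
by rewrite !mulrA (_ : 4 / k * k / 4 = 1) ?mul1r//; field; rewrite gt_eqF.
Qed.

(** Smoothing: at each step of a chain the supremum drops at least as fast as the
    barrier. The barrier is infinite at time 0, so a bound B of the data serves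
    to start, once the steps are so short that the first value of the barrier
    exceeds B; it leaves no trace in the conclusion. *)
Lemma semigroup_sup : exists2 K : R, 0 < K & forall t f u B, 0 < t ->
  S t f u -> (\forall x \ae mu, f x <= power_data A gam x) ->
  (\forall x \ae mu, f x <= B) ->
  \forall x \ae mu, u x <= K * t `^ (- rate^-1).
Proof.
have [I I0 HI] := int_power_data_tail.
have [C C0 CE] := sup_gain_mass I0.
have [K K0 KM] := discrete_barrier rate_gt0 C0.
exists K => // t f u B t0 H fA fB; have [fL uL] := semigroup_L2 t0 H.
have [w [w0 wS wL wl]] := semigroup_chain t0 H.
have [k kn wk] := L2_subseq_ae (fun n => wL n n.+1 (leqnn _)) uL wl.
have key n : B < K * (t / n.+1%:R) `^ (- rate^-1) ->
    \forall x \ae mu, w n n.+1 x <= K * t `^ (- rate^-1).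
  set h := t / n.+1%:R => hB; have h0 : 0 < h by rewrite divr_gt0.
  pose M j := K * (j%:R * h) `^ (- rate^-1).
  have M0 j : (0 < j)%N -> 0 < M j.
    by move=> j0; rewrite mulr_gt0// powR_gt0// mulr_gt0// ltr0n.
  have step j M' : (j < n.+1)%N -> M' < M j.+1 + h * (C * M j.+1 `^ (1 + rate)) ->
      (\forall x \ae mu, w n j x <= M') -> \forall x \ae mu, w n j.+1 x <= M j.+1.
    move=> jn MM wM; have Mj := M0 j.+1 isT.
    apply: (implicit_step_sup N0 p12 s01 h0 Mj (mass_gt0 I0 Mj) (wS n j jn) wM).
      apply: (@chain_mass I h n.+1 (w n)) => //.
      - by rewrite w0.
      - by rewrite w0.
      - exact: wS.
    by rewrite CE.
  have all j : (j < n.+1)%N -> \forall x \ae mu, w n j.+1 x <= M j.+1.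
    elim: j => [|j IH] jn.
      apply: (step 0%N B) => //; last by rewrite w0.
      apply: lt_le_trans hB _.
      by rewrite /M mul1r lerDl (mulr_ge0 (ltW h0))// (mulr_ge0 (ltW C0))// powR_ge0.
    by apply: (step j.+1 (M j.+1)) => //; [exact: KM|exact: IH (ltnW jn)].
  have := all n (ltnSn n); rewrite /M.
  by have -> : n.+1%:R * h = t by rewrite /h mulrC divfK// pnatr_eq0.
have near_key : \forall n \near \oo, B < K * (t / n.+1%:R) `^ (- rate^-1).
  pose B1 := `|B| + 1; have B10 : 0 < B1 by rewrite ltr_wpDl.
  pose d := (K / B1) `^ rate; have d0 : 0 < d by rewrite powR_gt0// divr_gt0.
  have dt : 0 < d / t by rewrite divr_gt0.
  apply: filterS (near_infty_natSinv_lt (PosNum dt)) => n /= nd.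
  have hd : t / n.+1%:R < d by rewrite mulrC -ltr_pdivlMr.
  have h0 : 0 < t / n.+1%:R by rewrite divr_gt0.
  apply: (@lt_le_trans _ _ B1); first by rewrite (le_lt_trans (ler_norm _))// ltrDl.
  rewrite -ler_pdivrMl//.
  have dE : d `^ (- rate^-1) = K^-1 * B1.
    rewrite /d -powRrM mulrN mulfV ?gt_eqF// powR_inv1 ?invf_div ?divr_ge0 ?ltW//.
    by rewrite mulrC.
  rewrite -dE; apply: ler_npowR => //; last exact: ltW.
  by rewrite oppr_le0 invr_ge0 ltW.
have [n0 _ Hn0] := near_key.
have all : \forall x \ae mu, forall n, (n0 <= n)%N ->
    w (k n) (k n).+1 x <= K * t `^ (- rate^-1).
  apply/ae_foralln => n; have [nn|_] := leqP n0 n; last exact: aeW.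
  apply: filterS (key (k n) (Hn0 _ (leq_trans nn (kn n)))) => x; by [].
apply: filterS2 all wk => x xa xw; apply: (cvgr_to_le xw).
by exists n0.
Qed.

End smoothing.

(** * Truncations of the power data *)

Section bounded_support.
Context (R : realType) (N : nat).
Local Notation X := 'rV[R]_N.
Local Notation mu := (lebesgue_rV R N).
Implicit Types f : X -> R.

Lemma Lfun1P f : measurable_fun setT f -> (\int[mu]_x `|f x|%:E < +oo)%E ->
  f \in Lfun mu 1%:E.
Proof. by move=> mf fy; apply/Lfun1_integrable/integrableP; split => //; exact/measurable_EFinP. Qed.

Lemma Lfunoo_ae f M : measurable_fun setT f -> (\forall x \ae mu, `|f x| <= M) ->
  f \in Lfun mu +oo%E.
Proof.
move=> mf fM; rewrite inE; apply/andP; split; rewrite inE//=.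
rewrite /finite_norm unlock /=; case: ifPn => // _.
apply: (@le_lt_trans _ _ M%:E); last exact: ltry.
by apply/ess_supP; apply: filterS fM => x /=; rewrite lee_fin.
Qed.

Lemma Lfunoo_ae_bound f : f \in Lfun mu +oo%E ->
  exists B : R, \forall x \ae mu, `|f x| <= B.
Proof.
rewrite inE => /andP[_]; rewrite inE /= /finite_norm unlock /=.
case: ifPn => [_|mu0 _]; last first.
  exists 0; exists setT; split => //; apply/eqP; rewrite eq_le measure_ge0 andbT.
  by rewrite leNgt.
set e := ess_sup _ _ => eoo.
have : (e <= (fine e + 1)%:E)%E \/ e = -oo%E.
  by move: eoo; case: e => [r| |] //= _; [left; rewrite lee_fin lerDl|right].
case=> [|] h.
  by exists (fine e + 1); have /ess_supP := h; apply: filterS => x.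
have : (e <= 0%:E)%E by rewrite h leNye.
by move/ess_supP => h'; exists 0; apply: filterS h' => x.
Qed.

Lemma Lfun1_oo_L2 f : f \in Lfun mu 1%:E -> f \in Lfun mu +oo%E -> f \in Lfun mu 2%:E.
Proof.
move=> f1 foo; have [B fB] := Lfunoo_ae_bound foo.
have /Lfun1_integrable/integrableP[/measurable_EFinP mf fi] := f1.
apply: L2P => //; pose C := `|B| + 1.
have C0 : 0 <= C by rewrite addr_ge0.
apply: (@le_lt_trans _ _ (\int[mu]_x (C * `|f x|)%:E)%E).
  apply: le_int_ae.
  - exact: measurable_funX.
  - by apply: measurable_funM => //; exact: measurableT_comp.
  - by move=> x; exact: sqr_ge0.
  - by move=> x; rewrite mulr_ge0.
  - apply: filterS fB => x fx; rewrite -real_normK ?num_real// expr2 ler_wpM2r//.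
    by apply: le_trans fx (le_trans (ler_norm _) _); rewrite lerDl.
rewrite intZ//; last exact: measurableT_comp.
by rewrite lte_mul_pinfty ?lee_fin.
Qed.

Lemma bounded_support_int f M r : 0 <= M -> measurable_fun setT f ->
  (forall x, `|f x| <= M) -> (forall x, r < enorm x -> f x = 0) ->
  (\int[mu]_x `|f x|%:E < +oo)%E.
Proof.
move=> M0 mf fM fr.
have mI : measurable_fun setT (\1_(ball_e r) : X -> R).
  by apply: measurable_indic; exact: measurable_ball_e.
apply: (@le_lt_trans _ _ (\int[mu]_x (M * \1_(ball_e r) x)%:E)%E).
  apply: le_int => //.
  - exact: measurableT_comp.
  - exact: measurable_funM.
  move=> x; rewrite indicE; have [xr|xr] := leP (enorm x) r.
    by rewrite mem_set// mulr1.
  by rewrite fr// normr0 mulr_ge0.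
rewrite intZ//.
rewrite int_indicE; last exact: measurable_ball_e.
by rewrite lte_mul_pinfty ?lee_fin ?measure_ge0// lebesgue_ball_lty.
Qed.

End bounded_support.

Section approximants.
Context (R : realType) (N : nat) (s p : R).
Context (N0 : (0 < N)%N) (p12 : 1 < p < 2) (s01 : 0 < s < 1).
Local Notation X := 'rV[R]_N.
Local Notation mu := (lebesgue_rV R N).
Local Notation J := (gagliardo_energy s p).
Local Notation pos r := (Num.max r 0).
Context (A gam : R) (A0 : 0 < A) (gam_bound : - N%:R < gam < 0).

Let gam0 : gam < 0. Proof. by case/andP: gam_bound. Qed.

Local Notation u0 := (power_data A gam : X -> R).

(** Capping the data near the origin and lowering them by e produces a Lipschitz
    function with bounded support that is still radially decreasing. *)
Definition approximant (rho e : R) (x : X) : R :=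
  pos (A * Num.max (enorm x) rho `^ gam - e).

Local Notation G := approximant.

Lemma measurable_approximant rho e : measurable_fun setT (G rho e).
Proof.
apply: measurable_pos; apply: measurable_funB => //; apply: measurable_funM => //.
by apply: measurable_powRl; apply: measurable_maxr => //; exact: measurable_enorm.
Qed.

Lemma approximant_ge0 rho e x : 0 <= G rho e x. Proof. exact: pos_ge0. Qed.

Let maxr0 (x : X) rho : 0 < rho -> 0 < Num.max (enorm x) rho.
Proof. by move=> r0; rewrite lt_max r0 orbT. Qed.

Lemma approximant_le rho e x : 0 < rho -> 0 < e -> G rho e x <= A * rho `^ gam.
Proof.
move=> r0 e0; rewrite ge_max mulr_ge0 ?powR_ge0 ?(ltW A0)// andbT.
apply: (@le_trans _ _ (A * Num.max (enorm x) rho `^ gam)); first by rewrite gerBl ltW.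
rewrite ler_wpM2l ?(ltW A0)//; apply: ler_npowR => //; first exact: ltW.
by rewrite le_max lexx orbT.
Qed.

Lemma approximant_le_data rho e x : 0 < rho -> 0 < e -> x != 0 -> G rho e x <= u0 x.
Proof.
move=> r0 e0 x0; rewrite ge_max mulr_ge0 ?powR_ge0 ?(ltW A0)// andbT.
apply: (@le_trans _ _ (A * Num.max (enorm x) rho `^ gam)); first by rewrite gerBl ltW.
rewrite ler_wpM2l ?(ltW A0)//; apply: ler_npowR; rewrite ?enorm_gt0 ?(ltW gam0)//.
by rewrite le_max lexx.
Qed.

Lemma approximant_monotone rho e x y : 0 < rho -> enorm x <= enorm y ->
  G rho e y <= G rho e x.
Proof.
move=> r0 xy; rewrite /G ge_max pos_ge0 andbT le_max; apply/orP; left.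
rewrite lerD2r ler_wpM2l ?(ltW A0)//; apply: ler_npowR; rewrite ?(ltW gam0) ?maxr0//.
by rewrite ge_max !le_max xy lexx orbT.
Qed.

Lemma approximant_le_approximant rho e rho' e' x : 0 < rho' -> rho' <= rho -> e' <= e ->
  G rho e x <= G rho' e' x.
Proof.
move=> r0 rr ee; rewrite /G ge_max pos_ge0 andbT le_max; apply/orP; left.
rewrite lerB// ler_wpM2l ?(ltW A0)//; apply: ler_npowR; rewrite ?(ltW gam0) ?maxr0//.
by rewrite ge_max !le_max rr lexx orbT.
Qed.

Lemma approximant_eq0 rho e x : 0 < e -> (A / e) `^ (- gam)^-1 < enorm x -> G rho e x = 0.
Proof.
move=> e0 xe; apply/max_idPr; rewrite subr_le0.
have x0 : 0 < enorm x by apply: le_lt_trans xe; exact: powR_ge0.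
apply: (@le_trans _ _ (u0 x)); last exact: (power_data_small A0 gam_bound e0 xe).
rewrite ler_wpM2l ?(ltW A0)//; apply: ler_npowR; rewrite ?(ltW gam0)//.
by rewrite le_max lexx.
Qed.

Lemma powR_tangent (t : R) : 0 < t -> 1 + gam * (t - 1) <= t `^ gam.
Proof.
move=> t0; rewrite /powR gt_eqF//; apply: le_trans (expR_ge1Dx _).
rewrite lerD2l ler_nM2l//; have := le_ln1Dx (_ : -1 < t - 1).
by rewrite addrCA subrr addr0; apply; lra.
Qed.

Let powR_lipschitz rho a b : 0 < rho -> rho <= a -> rho <= b ->
  `|a `^ gam - b `^ gam| <= - gam * rho `^ gam / rho * `|a - b|.
Proof.
move=> r0; wlog ab : a b / a <= b => [hw ra rb|ra rb].
  have [h|/ltW h] := leP a b; first exact: hw.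
  by rewrite distrC (distrC a); exact: hw.
have a0 := lt_le_trans r0 ra; have b0 := lt_le_trans r0 rb.
have pba : b `^ gam <= a `^ gam by apply: ler_npowR => //; exact: ltW.
rewrite ger0_norm ?subr_ge0// distrC ger0_norm ?subr_ge0//.
have -> : b `^ gam = a `^ gam * (b / a) `^ gam.
  by rewrite -powRM ?divr_ge0 ?ltW// mulrC divfK// gt_eqF.
have := @powR_tangent (b / a) (divr_gt0 b0 a0).
have aE : b / a - 1 = (b - a) / a by field; rewrite gt_eqF.
rewrite aE => tan.
apply: (@le_trans _ _ (a `^ gam * (- gam * ((b - a) / a)))).
  rewrite -[X in X - _]mulr1 -mulrBr ler_wpM2l ?powR_ge0//; lra.
rewrite -!mulrA mulrCA ler_wpM2l ?oppr_ge0 ?(ltW gam0)//.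
apply: ler_pM; rewrite ?powR_ge0 ?divr_ge0 ?subr_ge0 ?(ltW a0)//.
  by apply: ler_npowR => //; exact: ltW.
by rewrite mulrC ler_wpM2r ?subr_ge0// lef_pV2.
Qed.

Lemma approximant_lipschitz rho e : 0 < rho -> exists2 L : R, 0 <= L &
  forall x y, `|G rho e x - G rho e y| <= L * enorm (x - y).
Proof.
move=> r0; exists (A * (- gam * rho `^ gam / rho)).
  by rewrite mulr_ge0 ?(ltW A0)// divr_ge0 ?(ltW r0)// mulr_ge0 ?powR_ge0// oppr_ge0 ltW.
move=> x y; have pos1 a b : `|pos a - pos b| <= `|a - b| :> R.
  rewrite !maxEle; do 2 case: ifP; rewrite -?ltNge => h1 h2; rewrite ?subrr ?normr0//.
  - by rewrite ler0_norm ?ler0_norm; lra.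
  - by rewrite ger0_norm ?ger0_norm; lra.
apply: le_trans (pos1 _ _) _.
rewrite opprB addrA subrK -mulrBr normrM (gtr0_norm A0) -mulrA ler_wpM2l ?(ltW A0)//.
apply: le_trans (powR_lipschitz r0 _ _) _; rewrite ?le_max ?lexx ?orbT//.
rewrite ler_wpM2l//.
  by rewrite divr_ge0 ?(ltW r0)// mulr_ge0 ?powR_ge0// oppr_ge0 ltW.
apply: le_trans _ (ler_dist_enorm x y).
rewrite !maxEle; do 2 case: ifP; rewrite -?ltNge => h1 h2 //; rewrite ?subrr ?normr0//.
- by rewrite ler0_norm ?ler0_norm; lra.
- by rewrite ger0_norm ?ger0_norm; lra.
Qed.

Let radius e : R := (A / e) `^ (- gam)^-1.

Let bound rho e x : 0 < rho -> 0 < e -> `|G rho e x| <= A * rho `^ gam.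
Proof. by move=> *; rewrite ger0_norm ?approximant_ge0// approximant_le. Qed.

Lemma approximant_energy rho e : 0 < rho -> 0 < e -> (J (G rho e) < +oo)%E.
Proof.
move=> r0 e0; have [L L0 GL] := approximant_lipschitz e r0.
have M0 : 0 <= A * rho `^ gam by rewrite mulr_ge0 ?powR_ge0 ?ltW.
have rad : 0 < radius e by rewrite powR_gt0// divr_gt0.
apply: (lipschitz_energy_lty N0 p12 s01 L0 M0 rad (measurable_approximant rho e) GL).
- by move=> x; exact: bound.
- by move=> x; exact: approximant_eq0.
Qed.

Lemma approximant_Lfun rho e : 0 < rho -> 0 < e ->
  G rho e \in Lfun mu 1%:E /\ G rho e \in Lfun mu +oo%E.
Proof.
move=> r0 e0; have M0 : 0 <= A * rho `^ gam by rewrite mulr_ge0 ?powR_ge0 ?ltW.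
split.
  apply: Lfun1P; first exact: measurable_approximant.
  apply: (bounded_support_int M0 (measurable_approximant rho e) (r := radius e)).
  - by move=> x; exact: bound.
  - by move=> x; exact: approximant_eq0.
apply: (Lfunoo_ae (M := A * rho `^ gam)); first exact: measurable_approximant.
by apply: aeW => x; exact: bound.
Qed.

Lemma approximant_L2 rho e : 0 < rho -> 0 < e -> G rho e \in Lfun mu 2%:E.
Proof. by move=> r0 e0; have [] := approximant_Lfun r0 e0; exact: Lfun1_oo_L2. Qed.

(** With the origin in the half-space, its points are no farther from the origin
    than their mirror images. *)
Lemma approximant_refl rho e v c x : 0 < rho -> v != 0 -> 0 <= c ->
  dot x v <= c -> G rho e (refl v c x) <= G rho e x.
Proof.
move=> r0 v0 c0 xc; apply: approximant_monotone => //.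
have d0 : dot (0 : X) v <= c by rewrite -(scale0r v) dotZl mul0r.
by have := enorm_refl_half v0 d0 xc; rewrite !sub0r !enormN.
Qed.

Definition approximant_seq n : X -> R := G n.+1%:R^-1 n.+1%:R^-1.

Lemma ae_neq0 : \forall x \ae mu, x != 0.
Proof.
exists [set 0]; split; [exact: measurable_rV1|exact: lebesgue_set1|].
by move=> x /= /negP; rewrite negbK => /eqP.
Qed.

Lemma approximant_seqP : approximating_sequence u0 approximant_seq.
Proof.
have n0 n : 0 < (n.+1%:R^-1 : R) by rewrite invr_gt0.
split.
- by move=> n; exact: approximant_Lfun.
- apply: aeW => x n; rewrite approximant_ge0/=; apply: approximant_le_approximant => //;
    by rewrite lef_pV2 ?posrE// ler_nat.
- apply: filterS ae_neq0 => x x0; have ex := enorm_gt0 x0.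
  have lim : u0 x - n.+1%:R^-1 @[n --> \oo] --> u0 x.
    by rewrite -[X in _ --> X]subr0; apply: cvgB; [exact: cvg_cst|exact: cvg_harmonic].
  apply: squeeze_cvgr lim (cvg_cst (u0 x)).
  apply: filterS (near_infty_natSinv_lt (PosNum ex)) => n /= /ltW nx.
  rewrite approximant_le_data// andbT /approximant_seq /approximant (max_idPl nx).
  by rewrite le_max lexx.
Qed.

End approximants.

(** * Monotone limits and the self-similar solution *)

Section monotone_limits.
Context (R : realType) (N : nat) (s p : R).
Context (p12 : 1 < p < 2).
Local Notation X := 'rV[R]_N.
Local Notation mu := (lebesgue_rV R N).
Local Notation pos r := (Num.max r 0).
Local Notation S := (semigroup_at s p).
Implicit Types (u w : X -> R) (f g : nat -> X -> R).

Lemma approximating_L2 u f n : approximating_sequence u f -> f n \in Lfun mu 2%:E.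
Proof. by move=> [/(_ n)[f1 foo] _ _]; exact: Lfun1_oo_L2. Qed.

Lemma approximating_ge0 u f n : approximating_sequence u f ->
  \forall x \ae mu, 0 <= f n x.
Proof. by move=> [_ h _]; apply: filterS h => x /(_ n) /andP[]. Qed.

Lemma approximating_le u f : approximating_sequence u f ->
  \forall x \ae mu, forall n, f n x <= u x.
Proof.
move=> [_ h1 h2]; apply: filterS2 h1 h2 => x fx fu n.
have nd : nondecreasing_seq (f ^~ x).
  by apply/nondecreasing_seqP => k; have /andP[] := fx k.
rewrite -(cvg_lim _ fu)//; apply: nondecreasing_cvgn_le => //.
by apply/cvg_ex; exists (u x).
Qed.

Lemma approximating_bounded u f n : approximating_sequence u f ->
  exists B, \forall x \ae mu, f n x <= B.
Proof.
move=> [/(_ n)[_ foo] _ _]; have [B fB] := Lfunoo_ae_bound foo.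
by exists B; apply: filterS fB => x; exact: le_trans (ler_norm _).
Qed.

Lemma approximating_semigroup_monotone t u f f' : 0 < t ->
  approximating_sequence u f -> (forall n, S t (f n) (f' n)) ->
  \forall x \ae mu, forall n, 0 <= f' n x <= f' n.+1 x.
Proof.
move=> t0 fu Sf; apply/ae_foralln => n.
have [_ fm _] := fu.
have h0 : \forall x \ae mu, 0 <= f' n x.
  exact: (semigroup_ge0 p12 t0 (Sf n) (approximating_ge0 n fu)).
have h1 : \forall x \ae mu, f' n x <= f' n.+1 x.
  by apply: (semigroup_le p12 t0 (Sf n) (Sf n.+1)); apply: filterS fm => x /(_ n) /andP[].
by apply: filterS2 h0 h1 => x -> ->.
Qed.

Lemma ae_monotone_limit f (B : R) : (forall n, measurable_fun setT (f n)) ->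
  (\forall x \ae mu, forall n, 0 <= f n x <= f n.+1 x) ->
  (\forall x \ae mu, forall n, f n x <= B) ->
  exists W : X -> R, [/\ measurable_fun setT W,
    \forall x \ae mu, f n x @[n --> \oo] --> W x,
    \forall x \ae mu, forall n, f n x <= W x & \forall x \ae mu, 0 <= W x <= B].
Proof.
move=> mf fm fB; pose l x : R := fine (limn_esup (fun n => (f n x)%:E)).
have ml : measurable_fun setT l.
  apply: measurableT_comp => //; apply: measurable_fun_limn_esup => n.
  by apply/measurable_EFinP.
have cvgx : \forall x \ae mu, nondecreasing_seq (f ^~ x) /\ cvgn (f ^~ x).
  apply: filterS2 fm fB => x fx xB.
  have nd : nondecreasing_seq (f ^~ x).
    by apply/nondecreasing_seqP => k; have /andP[] := fx k.
  by split => //; apply: nondecreasing_is_cvgn => //; exists B => _ [n _ <-].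
have cvgl : \forall x \ae mu, f n x @[n --> \oo] --> l x.
  apply: filterS cvgx => x [_ /cvg_ex[/= a ua]].
  have ua' := cvgn_EFin ua.
  suff -> : l x = a by [].
  rewrite /l is_cvg_limn_esupE; last by apply/cvg_ex; eexists; exact: ua'.
  by rewrite (cvg_lim _ ua').
have fl : \forall x \ae mu, forall n, f n x <= l x.
  apply: filterS2 cvgx cvgl => x [nd cx] fx n.
  by rewrite -(cvg_lim _ fx)//; exact: nondecreasing_cvgn_le.
exists l; split => //.
near=> x; apply/andP; split.
  have fx : forall n, 0 <= f n x <= f n.+1 x by near: x.
  have lx : forall n, f n x <= l x by near: x.
  by apply: le_trans (lx 0%N); have /andP[] := fx 0%N.
have lx : f n x @[n --> \oo] --> l x by near: x.
have xB : forall n, f n x <= B by near: x.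
by apply: (cvgr_to_le lx); apply: nearW => n.
Unshelve. all: by end_near.
Qed.

(** The semigroup bound int (S f_m - S g_n)_+ <= int (f_m - g_n)_+ compares the
    monotone limits of two approximating sequences, whatever the sequences. *)
Lemma approximating_semigroup_le t u w f g f' g' W : 0 < t ->
  approximating_sequence u f -> approximating_sequence w g ->
  (\forall x \ae mu, u x <= w x) ->
  (forall n, S t (f n) (f' n)) -> (forall n, S t (g n) (g' n)) ->
  measurable_fun setT W -> (\forall x \ae mu, forall n, g' n x <= W x) ->
  forall m, \forall x \ae mu, f' m x <= W x.
Proof.
move=> t0 fu gw uw Sf Sg mW gW m.
have f'L n : f' n \in Lfun mu 2%:E by have [] := semigroup_L2 t0 (Sf n).
have g'L n : g' n \in Lfun mu 2%:E by have [] := semigroup_L2 t0 (Sg n).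
have mf n := L2_measurable (approximating_L2 n fu).
have mg n := L2_measurable (approximating_L2 n gw).
have mf' n := L2_measurable (f'L n).
have mg' n := L2_measurable (g'L n).
pose d x := pos (f' m x - W x).
have md : measurable_fun setT d by apply: measurable_pos; exact: measurable_funB.
have mfg n : measurable_fun setT (fun x => pos (f m x - g n x - 0)).
  by apply: measurable_pos; apply: measurable_funB => //; exact: measurable_funB.
have bound n : (\int[mu]_x (d x)%:E <= \int[mu]_x (pos (f m x - g n x - 0))%:E)%E.
  apply: le_trans (semigroup_T_contraction p12 t0 (lexx 0) (Sf m) (Sg n)).
  apply: le_int_ae => //.
  - by apply: measurable_pos; apply: measurable_funB => //; exact: measurable_funB.
  - by move=> x; exact: pos_ge0.
  - by move=> x; exact: pos_ge0.
  - apply: filterS gW => x /(_ n) gx; rewrite /d ge_max pos_ge0 andbT le_max.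
    by apply/orP; left; lra.
have lim0 : (\int[mu]_x (pos (f m x - g n x - 0))%:E)%E @[n --> \oo] --> 0%E.
  have [/(_ m)[f1 _] _ fcv] := fu; have [_ gm gcv] := gw.
  have fle := approximating_le fu.
  have fi : mu.-integrable setT (EFin \o f m) by apply/Lfun1_integrable.
  have mfg' n : measurable_fun setT (fun x => (pos (f m x - g n x - 0))%:E).
    by apply/measurable_EFinP.
  have cv : {ae mu, forall x, setT x -> (pos (f m x - g n x - 0))%:E @[n --> \oo] --> 0%E}.
    apply: filterS3 gcv fle uw => x gx fx ux _.
    apply/cvgn_EFin; have fw := le_trans (fx m) ux.
    have h : `|g n x - w x| @[n --> \oo] --> 0.
      have h0 : (g n x - w x) @[n --> \oo] --> 0.
        by rewrite -(subrr (w x)); apply: cvgB gx _; exact: cvg_cst.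
      by rewrite -(@normr0 _ R); exact: cvg_norm h0.
    apply: squeeze_cvgr (cvg_cst 0) h; apply: nearW => n.
    rewrite pos_ge0 subr0 ge_max normr_ge0 andbT distrC.
    by apply: le_trans (ler_norm _); rewrite lerD2r.
  have dom : {ae mu, forall x n, setT x -> (`|(pos (f m x - g n x - 0))%:E| <= (EFin \o f m) x)%E}.
    apply: filterS2 gm (approximating_ge0 m fu) => x gx f0 n _.
    rewrite /= lee_fin ger0_norm ?pos_ge0// ge_max f0 andbT subr0 gerBl.
    by have /andP[] := gx n.
  have [_ _] := dominated_convergence measurableT mfg' (measurable_cst 0%E) cv fi dom.
  by rewrite integral0.
have d0 : (\int[mu]_x (d x)%:E = 0)%E.
  apply/eqP; rewrite eq_le; apply/andP; split; last first.
    by apply: integral_ge0 => x _; rewrite lee_fin pos_ge0.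
  apply: (cvge_to_ge lim0); apply: nearW => n; exact: bound.
have := int_eq0_ae md (fun x => pos_ge0 _) d0; apply: filterS => x dx.
by move/eqP: dx; rewrite eq_le ge_max subr_le0 => /andP[/andP[]].
Qed.

End monotone_limits.

Section profile.
Context (R : realType) (N : nat) (s p : R).
Context (N0 : (0 < N)%N) (p12 : 1 < p < 2) (s01 : 0 < s < 1).
Local Notation X := 'rV[R]_N.
Local Notation mu := (lebesgue_rV R N).
Local Notation S := (semigroup_at s p).
Context (A gam : R) (A0 : 0 < A) (gam_bound : - N%:R < gam < 0)
  (gam_sub : 0 < s * p + gam * (2 - p)).
Local Notation u0 := (power_data A gam : X -> R).
Local Notation b := (beta s p gam).
Local Notation T t := (rescale (t `^ (gam * b)) (t `^ (- b))).

Lemma beta_gt0 : 0 < b. Proof. by rewrite invr_gt0. Qed.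

Lemma rescale_rate_self_similar t : 0 < t ->
  rescale_rate s p (t `^ (gam * b)) (t `^ (- b)) = t^-1.
Proof.
move=> t0; rewrite /rescale_rate -!powRrM -powRD; last by apply/implyP => _; rewrite gt_eqF.
rewrite -[RHS]powR_inv1 ?(ltW t0)//; congr (_ `^ _).
have -> : gam * b * (p - 2) + - b * (s * p) = - ((s * p + gam * (2 - p)) * b) by ring.
by rewrite /beta mulfV// gt_eqF.
Qed.

Lemma rescale_power_data a l : 0 < l ->
  rescale a l u0 = (fun x => a * l `^ gam * u0 x).
Proof.
move=> l0; apply/funext => x; rewrite /rescale /power_data enormZ gtr0_norm//.
by rewrite powRM ?enorm_ge0 ?(ltW l0)//; ring.
Qed.

Lemma rescale_data_invariant t : 0 < t -> T t u0 = u0.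
Proof.
move=> t0; rewrite rescale_power_data ?powR_gt0//; apply/funext => x.
rewrite -powRrM -powRD; last by apply/implyP => _; rewrite gt_eqF.
by rewrite (_ : _ + _ = 0) ?powRr0 ?mul1r//; ring.
Qed.

Lemma ae_scale l (P : X -> Prop) : 0 < l -> (\forall x \ae mu, P x) ->
  \forall x \ae mu, P (l *: x).
Proof.
move=> l0; apply: (ae_preimage (c := (l^-1 ^+ N)%:E)); first exact: measurable_rVZ.
by move=> B mB; exact: lebesgue_scale.
Qed.

Lemma approximating_rescale a l (u : X -> R) (f : nat -> X -> R) : 0 < a -> 0 < l -> approximating_sequence u f ->
  approximating_sequence (rescale a l u) (fun n => rescale a l (f n)).
Proof.
move=> a0 l0 [fL fm fcv]; split.
- move=> n; have [f1 foo] := fL n; split.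
    have /Lfun1_integrable/integrableP[/measurable_EFinP mf fi] := f1.
    have mfl : measurable_fun setT (fun x : X => f n (l *: x)).
      by apply: (measurableT_comp mf); exact: measurable_rVZ.
    apply: Lfun1P; first exact: measurable_funM.
    rewrite /rescale; under eq_integral do rewrite normrM (gtr0_norm a0).
    have mn : measurable_fun setT (fun x : X => `|f n x|%:E).
      by apply/measurable_EFinP; exact: measurableT_comp.
    have n0 (x : X) : (0 <= `|f n x|%:E)%E by rewrite lee_fin.
    rewrite intZ ?(ltW a0)//; last exact: measurableT_comp.
    rewrite (integral_scale l0 mn n0) !lte_mul_pinfty ?lee_fin ?(ltW a0)//.
    by rewrite exprn_ge0 ?invr_ge0 ?(ltW l0).
  have /Lfun1_integrable/integrableP[/measurable_EFinP mf _] := f1.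
  have mfl : measurable_fun setT (rescale a l (f n)).
    by apply: measurable_funM => //; apply: (measurableT_comp mf); exact: measurable_rVZ.
  have [B fB] := Lfunoo_ae_bound foo.
  apply: (Lfunoo_ae (M := a * B)) => //.
  apply: filterS (ae_scale l0 fB) => x fx.
  by rewrite /rescale normrM gtr0_norm// ler_wpM2l// ltW.
- apply: filterS (ae_scale l0 fm) => x fx n; have /andP[f0 f1] := fx n.
  by rewrite mulr_ge0 ?(ltW a0)//= ler_wpM2l// ltW.
- by apply: filterS (ae_scale l0 fcv) => x fx; apply: cvgMl_tmp.
Qed.

Lemma data_semigroup_limit t f f' : 0 < t -> approximating_sequence u0 f ->
  (forall n, S t (f n) (f' n)) -> exists W : X -> R, exists B : R, [/\ measurable_fun setT W,
    \forall x \ae mu, f' n x @[n --> \oo] --> W x,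
    \forall x \ae mu, forall n, f' n x <= W x & \forall x \ae mu, 0 <= W x <= B].
Proof.
move=> t0 fu Sf; have [K K0 HK] := semigroup_sup N0 p12 s01 A0 gam_bound gam_sub.
have fle := approximating_le fu.
have fB n : \forall x \ae mu, f' n x <= K * t `^ (- (p - 2 + s * p / - gam)^-1).
  have [B fB] := approximating_bounded n fu.
  by apply: (HK t (f n) (f' n) B t0 (Sf n)) => //; apply: filterS fle => x.
have mf n : measurable_fun setT (f' n).
  exact: (L2_measurable (semigroup_L2 t0 (Sf n)).2).
have fB' := ae_foralln fB.
have [W HW] := ae_monotone_limit mf (approximating_semigroup_monotone p12 t0 fu Sf) fB'.
by exists W; eexists; exact: HW.
Qed.

(** F0 is the limit at time 1 for one approximating sequence. The rescaling T t
    preserves the data and takes time 1 to time t, so T t F0 is the limit at time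
    t for the rescaled sequence, and limits do not depend on the sequence. *)
Lemma profile_exists : exists F0 : X -> R, exists B : R,
  [/\ measurable_fun setT F0, \forall x \ae mu, 0 <= F0 x <= B &
   forall t f f', 0 < t -> approximating_sequence u0 f ->
    (forall n, S t (f n) (f' n)) ->
    (\forall x \ae mu, f' n x @[n --> \oo] --> T t F0 x) /\
    \forall x \ae mu, forall n, f' n x <= T t F0 x].
Proof.
have h := approximant_seqP N0 A0 gam_bound; set h_ := approximant_seq A gam in h.
have hS n : exists g, S 1 (h_ n) g.
  exact: (semigroup_exists s p12 (approximating_L2 n h) ltr01).
pose h' n := sval (cid (hS n)).
have h'S n : S 1 (h_ n) (h' n) by rewrite /h'; case: cid.
have [F0 [B [mF hF hle F0B]]] := data_semigroup_limit ltr01 h h'S.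
exists F0, B; split => // t f f' t0 fu Sf.
have a0 : 0 < t `^ (gam * b) by rewrite powR_gt0.
have l0 : 0 < t `^ (- b) by rewrite powR_gt0.
have Th : approximating_sequence u0 (fun n => T t (h_ n)).
  by have := approximating_rescale a0 l0 h; rewrite rescale_data_invariant.
have ThS n : S t (T t (h_ n)) (T t (h' n)).
  have := semigroup_scale p12 ltr01 a0 l0 (h'S n).
  by rewrite rescale_rate_self_similar// div1r invrK.
have [W [B' [mW fW fleW _]]] := data_semigroup_limit t0 fu Sf.
have mTF : measurable_fun setT (T t F0).
  by apply: measurable_funM => //; apply: (measurableT_comp mF); exact: measurable_rVZ.
have Thle : \forall x \ae mu, forall n, T t (h' n) x <= T t F0 x.
  by apply: filterS (ae_scale l0 hle) => x xh n; rewrite ler_wpM2l ?(ltW a0).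
have Tcv : \forall x \ae mu, T t (h' n) x @[n --> \oo] --> T t F0 x.
  by apply: filterS (ae_scale l0 hF) => x xh; apply: cvgMl_tmp.
have uu : \forall x \ae mu, u0 x <= u0 x by exact: aeW.
have c1 := ae_foralln (approximating_semigroup_le p12 t0 fu Th uu Sf ThS mTF Thle).
have c2 := ae_foralln (approximating_semigroup_le p12 t0 Th fu uu ThS Sf mW fleW).
split => //.
apply: filterS2 (filterI fW Tcv) (filterI c1 c2) => x [xf xT] [x1 x2].
suff -> : T t F0 x = W x by [].
apply/eqP; rewrite eq_le; apply/andP; split.
  by apply: (cvgr_to_le xT); apply: nearW.
by apply: (cvgr_to_le xf); apply: nearW.
Qed.

End profile.

(** * Radial monotonicity *)

Lemma measurable_bool_set d (T : measurableType d) (b : T -> bool) :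
  measurable_fun setT b -> measurable [set x | b x].
Proof.
move=> mb; rewrite (_ : mkset _ = b @^-1` [set true]).
  exact: (preimage_measurable mb).
by apply/seteqP; split=> x /=.
Qed.

Lemma ae_ae_swap d1 d2 (T1 : measurableType d1) (T2 : measurableType d2) (R : realType)
    (m1 : {sigma_finite_measure set T1 -> \bar R})
    (m2 : {sigma_finite_measure set T2 -> \bar R}) (B : set (T1 * T2)) : measurable B ->
  (\forall x \ae m1, \forall y \ae m2, ~ B (x, y)) ->
  \forall y \ae m2, \forall x \ae m1, ~ B (x, y).
Proof.
move=> mB h; have h0 : (m1 \x m2)%E B = 0%E.
  apply/(prod_null_xsection m1 m2 mB); apply: filterS h => x xB.
  apply/ae_measureP; first exact: measurable_xsection.
  by apply: filterS xB => y yB; rewrite /xsection/= inE.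
move/(prod_null_ysection m1 m2 mB) : h0; apply: filterS => y.
move/ae_measureP => /(_ (measurable_ysection _ mB)); apply: filterS => x.
by rewrite /ysection/= inE.
Qed.

Lemma ae_imply d (T : measurableType d) (R : realType)
    (m : {measure set T -> \bar R}) (P Q : T -> Prop) : (forall x, P x -> Q x) ->
  (\forall x \ae m, P x) -> \forall x \ae m, Q x.
Proof. by move=> PQ; apply: filterS. Qed.

Section radial.
Context (R : realType) (N : nat) (N0 : (0 < N)%N).
Local Notation X := 'rV[R]_N.
Local Notation mu := (lebesgue_rV R N).
Local Notation leb :=
  (lebesgue_measure : {sigma_finite_measure set (measurableTypeR R) -> \bar R}).
Context (F : X -> R) (mF : measurable_fun setT F).
Context (FR : forall v c, v != 0 -> 0 <= c ->
  \forall x \ae mu, dot x v <= c -> F (refl v c x) <= F x).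

Let bad (h x : X) : bool := (enorm x <= enorm (x + h)) && (F x < F (x + h)).

Let measurable_bad d (T : measurableType d) (h x : T -> X) :
  measurable_fun setT h -> measurable_fun setT x ->
  measurable_fun setT (fun t => bad (h t) (x t)).
Proof.
move=> mh mx; have mxh : measurable_fun setT (fun t => x t + h t) by exact: measurable_rVD.
apply: measurable_and.
  by apply: measurable_fun_ler; exact: measurable_enorm.
apply: measurable_fun_ltr; [exact: (measurableT_comp mF mx)|exact: (measurableT_comp mF mxh)].
Qed.

(* The hyperplane that reflects x to x + tau v has offset
   dot x v + tau |v|^2 / 2, and it has the origin on the side of x exactly
   when |x| <= |x + tau v|. *)
Let along_direction (v : X) : v != 0 ->
  \forall x \ae mu, \forall tau \ae leb, ~ (0 < tau /\ bad (tau *: v) x).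
Proof.
move=> v0; have vv := dot_gt0 v0.
pose b1 (z : measurableTypeR R * X) := [&& 0 <= z.1, dot z.2 v <= z.1 &
  F z.2 < F (refl v z.1 z.2)].
have mb1 : measurable_fun setT b1.
  have m2 : measurable_fun [set: measurableTypeR R * X] snd by exact: measurable_snd.
  have m1 : measurable_fun [set: measurableTypeR R * X] fst by exact: measurable_fst.
  have mdot : measurable_fun setT (fun z : measurableTypeR R * X => dot z.2 v).
    exact: measurable_dot.
  apply: measurable_and; first exact: measurable_fun_ler.
  apply: measurable_and; first exact: measurable_fun_ler.
  apply: measurable_fun_ltr; first exact: (measurableT_comp mF m2).
  apply: (measurableT_comp mF); rewrite /refl; apply: measurable_rVD => //.
  apply: measurable_rVZ => //; apply: measurable_funM => //.
  by apply: measurable_funM => //; exact: measurable_funB.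
have mB1 := measurable_bool_set mb1.
have h1 : \forall x \ae mu, \forall c \ae leb, ~ b1 (c, x).
  apply: (ae_ae_swap mB1); apply: aeW => c; rewrite /b1/=.
  have [c0|c0] := leP 0 c; last by apply: aeW.
  apply: filterS (FR v0 c0) => x xP /and3P[_ xv Fx]; by have := lt_le_trans Fx (xP xv); rewrite ltxx.
apply: filterS h1 => x [A [mA A0 xA]].
pose k := dot v v / 2; pose e := dot x v; have k0 : 0 < k by rewrite divr_gt0.
exists ((fun tau : measurableTypeR R => (k * tau + e)%R) @^-1` A); split.
- apply: preimage_measurable => //; apply: measurable_funD => //; exact: measurable_funM.
- have := lebesgue_affine e k0 mA; rewrite A0 => /esym/eqP.
  by rewrite mule_eq0 eqe gt_eqF//= => /eqP.
- move=> tau /= /contrapT[t0 /andP[xx Fx]]; apply: xA => /=; apply; rewrite /b1/=.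
  have -> : refl v (k * tau + e) x = x + tau *: v.
    by rewrite /refl; congr (_ + _ *: _); rewrite /k /e; field; rewrite gt_eqF.
  rewrite Fx andbT; move: xx; rewrite le_enorm_dot !dotE (dotC v x) -/e => xx.
  apply/andP; split.
    rewrite /k; have : 0 <= tau * (2 * e + tau * dot v v) by lra.
    by rewrite pmulr_rge0//; lra.
  by rewrite /e lerDr mulr_ge0 ?ltW.
Qed.

Let along_direction_swap (v : X) : v != 0 ->
  \forall tau \ae leb, \forall x \ae mu, ~ (0 < tau /\ bad (tau *: v) x).
Proof.
move=> v0; pose b2 (z : X * measurableTypeR R) := (0 < z.2) && bad (z.2 *: v) z.1.
have mb2 : measurable_fun setT b2.
  apply: measurable_and.
    by apply: measurable_fun_ltr => //; exact: measurable_snd.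
  apply: measurable_bad; last exact: measurable_fst.
  by apply: measurable_rVZ => //; exact: measurable_snd.
have := ae_ae_swap (m1 := mu) (m2 := leb) (measurable_bool_set mb2).
move=> sw; have : \forall y \ae leb, \forall x \ae mu, ~ b2 (x, y).
  apply: sw; apply: filterS (along_direction v0) => x.
  by apply: ae_imply => tau h /andP[t0 b]; exact: h.
by apply: ae_imply => tau; apply: ae_imply => x h [t0 b]; apply: h; rewrite /b2/= t0.
Qed.

Let Bad : set (X * X) := [set z | bad z.1 z.2].

Let measurable_Bad : measurable Bad.
Proof.
apply: measurable_bool_set; apply: measurable_bad; [exact: measurable_fst|exact: measurable_snd].
Qed.

Let b (h : X) : \bar R := mu (xsection Bad h).

Let b_eq0 h : b h = 0%E <-> \forall x \ae mu, ~ bad h x.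
Proof.
rewrite /b; split.
  move/ae_measureP => /(_ (measurable_xsection _ measurable_Bad)); apply: filterS => x.
  by rewrite /xsection/= inE.
move=> H; apply/ae_measureP; first exact: measurable_xsection.
by apply: filterS H => x xb; rewrite /xsection/= inE.
Qed.

(* Along every ray b vanishes at almost every point; as b is measurable, some
   dilate of b, hence b itself, vanishes almost everywhere. *)
Let b_ae0 : \forall h \ae mu, b h = 0%E.
Proof.
pose b3 (z : measurableTypeR R * X) := (0 < z.1) && (b (z.1 *: z.2) != 0%E).
have mb : measurable_fun setT b by exact: measurable_fun_xsection.
have mb3 : measurable_fun setT b3.
  apply: measurable_and.
    by apply: measurable_fun_ltr => //; exact: measurable_fst.
  have mbz : measurable_fun setT (fun z : measurableTypeR R * X => b (z.1 *: z.2)).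
    apply: (measurableT_comp mb).
    by apply: measurable_rVZ; [exact: measurable_fst|exact: measurable_snd].
  apply: measurable_neg; apply: (measurable_fun_bool true).
  rewrite setTI (_ : _ @^-1` _ = (fun z : measurableTypeR R * X => b (z.1 *: z.2)) @^-1` [set 0%E]).
    exact: (preimage_measurable mbz).
  by apply/seteqP; split=> z /= /eqP.
have h3 : \forall tau \ae leb, \forall h \ae mu, ~ b3 (tau, h).
  pose b3' (z : X * measurableTypeR R) := b3 (z.2, z.1).
  have mb3' : measurable_fun setT b3'.
    apply: (measurableT_comp mb3); apply/measurable_fun_pairP.
    by split; [exact: measurable_snd|exact: measurable_fst].
  have := ae_ae_swap (m1 := mu) (m2 := leb) (measurable_bool_set mb3').
  apply; apply: filterS (ae_neq0 R N0) => h h0.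
  apply: ae_imply (along_direction_swap h0) => tau H /andP[/= t0 /eqP]; apply.
  by apply/b_eq0; apply: filterS H => x xP bx; apply: xP.
have [tau t0 Ht] : exists2 tau : R, 0 < tau & \forall h \ae mu, ~ b3 (tau, h).
  have [Z [mZ Z0 HZ]] := h3; apply: contrapT => H.
  have : leb `]0, 1]%classic = 0%E.
    apply/eqP; rewrite eq_le measure_ge0 andbT -Z0; apply: le_measure; rewrite ?inE//.
    move=> tau /=; rewrite in_itv/= => /andP[t0 _]; apply: HZ => /= Ht.
    by apply: H; exists tau.
  have e1 : lebesgue_measure (`]0, 1]%classic : set R) = 1%E.
    by rewrite lebesgue_measure_itv/= lte_fin ltr01 sube0.
  by move=> e0; have /eqP := etrans (esym e1) e0; rewrite eqe oner_eq0.
have tV : 0 < tau^-1 by rewrite invr_gt0.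
apply: filterS (ae_scale tV Ht) => h nb; apply/eqP; apply: contra_notT nb => bh.
have E : tau *: (tau^-1 *: h) = h by rewrite scalerA mulfV ?gt_eqF// scale1r.
by apply/andP; split; [exact: t0|rewrite [_.1]/= [_.2]/= E; exact: bh].
Qed.

(** Two points x and x + h in the wrong order are exchanged by a reflection along
    h. For each reflection the hypothesis excludes almost every x; exchanging
    quantifiers by Fubini's theorem, first in the offset and then in the length of
    h along a ray, excludes almost every pair. *)
Lemma reflection_radial : \forall x \ae mu, \forall y \ae mu,
  enorm x <= enorm y -> F y <= F x.
Proof.
have h5 : \forall x \ae mu, \forall h \ae mu, ~ Bad (h, x).
  apply: (ae_ae_swap measurable_Bad); apply: filterS b_ae0 => h /b_eq0.
  by apply: filterS.
apply: filterS h5 => x hx.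
have mt : measurable_fun setT (fun y : X => y + - x) by exact: measurable_rVD.
have tr (B : set X) : measurable B -> (mu ((fun y : X => (y + - x)%R) @^-1` B) = 1 * mu B)%E.
  by move=> mB; rewrite mul1e lebesgue_rV_translate.
apply: filterS (ae_preimage mt tr hx) => y H xy; rewrite leNgt; apply/negP => Fxy.
by apply: H; rewrite /Bad/= /bad (addrC x) subrK xy.
Qed.

End radial.

(** * The continuous representative of the profile *)

Section essential_profile.
Context (R : realType) (N : nat) (N0 : (0 < N)%N).
Local Notation X := 'rV[R]_N.
Local Notation mu := (lebesgue_rV R N).
Context (F0 : X -> R) (B kap : R) (kap0 : 0 < kap).
Context (F0B : \forall x \ae mu, 0 <= F0 x <= B).
Context (F0rad : \forall x \ae mu, \forall y \ae mu, enorm x <= enorm y -> F0 y <= F0 x).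
Context (F0amp : forall l, 1 <= l -> \forall x \ae mu, F0 x <= l `^ kap * F0 (l *: x)).

Let adm rho : set R := [set M | 0 <= M /\ \forall x \ae mu, rho < enorm x -> F0 x <= M].

(** The essential supremum of F0 outside the ball of radius rho. *)
Definition ess_profile rho : R := inf (adm rho).

Local Notation Phi := ess_profile.

Let adm_lb rho : has_lbound (adm rho). Proof. by exists 0 => M []. Qed.

Let adm_bound rho : adm rho `|B|.
Proof.
split => //; apply: filterS F0B => x /andP[_ xB] _.
exact: le_trans xB (ler_norm _).
Qed.

Let adm_inf rho : has_inf (adm rho).
Proof. by split; [exists `|B|; exact: adm_bound|exact: adm_lb]. Qed.

Lemma ess_profile_le rho M : 0 <= M ->
  (\forall x \ae mu, rho < enorm x -> F0 x <= M) -> Phi rho <= M.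
Proof. by move=> M0 xM; apply: ge_inf; [exact: adm_lb|split]. Qed.

Lemma ess_profile_ge0 rho : 0 <= Phi rho.
Proof. by apply: lb_le_inf; [exists `|B|; exact: adm_bound|move=> M []]. Qed.

Lemma ess_profileP rho : \forall x \ae mu, rho < enorm x -> F0 x <= Phi rho.
Proof.
have h n : \forall x \ae mu, rho < enorm x -> F0 x <= Phi rho + n.+1%:R^-1.
  have e0 : 0 < (n.+1%:R^-1 : R) by rewrite invr_gt0.
  have [M [M0 xM] ltM] := inf_adherent e0 (adm_inf rho).
  by apply: filterS xM => x xM rx; apply: le_trans (xM rx) (ltW ltM).
apply: filterS (ae_foralln h) => x xh rx; apply/ler_addgt0Pr => e e0.
have [n _ Hn] := near_infty_natSinv_lt (PosNum e0).
by apply: le_trans (xh n rx) _; rewrite lerD2l ltW//; exact: (Hn n (leqnn n)).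
Qed.

Lemma ess_profile_anti rho rho' : rho <= rho' -> Phi rho' <= Phi rho.
Proof.
move=> rr; apply: ess_profile_le; first exact: ess_profile_ge0.
by apply: filterS (ess_profileP rho) => x xP rx; apply: xP; exact: le_lt_trans rx.
Qed.

Lemma ess_profile_scale l rho : 1 <= l -> Phi rho <= l `^ kap * Phi (l * rho).
Proof.
move=> l1; have l0 : 0 < l by exact: lt_le_trans l1.
apply: ess_profile_le; first by rewrite mulr_ge0 ?powR_ge0 ?ess_profile_ge0.
apply: filterS2 (F0amp l1) (ae_scale l0 (ess_profileP (l * rho))) => x xl xP rx.
apply: le_trans xl _; rewrite ler_wpM2l ?powR_ge0//; apply: xP.
by rewrite enormZ gtr0_norm// ltr_pM2l.
Qed.

(* Holds for any essential supremum outside a ball: the sets |x| > rho' exhaust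
   |x| > rho as rho' decreases to rho. *)
Let right_cont rho e : 0 < e -> exists2 rho', rho < rho' & Phi rho <= Phi rho' + e.
Proof.
move=> e0; apply: contrapT => H.
have H' rho' : rho < rho' -> Phi rho' <= Phi rho - e.
  move=> rr; rewrite leNgt; apply/negP => h; apply: H; exists rho' => //; lra.
have : Phi rho <= Phi rho - e; last by lra.
apply: ess_profile_le.
  have r1 : rho < rho + 1 by rewrite ltrDl.
  exact: le_trans (ess_profile_ge0 _) (H' _ r1).
have h n := ess_profileP (rho + n.+1%:R^-1).
apply: filterS (ae_foralln h) => x xh rx.
have d0 : 0 < enorm x - rho by rewrite subr_gt0.
have [n _ Hn] := near_infty_natSinv_lt (PosNum d0).
have n1 : (n.+1%:R^-1 : R) < enorm x - rho by exact: (Hn n (leqnn n)).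
apply: le_trans (xh n _) (H' _ _); first by rewrite addrC -ltrBrDr.
by rewrite ltrDl invr_gt0.
Qed.

(* Here the growth bound F0amp is needed: it compares Phi at rho / l and rho. *)
Let left_cont rho e : 0 < rho -> 0 < e ->
  exists2 rho', rho' < rho & Phi rho' <= Phi rho + e.
Proof.
move=> r0 e0; pose q := 1 + e / (Phi rho + 1).
have P1 : 0 < Phi rho + 1 by rewrite ltr_wpDl ?ess_profile_ge0.
have eP : 0 < e / (Phi rho + 1) by rewrite divr_gt0.
have q1 : 1 < q by rewrite /q ltrDl.
pose l := q `^ kap^-1.
have l1 : 1 < l.
  rewrite /l -(powR1r kap^-1); apply: gt0_ltr_powR; rewrite ?nnegrE ?invr_gt0//.
  by apply: ltW; exact: lt_trans q1.
have l0 : 0 < l by exact: lt_trans l1.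
exists (rho / l); first by rewrite ltr_pdivrMr// ltr_pMr.
apply: le_trans (ess_profile_scale _ (ltW l1)) _.
have -> : l * (rho / l) = rho by rewrite mulrC divfK// gt_eqF.
rewrite /l -powRrM mulVf ?gt_eqF// powRr1; last first.
  by apply: ltW; exact: lt_trans q1.
rewrite /q mulrDl mul1r lerD2l -mulrA ger_pMr// mulrC ler_pdivrMr// mul1r; lra.
Qed.

Definition profile (x : X) : R := Phi (enorm x).

(** Above by the supremum over |y| > q for rational q < |x|, and left continuity;
    below because almost every y with |y| > |x| has F0 y <= F0 x. *)
Lemma profile_ae : \forall x \ae mu, F0 x = profile x.
Proof.
have hq (q : rat) := ess_profileP (ratr q).
have hq' (n : nat) : \forall x \ae mu, if @unpickle rat n is Some q then
    ratr q < enorm x -> F0 x <= Phi (ratr q) else True.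
  by case: unpickle => [q|]; [exact: hq|exact: aeW].
have up := ae_foralln hq'.
apply: filterS3 up (filterI F0B (ae_neq0 R N0)) F0rad => x xq [xB x0] xrad.
have ex := enorm_gt0 x0.
apply/eqP; rewrite eq_le; apply/andP; split.
  apply/ler_addgt0Pr => e e0.
  have [rho rx Prho] := left_cont ex e0.
  have [q] := rat_in_itvoo rx; rewrite in_itv/= => /andP[rq qx].
  have := xq (pickle q); rewrite pickleK => /(_ qx) /le_trans; apply.
  by apply: le_trans Prho; apply: ess_profile_anti; exact: ltW.
apply: ess_profile_le; first by case/andP: xB.
by apply: filterS xrad => y xy lxy; apply: xy; exact: ltW.
Qed.

Lemma profile_anti x y : enorm x <= enorm y -> profile y <= profile x.
Proof. exact: ess_profile_anti. Qed.

Lemma near_enorm (x : X) d : 0 < d -> \forall y \near x, `|enorm x - enorm y| < d.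
Proof.
move=> d0; pose c := Num.sqrt N%:R + 1 : R.
have c0 : 0 < c by rewrite ltr_wpDl ?sqrtr_ge0.
have e0 : 0 < d / c by rewrite divr_gt0.
apply/nbhs_ballP; exists (d / c) => //= y xy.
apply: le_lt_trans (ler_dist_enorm _ _) _.
apply: (@le_lt_trans _ _ (Num.sqrt N%:R * (d / c))).
  apply: enorm_le_coord; first exact: ltW.
  have xy' : forall i j, ball (x i j) (d / c) (y i j) by case: xy.
  by move=> i; have := xy' ord0 i; rewrite /ball/= !mxE => /ltW.
by rewrite mulrCA gtr_pMr// ltr_pdivrMr// mul1r /c ltrDl.
Qed.

Lemma continuous_profile : continuous profile.
Proof.
move=> x; have FF : Filter (nbhs x) by exact: nbhs_filter.
apply/(cvgrPdist_le (F := nbhs x)) => e e0.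
have [r1 r1x P1] := right_cont (enorm x) e0.
have up : \forall y \near x, enorm y < r1.
  have d0 : 0 < r1 - enorm x by rewrite subr_gt0.
  apply: filterS (near_enorm x d0) => y; rewrite ltr_norml => /andP[]; lra.
have [x0|x0] := leP (enorm x) 0.
  apply: filterS up => y yr; rewrite /profile ger0_norm; last first.
    rewrite subr_ge0; apply: ess_profile_anti; exact: le_trans x0 (enorm_ge0 y).
  have := ess_profile_anti (ltW yr); lra.
have [r2 r2x P2] := left_cont x0 e0.
have dn : \forall y \near x, r2 < enorm y.
  have d0 : 0 < enorm x - r2 by rewrite subr_gt0.
  apply: filterS (near_enorm x d0) => y; rewrite ltr_norml => /andP[]; lra.
apply: filterS2 up dn => y yr ry; rewrite /profile ler_norml.
have := ess_profile_anti (ltW yr); have := ess_profile_anti (ltW ry).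
by move=> h1 h2; apply/andP; split; lra.
Qed.

End essential_profile.

(** * Asymptotics of the profile *)

Section annuli.
Context (R : realType) (N : nat) (N0 : (0 < N)%N).
Local Notation X := 'rV[R]_N.
Local Notation mu := (lebesgue_rV R N).

Definition annulus (a b : R) : set X := [set x | a < enorm x < b].

Lemma measurable_annulus a b : measurable (annulus a b).
Proof.
rewrite (_ : annulus a b = (@enorm R N) @^-1` `]a, b[%classic).
  by apply: preimage_measurable => //; exact: measurable_enorm.
by apply/seteqP; split=> x /=; rewrite in_itv.
Qed.

Lemma annulus_measure a b : 0 <= a -> a < b ->
  exists2 m : R, 0 < m & mu (annulus a b) = m%:E.
Proof.
move=> a0 ab; have mA := measurable_annulus a b.
have fin : (mu (annulus a b) < +oo)%E.
  apply: le_lt_trans (lebesgue_ball_lty N b); apply: le_measure; rewrite ?inE//.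
    exact: measurable_ball_e.
  by move=> x /andP[_ /ltW].
have one0 : const_mx 1 != 0 :> X.
  apply/eqP => /matrixP /(_ ord0 (Ordinal N0)); rewrite !mxE => /eqP.
  by rewrite oner_eq0.
pose w : X := ((a + b) / 2 / enorm (const_mx 1 : X)) *: const_mx 1.
have w0 := enorm_gt0 one0.
have ew : enorm w = (a + b) / 2.
  rewrite enormZ ger0_norm ?divr_ge0 ?(ltW w0)//; last by lra.
  by rewrite divfK// gt_eqF.
pose d := (b - a) / 4; have d0 : 0 < d by rewrite divr_gt0// subr_gt0.
have pos : (0 < mu (annulus a b))%E.
  apply: lt_le_trans (lebesgue_ball_gt0 N d0) _.
  have mB := @measurable_ball_e R N d.
  rewrite -(lebesgue_rV_translate (- w) mB); apply: le_measure; rewrite ?inE//.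
    by apply: preimage_measurable => //; exact: measurable_rVD.
  move=> x; rewrite /ball_e/= /annulus/= => xd.
  have := le_trans (ler_dist_enorm x w) xd; rewrite ew ler_norml /d => /andP[h1 h2].
  by apply/andP; split; lra.
exists (fine (mu (annulus a b))); first by rewrite fine_gt0// pos.
by rewrite fineK// ge0_fin_numE// ltW.
Qed.

Lemma le_int_on (E : set X) (h : X -> R) c (m : R) : measurable E -> mu E = m%:E -> 0 <= c ->
  measurable_fun setT h -> (forall x, 0 <= h x) ->
  (\forall x \ae mu, E x -> c <= h x) -> ((c * m)%:E <= \int[mu]_x (h x)%:E)%E.
Proof.
move=> mE Em c0 mh h0 hc.
apply: (@le_trans _ _ (\int[mu]_x (c * \1_E x)%:E)%E).
  have mI : measurable_fun setT (\1_E : X -> R) by exact: measurable_indic.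
  rewrite (intZ mu mI _ c0); last by move=> x; rewrite indicE ler0n.
  have -> : (\int[mu]_x (\1_E x)%:E = m%:E)%E by exact: etrans (int_indicE mu mE) Em.
  by rewrite -EFinM.
apply: le_int_ae => //.
- by apply: measurable_funM => //; exact: measurable_indic.
- by move=> x; rewrite mulr_ge0// indicE ler0n.
- apply: filterS hc => x xc; rewrite indicE; case: (boolP (x \in E)) => [/set_mem xE|_].
    by rewrite mulr1; exact: xc.
  by rewrite mulr0.
Qed.

End annuli.

Section asymptotics.
Context (R : realType) (N : nat) (s p : R).
Context (N0 : (0 < N)%N) (p12 : 1 < p < 2) (s01 : 0 < s < 1).
Local Notation X := 'rV[R]_N.
Local Notation mu := (lebesgue_rV R N).
Local Notation J := (gagliardo_energy s p).
Local Notation pos r := (Num.max r 0).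
Local Notation S := (semigroup_at s p).
Context (A gam : R) (A0 : 0 < A) (gam_bound : - N%:R < gam < 0)
  (gam_sub : 0 < s * p + gam * (2 - p)).
Local Notation u0 := (power_data A gam : X -> R).
Local Notation b := (beta s p gam).
Local Notation T t := (rescale (t `^ (gam * b)) (t `^ (- b))).
Local Notation G rho e := (approximant A gam rho e : X -> R).

Context (F0 : X -> R) (mF : measurable_fun setT F0).
Context (HF : forall t (f f' : nat -> X -> R), 0 < t -> approximating_sequence u0 f ->
  (forall n, S t (f n) (f' n)) ->
  (\forall x \ae mu, f' n x @[n --> \oo] --> T t F0 x) /\
  \forall x \ae mu, forall n, f' n x <= T t F0 x).
Context (Phi : R -> R) (Phi_anti : forall r r', r <= r' -> Phi r' <= Phi r).
Context (F0Phi : \forall x \ae mu, F0 x = Phi (enorm x)).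

Let b0 : 0 < b. Proof. exact: beta_gt0. Qed.
Let gam0 : gam < 0. Proof. by case/andP: gam_bound. Qed.

(* The time at which the solution shows on the unit sphere the values of the profile
   at radius r. *)
Let time (r : R) : R := r `^ (- b^-1).

Let time_gt0 r : 0 < r -> 0 < time r. Proof. exact: powR_gt0. Qed.

Let time_beta r : 0 < r -> time r `^ (- b) = r.
Proof.
move=> r0; rewrite /time -powRrM mulrNN mulVf ?gt_eqF//; apply: powRr1; exact: ltW.
Qed.

Let time_gam r : 0 < r -> time r `^ (gam * b) = r `^ (- gam).
Proof.
move=> r0; rewrite /time -powRrM; congr (_ `^ _).
by rewrite mulNr mulrCA mulVf ?gt_eqF// mulr1.
Qed.

Let time_small tau : 0 < tau -> \forall r \near +oo, 0 < r /\ time r < tau.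
Proof.
move=> t0; exists (tau `^ (- b)); split; first by rewrite num_real.
move=> r /= tr; have r0 : 0 < r by apply: le_lt_trans tr; exact: powR_ge0.
split => //; have tb : 0 < tau `^ (- b) by rewrite powR_gt0.
rewrite ltNge; apply/negP => h.
have := ler_npowR (_ : - b <= 0) t0 h; rewrite time_beta// oppr_le0 => /(_ (ltW b0)).
by rewrite leNgt tr.
Qed.

Let rescaled r : 0 < r ->
  \forall x \ae mu, T (time r) F0 x = r `^ (- gam) * Phi (r * enorm x).
Proof.
move=> r0; apply: filterS (ae_scale r0 F0Phi) => x xF.
by rewrite /rescale time_gam// time_beta// xF enormZ gtr0_norm.
Qed.

Let measurable_rescaled t : measurable_fun setT (T t F0).
Proof. by apply: measurable_funM => //; apply: (measurableT_comp mF); exact: measurable_rVZ. Qed.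

(* A lower and an integral upper bound of the solution by the evolution of a
   truncation. They pass through an approximating sequence, one of whose terms
   exceeds the truncation. *)
Let approximant_evolution rho e t : 0 < rho -> 0 < e -> 0 < t ->
  exists g, [/\ S t (G rho e) g, measurable_fun setT g,
    (\forall x \ae mu, g x <= T t F0 x) &
    (\int[mu]_x (pos (T t F0 x - g x - e))%:E <=
      \int[mu]_x (pos (u0 x - A * rho `^ gam))%:E)%E].
Proof.
move=> r0 e0 t0; have GL := approximant_L2 A0 gam_bound r0 e0.
have [g Sg] := semigroup_exists s p12 GL t0.
have mg := L2_measurable (semigroup_L2 t0 Sg).2.
have fu := approximant_seqP N0 A0 gam_bound.
have fL n := approximating_L2 n fu.
pose f' n := sval (cid (semigroup_exists s p12 (fL n) t0)).
have Sf n : S t (approximant_seq A gam n) (f' n) by rewrite /f'; case: cid.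
have mf' n := L2_measurable (semigroup_L2 t0 (Sf n)).2.
have [fT fleT] := HF t0 fu Sf.
exists g; split => //.
  have m0 : 0 < Num.min rho e by rewrite lt_min r0.
  have [n _ Hn] := near_infty_natSinv_lt (PosNum m0).
  have nm : (n.+1%:R^-1 : R) < Num.min rho e by exact: (Hn n (leqnn n)).
  have gf : \forall x \ae mu, g x <= f' n x.
    apply: (semigroup_le p12 t0 Sg (Sf n)); apply: aeW => x.
    by move: nm; rewrite lt_min => /andP[/ltW n1 /ltW n2];
      apply: (approximant_le_approximant A0 gam_bound).
  by apply: filterS2 gf fleT => x gx fx; exact: le_trans gx (fx n).
apply: (fatou_ae (f_ := fun n x => pos (f' n x - g x - e))).
- by move=> n; apply: measurable_pos; apply: measurable_funB => //; exact: measurable_funB.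
- by apply: measurable_pos; apply: measurable_funB => //; exact: measurable_funB.
- by move=> n x; exact: pos_ge0.
- by move=> x; exact: pos_ge0.
- apply: filterS fT => x fx.
  apply: (@continuous_cvg _ _ _ _ _ _ (fun r : R => pos (r - g x - e))) => //.
  apply: continuous_max; last exact: cvg_cst.
  by apply: continuousB; [apply: continuousB; [exact: cvg_id|exact: cvg_cst]|exact: cvg_cst].
- apply: nearW => n.
  apply: le_trans (semigroup_T_contraction p12 t0 (ltW e0) (Sf n) Sg) _.
  apply: le_int_ae.
  - apply: measurable_pos; apply: measurable_funB => //; apply: measurable_funB.
      exact: L2_measurable (fL n).
    exact: measurable_approximant.
  - by apply: measurable_pos; apply: measurable_funB => //; exact: measurable_power_data.
  - by move=> x; exact: pos_ge0.
  - by move=> x; exact: pos_ge0.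
  - have n0 : 0 < (n.+1%:R^-1 : R) by rewrite invr_gt0.
    apply: filterS (ae_neq0 R N0) => x x0.
    have fx := approximant_le_data A0 gam_bound n0 n0 x0.
    rewrite -/(approximant_seq A gam n) in fx.
    rewrite ge_max pos_ge0 andbT le_max.
    have Gx : A * Num.max (enorm x) rho `^ gam - e <= G rho e x by rewrite /approximant le_max lexx.
    have [xr|xr] := leP (enorm x) rho.
      by apply/orP; left; move: Gx; rewrite (max_idPr xr); lra.
    apply/orP; right; move: Gx; rewrite (max_idPl (ltW xr)).
    by rewrite -/(power_data A gam x); lra.
Qed.

Let approximant_move rho e t g C : 0 < t -> J (G rho e) = C%:E -> S t (G rho e) g ->
  (\int[mu]_x ((g x - G rho e x) ^+ 2)%:E <= (t * C)%:E)%E.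
Proof. by move=> t0 JC Sg; exact: (semigroup_energy p12 t0 Sg JC). Qed.

Let approximant_finite_energy rho e : 0 < rho -> 0 < e ->
  exists2 C : R, 0 <= C & J (G rho e) = C%:E.
Proof.
move=> r0 e0; have := approximant_energy N0 p12 s01 A0 gam_bound r0 e0.
have := gagliardo_ge0 s p12 (G rho e : X -> R).
by case: (J _) => [C| |]//; rewrite lee_fin => C0 _; exists C.
Qed.

(** Just outside the unit sphere the solution dominates the evolution of a
    truncation of the data, which has moved little in L^2 at a small time. *)
Lemma profile_asymptotics_ge e : 0 < e ->
  \forall r \near +oo, A - e <= r `^ (- gam) * Phi r.
Proof.
(* The data exceed A - e / 4 for 1 < |x| < 1 + d, by the tangent at 1. *)
move=> e0; pose d := e / (4 * A * - gam).
have d0 : 0 < d by rewrite divr_gt0// mulr_gt0 ?oppr_gt0// mulr_gt0.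
have d1 : 1 < 1 + d by rewrite ltrDl.
have e4 : 0 < e / 4 by rewrite divr_gt0.
have [C C0 JC] := approximant_finite_energy ltr01 e4.
have [m m0 Em] := annulus_measure N0 (ler01 : 0 <= 1 :> R) d1.
pose tau := (e / 2) ^+ 2 * m / (C + 1).
have C1 : 0 < C + 1 by rewrite ltr_wpDl.
have tau0 : 0 < tau by rewrite divr_gt0// mulr_gt0// exprn_gt0// divr_gt0.
apply: filterS (time_small tau0) => r [r0 rtau].
set t := time r in rtau; have t0 : 0 < t by exact: time_gt0.
rewrite leNgt; apply/negP => Y.
have [g [Sg mg gT _]] := approximant_evolution ltr01 e4 t0.
have move_ := approximant_move t0 JC Sg.
have mG : measurable_fun setT (G 1 (e / 4)) by exact: measurable_approximant.
have sqm : measurable_fun setT (fun x => (g x - G 1 (e / 4) x) ^+ 2).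
  by apply: measurable_funX; exact: measurable_funB.
have low : (((e / 2) ^+ 2 * m)%:E <= \int[mu]_x ((g x - G 1 (e / 4) x) ^+ 2)%:E)%E.
  apply: (@le_int_on _ _ (annulus 1 (1 + d)) (fun x => (g x - G 1 (e / 4) x) ^+ 2)) => //.
  - exact: measurable_annulus.
  - exact: sqr_ge0.
  - by move=> x; exact: sqr_ge0.
  apply: filterS2 gT (rescaled r0) => x gx Tx /andP[x1 xd].
  have x0 : 0 < enorm x by exact: lt_trans x1.
  have Tle : T t F0 x <= r `^ (- gam) * Phi r.
    rewrite Tx ler_wpM2l ?powR_ge0//; apply: Phi_anti.
    by rewrite ler_pMr// ltW.
  have Gge : A - e / 2 <= G 1 (e / 4) x.
    rewrite /approximant (max_idPl (ltW x1)) le_max; apply/orP; left.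
    have h1 : (1 + d) `^ gam <= enorm x `^ gam.
      by apply: ler_npowR => //; exact: ltW.
    have h2 := powR_tangent gam_bound (_ : 0 < 1 + d); rewrite ltr_wpDl// in h2.
    have h3 := h2 isT; rewrite addrAC subrr add0r in h3.
    have h4 : A * (1 + gam * d) <= A * enorm x `^ gam.
      by rewrite ler_wpM2l ?(ltW A0)//; exact: le_trans h3 h1.
    have h5 : A * (gam * d) = - (e / 4).
      by rewrite /d; field; rewrite lt_eqF//= gt_eqF.
    by move: h4; rewrite mulrDr h5; lra.
  rewrite -[leRHS]sqrrN lerXn2r ?nnegrE ?divr_ge0 ?(ltW e0)//; lra.
have := le_trans low move_; rewrite lee_fin leNgt; apply/negP; rewrite negbK.
apply: (@le_lt_trans _ _ (t * (C + 1))); first by rewrite ler_wpM2l ?(ltW t0)// lerDl.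
by rewrite -ltr_pdivlMr.
Qed.

(** Just inside the unit sphere the solution exceeds the evolution of a
    truncation G of the data, up to an integral error controlled by the mass of
    the data that the truncation misses near the origin. *)
Lemma profile_asymptotics_le e : 0 < e ->
  \forall r \near +oo, r `^ (- gam) * Phi r <= A + e.
Proof.
move=> e0; have e4 : 0 < e / 4 by rewrite divr_gt0.
have Ae : 1 < 1 + e / (4 * A) by rewrite ltrDl divr_gt0// mulr_gt0.
have Ae0 : 0 < 1 + e / (4 * A) by exact: lt_trans Ae.
(* The data are at most A + e / 4 for q < |x|. *)
pose q := (1 + e / (4 * A)) `^ gam^-1.
have q0 : 0 < q by rewrite powR_gt0.
have q1 : q < 1.
  rewrite /q -[gam]opprK invrN powRN invf_lt1 ?powR_gt0//.
  rewrite -[ltLHS](powR1r (- gam)^-1); apply: gt0_ltr_powR; rewrite ?nnegrE ?invr_gt0 ?oppr_gt0//.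
  exact: ltW.
have qg : A * q `^ gam = A + e / 4.
  rewrite /q -powRrM mulVf ?lt_eqF// powRr1 ?(ltW Ae0)//; field.
  by rewrite gt_eqF.
have [m m0 Em] := annulus_measure N0 (ltW q0) q1.
have [I I0 HI] := int_power_data_tail A0 gam_bound.
have gN : 0 < gam + N%:R by case/andP: gam_bound => h _; lra.
(* The cap radius makes the missed mass A * kap * I, and later tau makes the
   displacement, less than half of the lower bound e / 4 * m. *)
pose kap := e / 4 * m / (2 * A * I + 1).
have AI : 0 < 2 * A * I + 1 by rewrite ltr_wpDl// !mulr_ge0 ?ltW.
have kap0 : 0 < kap by rewrite divr_gt0// mulr_gt0.
pose rho := Num.min q (kap `^ (gam + N%:R)^-1).
have rho0 : 0 < rho by rewrite lt_min q0 powR_gt0.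
have rhoq : rho <= q by rewrite ge_min lexx.
pose cc := A * rho `^ gam; have cc0 : 0 < cc by rewrite mulr_gt0// powR_gt0.
have eta : (\int[mu]_x (pos (u0 x - cc))%:E <= (A * kap * I)%:E)%E.
  apply: le_trans (HI _ cc0) _; rewrite lee_fin ler_wpM2r ?(ltW I0)//.
  have -> : (A / cc) `^ (- gam)^-1 = rho.
    rewrite /cc invfM mulrA divff ?gt_eqF// mul1r -powRN -powRrM mulfV ?powRr1 ?(ltW rho0)//.
    by rewrite oppr_eq0 lt_eqF.
  rewrite /cc -mulrA ler_wpM2l ?(ltW A0)//.
  rewrite -powR_mulrn ?(ltW rho0)// -powRD; last by apply/implyP => _; rewrite gt_eqF.
  apply: (@le_trans _ _ ((kap `^ (gam + N%:R)^-1) `^ (gam + N%:R))).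
    by apply: ge0_ler_powR; rewrite ?nnegrE ?powR_ge0 ?(ltW gN) ?(ltW rho0)// ge_min lexx orbT.
  by rewrite -powRrM mulVf ?gt_eqF// powRr1// ltW.
have [C C0 JC] := approximant_finite_energy rho0 e4.
pose tau := (e / 4) ^+ 2 * m / (2 * C + 1).
have C1 : 0 < 2 * C + 1 by rewrite ltr_wpDl// mulr_ge0.
have tau0 : 0 < tau by rewrite divr_gt0// mulr_gt0// exprn_gt0.
apply: filterS (time_small tau0) => r [r0 rtau].
set t := time r in rtau; have t0 : 0 < t by exact: time_gt0.
rewrite leNgt; apply/negP => Y.
have [g [Sg mg _ gI]] := approximant_evolution rho0 e4 t0.
have move_ := approximant_move t0 JC Sg.
have mG : measurable_fun setT (G rho (e / 4)) by exact: measurable_approximant.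
pose h1 x := pos (T t F0 x - g x - e / 4).
pose h2 x := (e / 4)^-1 * (g x - G rho (e / 4) x) ^+ 2.
have mh1 : measurable_fun setT h1.
  apply: measurable_pos; apply: measurable_funB => //; apply: measurable_funB => //.
have msq : measurable_fun setT (fun x => (g x - G rho (e / 4) x) ^+ 2).
  by apply: measurable_funX; exact: measurable_funB.
have mh2 : measurable_fun setT h2 by exact: measurable_funM.
have h10 x : 0 <= h1 x by exact: pos_ge0.
have e4V : 0 < (e / 4)^-1 by rewrite invr_gt0.
have h20 x : 0 <= h2 x by rewrite mulr_ge0 ?(ltW e4V)// sqr_ge0.
have low : ((e / 4 * m)%:E <= \int[mu]_x (h1 x + h2 x)%:E)%E.
  apply: (@le_int_on _ _ (annulus q 1) (fun x => h1 x + h2 x)) => //.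
  - exact: measurable_annulus.
  - exact: ltW.
  - exact: measurable_funD.
  - by move=> x; rewrite addr_ge0.
  apply: filterS (rescaled r0) => x Tx /andP[xq x1].
  have x0 : 0 < enorm x by exact: lt_trans xq.
  have xn0 : x != 0 by apply/eqP => xE; move: x0; rewrite xE enorm0 ltxx.
  have Tge : A + e < T t F0 x.
    apply: lt_le_trans Y _; rewrite Tx ler_wpM2l ?powR_ge0//; apply: Phi_anti.
    by rewrite ger_pMr// ltW.
  have Gle : G rho (e / 4) x <= A + e / 4.
    apply: le_trans (approximant_le_data A0 gam_bound rho0 e4 xn0) _.
    rewrite -qg /power_data ler_wpM2l ?(ltW A0)//; apply: ler_npowR => //; exact: ltW.
  have [gG|gG] := leP (e / 4) (g x - G rho (e / 4) x).
    apply: (@le_trans _ _ (h2 x)); last by rewrite lerDr.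
    rewrite /h2 ler_pdivlMl// -expr2 lerXn2r ?nnegrE ?(ltW e4)//.
    exact: le_trans (ltW e4) gG.
  apply: (@le_trans _ _ (h1 x)); last by rewrite lerDl.
  by rewrite /h1 le_max; apply/orP; left; lra.
have high : (\int[mu]_x (h1 x + h2 x)%:E <= (A * kap * I + (e / 4)^-1 * (t * C))%:E)%E.
  rewrite (intD mu mh1 mh2 h10 h20) EFinD; apply: leeD; first exact: le_trans gI eta.
  rewrite (intZ mu msq (fun x => sqr_ge0 _) (ltW e4V)) EFinM.
  by apply: lee_wpmul2l => //; rewrite lee_fin ltW.
have := le_trans low high; rewrite lee_fin leNgt; apply/negP; rewrite negbK.
have half1 : A * kap * I < e / 4 * m / 2.
  have -> : A * kap * I = e / 4 * m * (A * I / (2 * A * I + 1)).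
    by rewrite /kap; field; rewrite gt_eqF.
  rewrite ltr_pM2l ?mulr_gt0// ltr_pdivrMr//.
  have AI0 : 0 < A * I by rewrite mulr_gt0.
  move: AI0; rewrite -(mulrA 2); move: (A * I) => z z0; lra.
have half2 : (e / 4)^-1 * (t * C) < e / 4 * m / 2.
  rewrite ltr_pdivrMl//; apply: (@le_lt_trans _ _ (tau * C)).
    by rewrite ler_wpM2r// ltW.
  have -> : tau * C = (e / 4) ^+ 2 * m * (C / (2 * C + 1)).
    by rewrite /tau; field; rewrite gt_eqF.
  have -> : e / 4 * (e / 4 * m / 2) = (e / 4) ^+ 2 * m * 2^-1 by ring.
  rewrite ltr_pM2l ?mulr_gt0 ?exprn_gt0// ltr_pdivrMr//; lra.
lra.
Qed.

End asymptotics.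

(** * Existence, uniqueness and properties of the profile *)

Section self_similar_profile.
Context (R : realType) (N : nat) (s p : R).
Context (N0 : (0 < N)%N) (p12 : 1 < p < 2) (s01 : 0 < s < 1).
Local Notation X := 'rV[R]_N.
Local Notation mu := (lebesgue_rV R N).
Local Notation S := (semigroup_at s p).
Context (A gam : R) (A0 : 0 < A) (gam_bound : - N%:R < gam < 0)
  (gam_sub : 0 < s * p + gam * (2 - p)).
Local Notation u0 := (power_data A gam : X -> R).
Local Notation b := (beta s p gam).
Local Notation T t := (rescale (t `^ (gam * b)) (t `^ (- b))).
Context (F0 : X -> R) (mF : measurable_fun setT F0).
Context (HF : forall t (f f' : nat -> X -> R), 0 < t -> approximating_sequence u0 f ->
  (forall n, S t (f n) (f' n)) ->
  (\forall x \ae mu, f' n x @[n --> \oo] --> T t F0 x) /\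
  \forall x \ae mu, forall n, f' n x <= T t F0 x).

Let T1 : T 1 F0 = F0.
Proof. by apply/funext => x; rewrite /rescale !powR1 mul1r scale1r. Qed.

Let evolution_at1 : exists f' : nat -> X -> R,
  [/\ forall n, S 1 (approximant_seq A gam n) (f' n),
      \forall x \ae mu, f' n x @[n --> \oo] --> F0 x &
      \forall x \ae mu, forall n, f' n x <= F0 x].
Proof.
have fu := approximant_seqP N0 A0 gam_bound.
have ex n : exists g, S 1 (approximant_seq A gam n : X -> R) g.
  exact: (semigroup_exists s p12 (approximating_L2 n fu) ltr01).
pose f' n := sval (cid (ex n)).
have Sf n : S 1 (approximant_seq A gam n) (f' n) by rewrite /f'; case: cid.
by exists f'; have [] := HF ltr01 fu Sf; rewrite T1.
Qed.

(** The truncations of the data have this property and polarization lets the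
    evolution inherit it. *)
Lemma profile_reflection v c : v != 0 -> 0 <= c ->
  \forall x \ae mu, dot x v <= c -> F0 (refl v c x) <= F0 x.
Proof.
move=> v0 c0; have [f' [Sf fF _]] := evolution_at1.
have n0 n : 0 < (n.+1%:R^-1 : R) by rewrite invr_gt0.
have fr n : \forall x \ae mu, dot x v <= c -> f' n (refl v c x) <= f' n x.
  apply: (semigroup_polar p12 s01 ltr01 v0 (Sf n)); apply: aeW => x xc.
  exact: (approximant_refl A0 gam_bound _ (n0 n) v0 c0 xc).
apply: filterS3 (ae_foralln fr) fF (ae_refl c v0 fF) => x xr xF xF' xc.
by apply: ler_cvg_to xF' xF _; apply: nearW => n; exact: xr.
Qed.

(** For this exponent the dilation u |-> l^kap u (l x) leaves time unchanged, and
    it increases the data when l >= 1. *)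
Lemma profile_amplification l : 1 <= l ->
  \forall x \ae mu, F0 x <= l `^ (s * p / (2 - p)) * F0 (l *: x).
Proof.
move=> l1; have l0 : 0 < l by exact: lt_le_trans l1.
have [p1 p2] := andP p12; have q0 : 0 < 2 - p by lra.
pose kap := s * p / (2 - p); pose a := l `^ kap.
have a0 : 0 < a by rewrite powR_gt0.
have rate : rescale_rate s p a l = 1.
  rewrite /rescale_rate /a -powRrM -powRD; last by apply/implyP => _; rewrite gt_eqF.
  rewrite (_ : _ + _ = 0) ?powRr0// /kap; field; rewrite gt_eqF//.
have [f' [Sf fF fleF]] := evolution_at1.
have fu := approximant_seqP N0 A0 gam_bound.
have Sg n : S 1 (rescale a l (approximant_seq A gam n)) (rescale a l (f' n)).
  by have := semigroup_scale p12 ltr01 a0 l0 (Sf n); rewrite rate divr1.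
have gw := approximating_rescale a0 l0 fu.
have uw : \forall x \ae mu, u0 x <= rescale a l u0 x.
  apply: aeW => x; rewrite rescale_power_data// ler_peMl ?power_data_ge0//.
  rewrite /a -powRD; last by apply/implyP => _; rewrite gt_eqF.
  rewrite -[leLHS](powRr0 l); apply: ler_powR => //.
  rewrite /kap -(ler_pM2r q0) mul0r mulrDl divfK ?gt_eqF//; exact: ltW.
have mW : measurable_fun setT (rescale a l F0).
  by apply: measurable_funM => //; apply: (measurableT_comp mF); exact: measurable_rVZ.
have gW : \forall x \ae mu, forall n, rescale a l (f' n) x <= rescale a l F0 x.
  by apply: filterS (ae_scale l0 fleF) => x xf n; rewrite ler_wpM2l ?(ltW a0).
have h := ae_foralln (approximating_semigroup_le p12 ltr01 fu gw uw Sf Sg mW gW).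
by apply: filterS2 fF h => x xF xh; apply: (cvgr_to_le xF); exact: nearW.
Qed.

Context (F : X -> R) (F0F : \forall x \ae mu, F0 x = F x).
Local Notation u := (self_similar s p gam F).

Let TF t : 0 < t -> \forall x \ae mu, T t F0 x = u t x.
Proof.
move=> t0; have l0 : 0 < t `^ (- b) by rewrite powR_gt0.
by apply: filterS (ae_scale l0 F0F) => x xF; rewrite /rescale xF.
Qed.

Lemma self_similar_limit f : approximating_sequence u0 f ->
  limit_of_semigroup_solutions s p f u.
Proof.
move=> fu; have fL n := approximating_L2 n fu.
have ex n t : exists g, 0 < t -> S t (f n) g.
  have [t0|t0] := ltP 0 t; last by exists (f n).
  by have [g Sg] := semigroup_exists s p12 (fL n) t0; exists g.
pose g n t := sval (cid (ex n t)).
have gS n t : 0 < t -> S t (f n) (g n t) by rewrite /g; case: cid.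
pose v n t := if 0 < t then g n t else f n.
have vS n t : 0 < t -> S t (f n) (v n t) by move=> t0; rewrite /v t0; exact: gS.
exists v; split.
  by move=> n; split; [exact: fL|rewrite /v ltxx|move=> t; exact: vS].
move=> t t0; have [h _] := HF t0 fu (fun n => vS n t t0).
by apply: filterS2 h (TF t0) => x + <-.
Qed.

Lemma self_similar_unique_minimal : unique_minimal_solution s p u0 u.
Proof.
split; last exact: self_similar_limit.
exists (approximant_seq A gam); first exact: approximant_seqP.
by apply: self_similar_limit; exact: approximant_seqP.
Qed.

Lemma self_similar_profile_unique (H : X -> R) :
  minimal_solution s p u0 (self_similar s p gam H) -> \forall y \ae mu, H y = F y.
Proof.
move=> [f fu [v [vS vH]]].
have Sf n : S 1 (f n) (v n 1) by have [_ _ h] := vS n; exact: h.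
have [h _] := HF ltr01 fu Sf.
apply: filterS3 h (vH 1 ltr01) F0F => x; rewrite T1 /self_similar !powR1 mul1r scale1r.
by move=> h1 h2 <-; exact: cvg_unique h2 h1.
Qed.

End self_similar_profile.

Section norms.
Context (R : realType) (N : nat).
Local Notation X := 'rV[R]_N.
Local Notation mu := (lebesgue_rV R N).

(** Every ball around the origin has positive measure, so continuity there makes
    the maximum an essential supremum. *)
Lemma Loo_norm_max (f : X -> R) : continuous f -> (forall x, 0 <= f x <= f 0) ->
  ('N[mu]_+oo[EFin \o f] = (f 0)%:E)%E.
Proof.
move=> cf f0; have muT : (0 < mu setT)%E.
  apply: lt_le_trans (lebesgue_ball_gt0 N (ltr01 : 0 < 1 :> R)) _.
  by apply: le_measure; rewrite ?inE//; exact: measurable_ball_e.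
rewrite unlock /= muT; apply/eqP; rewrite eq_le; apply/andP; split.
  apply/ess_supP; apply: aeW => x /=; rewrite lee_fin.
  by have /andP[h1 h2] := f0 x; rewrite ger0_norm.
apply/lee_subgt0Pr => e e0; rewrite leNgt; apply/negP => lt.
have : (ess_sup mu (abse \o (EFin \o f)) <= (f 0 - e)%:E)%E by exact: ltW.
move/ess_supP => fe.
have FF : Filter (nbhs (0 : X)) by exact: nbhs_filter.
have /(cvgrPdist_lt (F := nbhs (0 : X))) /(_ _ e0) := cf 0.
move=> /nbhs_ballP[d /= d0 Hd].
have hB : (0 < mu (ball_e (d / 2)))%E by apply: lebesgue_ball_gt0; rewrite divr_gt0.
have [Z [mZ Z0 HZ]] := fe.
have : (mu (ball_e (d / 2)) <= mu Z)%E.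
  apply: le_measure; rewrite ?inE//; first exact: measurable_ball_e.
  move=> x xd; apply: HZ => /= h; rewrite lee_fin in h.
  have xB : ball (0 : X) d x.
    split => // i j; rewrite /ball/= mxE sub0r normrN.
    rewrite (ord1 i); apply: le_lt_trans (coord_le_enorm x j) _.
    by apply: le_lt_trans xd _; rewrite ltr_pdivrMr// ltr_pMr// ltr1n.
  have := Hd _ xB; rewrite /= => h2; move: h; rewrite ger0_norm; last by have /andP[] := f0 x.
  move: h2; rewrite ltr_norml => /andP[_ h3] h4; clear -h3 h4; lra.
by rewrite Z0 leNgt hB.
Qed.

End norms.

Section main.
Context (R : realType) (N : nat) (s p : R).
Context (N0 : (0 < N)%N) (p12 : 1 < p < 2) (s01 : 0 < s < 1).
Local Notation X := 'rV[R]_N.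
Local Notation mu := (lebesgue_rV R N).

Let sp0 : 0 < s * p.
Proof. by have [s0 _] := andP s01; have [p1 _] := andP p12; rewrite mulr_gt0//; lra. Qed.

Let q0 : 0 < 2 - p. Proof. by have [_ p2] := andP p12; lra. Qed.

Lemma gamma2_lt0 : gamma2 N s p < 0.
Proof. by rewrite /gamma2 gt_max !oppr_lt0 ltr0n N0/= divr_gt0. Qed.

Lemma gamma2_range gam : gamma2 N s p < gam < 0 ->
  - N%:R < gam < 0 /\ 0 < s * p + gam * (2 - p).
Proof.
rewrite /gamma2 gt_max => /andP[/andP[-> h] ->]; split => //.
by move: h; rewrite -(ltr_pM2r q0) mulNr divfK ?gt_eqF//; lra.
Qed.

Lemma alpha_lt gam : gamma2 N s p < gam < 0 -> `|gam| / (s * p) < alpha s p gam.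
Proof.
move=> /gamma2_range[/andP[_ g0] gs]; rewrite /alpha /beta ltr_pM2l ?normr_gt0 ?lt_eqF//.
by rewrite ltf_pV2 ?posrE// gtrDl nmulr_rlt0.
Qed.

Lemma alpha_increasing gam gam' : gamma2 N s p < gam < 0 -> gamma2 N s p < gam' < 0 ->
  `|gam| < `|gam'| -> 0 < alpha s p gam < alpha s p gam'.
Proof.
move=> /gamma2_range[/andP[_ g0] gs] /gamma2_range[/andP[_ g0'] gs'].
rewrite /alpha (ltr0_norm g0) (ltr0_norm g0') ltrN2 => gg.
have h : gam' * (2 - p) < gam * (2 - p) by rewrite ltr_pM2r.
apply/andP; split; first by rewrite mulr_gt0 ?invr_gt0// oppr_gt0.
apply: (@lt_trans _ _ (- gam' / (s * p + gam * (2 - p)))).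
  by rewrite ltr_pM2r ?invr_gt0// ltrN2.
by rewrite ltr_pM2l ?oppr_gt0// ltf_pV2 ?posrE// ltrD2l.
Qed.

Lemma self_similar_solution gam A : gamma2 N s p < gam < 0 -> 0 < A ->
  exists F : X -> R, let u := self_similar s p gam F in
  [/\ unique_minimal_solution s p (power_data A gam) u,
      (forall G : X -> R,
        minimal_solution s p (power_data A gam) (self_similar s p gam G) ->
        \forall y \ae mu, G y = F y),
      continuous F,
      (forall x y : X, enorm x <= enorm y -> F y <= F x) &
      forall e, 0 < e -> \forall r \near +oo, forall y, r <= enorm y ->
          `|F y / (A * enorm y `^ gam) - 1| <= e].
Proof.
move=> hgam A0; have [gam_bound gam_sub] := gamma2_range hgam.
have [F0 [B [mF F0B HF]]] := profile_exists N0 p12 s01 A0 gam_bound gam_sub.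
have kap0 : 0 < s * p / (2 - p) by rewrite divr_gt0.
have F0refl := profile_reflection N0 p12 s01 A0 gam_bound HF.
have F0rad := reflection_radial N0 mF F0refl.
have F0amp := profile_amplification N0 p12 A0 gam_bound gam_sub mF HF.
have F0F := profile_ae N0 kap0 F0B F0rad F0amp.
have Panti := ess_profile_anti F0B.
exists (profile F0); split.
- exact: (self_similar_unique_minimal N0 p12 A0 gam_bound HF F0F).
- by move=> G; apply: (self_similar_profile_unique HF F0F).
- exact: (continuous_profile kap0 F0B F0amp).
- by move=> x y; exact: (profile_anti F0B).
- move=> e e0; have Ae : 0 < A * e by rewrite mulr_gt0.
  have lo := profile_asymptotics_ge N0 p12 s01 A0 gam_bound gam_sub mF HF Panti F0F Ae.
  have hi := profile_asymptotics_le N0 p12 s01 A0 gam_bound gam_sub mF HF Panti F0F Ae.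
  have [M [_ HM]] := filterI lo hi.
  exists (Num.max M 0); split; first by rewrite num_real.
  move=> r; rewrite gt_max => /andP[Mr r0] y ry.
  have y0 : 0 < enorm y by exact: lt_le_trans ry.
  have [h1 h2] := HM _ (lt_le_trans Mr ry).
  have -> : profile F0 y / (A * enorm y `^ gam) =
      enorm y `^ (- gam) * ess_profile F0 (enorm y) / A.
    by rewrite powRN /profile; field; rewrite !gt_eqF// powR_gt0.
  rewrite ler_norml lerBlDr lerBrDr ler_pdivlMr// ler_pdivrMr//.
  by apply/andP; split; lra.
Qed.

(** Far away F is comparable to a positive power, and it only grows towards the
    origin. *)
Lemma asymptotic_positive gam A (F : X -> R) : 0 < A ->
  (forall x y : X, enorm x <= enorm y -> F y <= F x) ->
  (forall e, 0 < e -> \forall r \near +oo, forall y, r <= enorm y ->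
    `|F y / (A * enorm y `^ gam) - 1| <= e) -> forall y, 0 < F y.
Proof.
move=> A0 Fmon Fas y; have h0 : 0 < 2^-1 :> R by rewrite invr_gt0.
have [M [_ HM]] := Fas _ h0.
have one0 : const_mx 1 != 0 :> X.
  apply/eqP => /matrixP /(_ ord0 (Ordinal N0)); rewrite !mxE => /eqP.
  by rewrite oner_eq0.
pose r := Num.max (Num.max M (enorm y)) 0 + 1.
have rM : M < r by rewrite /r ltr_pwDr// !le_max lexx.
have ry : enorm y <= r by rewrite /r ler_wpDr// !le_max lexx orbT.
have r0 : 0 < r by rewrite ltr_pwDr// le_max lexx orbT.
pose w : X := (r / enorm (const_mx 1 : X)) *: const_mx 1.
have w0 := enorm_gt0 one0.
have ew : enorm w = r.
  by rewrite enormZ ger0_norm ?divr_ge0 ?(ltW w0) ?(ltW r0)// divfK// gt_eqF.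
have := HM r rM w; rewrite ew lexx => /(_ isT); rewrite ler_norml => /andP[h _].
have q : 0 < F w / (A * r `^ gam) by lra.
apply: lt_le_trans (Fmon y w _); last by rewrite ew.
by move: q; rewrite pmulr_lgt0// invr_gt0 mulr_gt0// powR_gt0.
Qed.

End main.

Theorem theorem7p1 (R : realType) (N : nat) (s p : R)
    (hN : (1 <= N)%N) (hp : 1 < p < 2) (hs : 0 < s < 1) :
  gamma2 N s p < 0 /\
  (forall gamma A : R, gamma2 N s p < gamma < 0 -> 0 < A ->
    0 < beta s p gamma /\ gamma * beta s p gamma < 0 /\
    exists F : 'rV[R]_N -> R,
      let u := self_similar s p gamma F in
      (* (i) *)
      [/\ unique_minimal_solution s p (power_data A gamma) u,
          (forall G : 'rV[R]_N -> R,
            minimal_solution s p (power_data A gamma)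
              (self_similar s p gamma G) ->
            \forall y \ae lebesgue_rV R N, G y = F y),
          continuous F,
          (forall y, 0 < F y) &
          [bounded F y | y in [set: 'rV[R]_N]]] /\
      (* (ii) *)
      [/\ (forall x y : 'rV[R]_N, enorm x <= enorm y -> F y <= F x),
          (forall t x, 0 < t -> u t x <= u t 0),
          (forall t, 0 < t -> u t 0 = F 0 * t `^ (- alpha s p gamma)),
          (forall t, 0 < t ->
            'N[lebesgue_rV R N]_+oo[EFin \o u t]%E =
            (F 0 * t `^ (- alpha s p gamma))%:E) &
          `|gamma| / (s * p) < alpha s p gamma] /\
      (* (iii) *)
      (forall r : R, [bounded F y | y in [set y : 'rV[R]_N | enorm y <= r]]) /\
      (forall e : R, 0 < e -> \forall r \near +oo,
        forall y : 'rV[R]_N, r <= enorm y ->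
          `|F y / (A * enorm y `^ gamma) - 1| <= e)) /\
  (forall gamma gamma' : R,
    gamma2 N s p < gamma < 0 -> gamma2 N s p < gamma' < 0 ->
    `|gamma| < `|gamma'| -> 0 < alpha s p gamma < alpha s p gamma').

Proof.
split; first exact: (gamma2_lt0 hN hp hs).
split; last by move=> gamma gamma'; exact: (alpha_increasing hp).
move=> gamma A hgam A0; have [/andP[_ g0] gs] := gamma2_range hp hgam.
have b0 : 0 < beta s p gamma by rewrite invr_gt0.
split => //; split; first by rewrite nmulr_rlt0.
have [F [umin uniq cF Fmon Fas]] := self_similar_solution hN hp hs hgam A0.
have Fpos := asymptotic_positive hN A0 Fmon Fas.
have F0max y : F y <= F 0 by apply: Fmon; rewrite enorm0 enorm_ge0.
have Fbnd (Y : set 'rV[R]_N) : [bounded F y | y in Y].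
  exists (F 0); split; first by rewrite num_real.
  by move=> M FM y _ /=; rewrite gtr0_norm//; exact: le_trans (F0max y) (ltW FM).
have u0E t : self_similar s p gamma F t 0 = F 0 * t `^ (- alpha s p gamma).
  by rewrite /self_similar scaler0 mulrC /alpha ltr0_norm// mulNr opprK.
have ule t x : self_similar s p gamma F t x <= self_similar s p gamma F t 0.
  by rewrite /self_similar scaler0 ler_wpM2l ?powR_ge0.
exists F; split; first by [].
split; last by split.
split => //; last exact: (alpha_lt hp hs hgam).
move=> t t0; rewrite -u0E; apply: Loo_norm_max; last first.
  by move=> x; rewrite ule andbT mulr_ge0 ?powR_ge0 ?ltW.
move=> x; have FF : Filter (nbhs x) by exact: nbhs_filter.
have lim : F (t `^ (- beta s p gamma) *: y) @[y --> x] --> F (t `^ (- beta s p gamma) *: x).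
  apply: (@continuous_comp _ _ _ (fun y : 'rV[R]_N => t `^ (- beta s p gamma) *: y) F);
    [exact: scaler_continuous|exact: cF].
apply: (@cvgMl_tmp R _ (nbhs x) FF (fun y : 'rV[R]_N => F (t `^ (- beta s p gamma) *: y)) (t `^ (gamma * beta s p gamma)) _ lim).
Qed.
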